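(* Let $n\ge1$, $m\in\{1,\dots,n\}$ and let $E \subset \mathbb{R}^n$ be a non-empty bounded set. Then, for all $V \in G(n, m)$, $$\underline{\dim}_{\,\theta}\, \pi_V E \leq \underline{\dim}_{\,\theta}^{\,m} E \quad\text{and}\quad \overline{\dim}_{\,\theta}\, \pi_V E \leq \overline{\dim}_{\,\theta}^{\,m} E$$ for all $\theta\in (0,1]$. Moreover, for $\gamma_{n, m}$-almost all $V \in G(n, m)$, $$\underline{\dim}_{\,\theta}\, \pi_V E = \underline{\dim}_{\,\theta}^{\,m} E \quad\text{and}\quad \overline{\dim}_{\,\theta}\, \pi_V E = \overline{\dim}_{\,\theta}^{\,m} E$$ for all $\theta\in (0,1]$ (that is, the exceptional null set of $V$ does not depend on $\theta$).
   Context: $G(n,m)$ is the Grassmannian of $m$-dimensional linear subspaces of $\mathbb{R}^n$, $\gamma_{n,m}$ its natural (rotation-)invariant probability measure, and $\pi_V:\mathbb{R}^n\to V$ is orthogonal projection onto $V$. Intermediate dimensions. $|U|$ denotes the diameter of a set $U$; covers are countable (finite or infinite). For $F\subset\mathbb{R}^n$ and $0<\theta\le 1$, the lower intermediate dimension $\underline{\dim}_{\,\theta}F$ is the infimum of all $s\ge 0$ such that for all $\epsilon>0$ and all $r_0>0$ there exist $0<r\le r_0$ and a cover $\{U_i\}$ of $F$ with $r^{1/\theta}\le |U_i|\le r$ for all $i$ and $\sum_i |U_i|^s\le\epsilon$. The upper intermediate dimension $\overline{\dim}_{\,\theta}F$ is the infimum of all $s\ge 0$ such that for all $\epsilon>0$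 there exists $r_0>0$ such that for all $0<r\le r_0$ there is a cover $\{U_i\}$ of $F$ with $r^{1/\theta}\le |U_i|\le r$ for all $i$ and $\sum_i |U_i|^s\le\epsilon$. Kernels and capacities. For $\theta\in(0,1]$, $m\in\{1,\dots,n\}$, $0\le s\le m$ and $0<r<1$, define for $x\in\mathbb{R}^n$ $$\phi_{r,\theta}^{s,m}(x)=\begin{cases}1 & 0\le|x|<r\\ (r/|x|)^s & r\le|x|<r^\theta\\ r^{\theta(m-s)+s}/|x|^m & r^\theta\le|x|.\end{cases}$$ For compact non-empty $E$ let $\mathcal{M}(E)$ be the set of Borel probability measures supported on $E$. The capacity of $E$ is $$C_{r,\theta}^{s,m}(E)=\Big(\inf_{\mu\in\mathcal{M}(E)}\int\!\!\int\phi_{r,\theta}^{s,m}(x-y)\,d\mu(x)\,d\mu(y)\Big)^{-1}.$$ For bounded, not necessarily closed, $E$ the capacity is defined to be that of the closure of $E$. Dimension profiles. The lower intermediate dimension profile $\underline{\dim}_{\,\theta}^{\,m}E$ is the unique $s\in[0,m]$ such that $\liminf_{r\to0}\frac{\log C_{r,\theta}^{s,m}(E)}{-\log r}=s$, and the upper intermediate dimension profile $\overline{\dim}_{\,\theta}^{\,m}E$ is the unique $s\in[0,m]$ such that $\limsup_{r\to0}\frac{\log C_{r,\theta}^{s,m}(E)}{-\log r}=s$ (such unique values exist). *)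

(* Defs.v *)
From HB Require Import structures.
From mathcomp Require Import all_boot all_order all_algebra.
From mathcomp Require Import all_classical all_reals all_analysis.

Set Implicit Arguments.
Unset Strict Implicit.
Unset Printing Implicit Defensive.

Import Order.TTheory GRing.Theory Num.Theory.
Import numFieldNormedType.Exports.

Local Open Scope classical_set_scope.
Local Open Scope ring_scope.

Notation borel T := (g_sigma_algebraType (@open T)).

(* R^n is 'rV[R]_n. Its library topology (entrywise convergence) is the
   Euclidean one, but its library norm is the sup norm, so the Euclidean inner
   product and norm are introduced separately. *)

Section Euclid.
Context {R : realType} {n : nat}.
Implicit Types (u v x : 'rV[R]_n) (V : {vspace 'rV[R]_n}).

Definition dot u v : R := \sum_(i < n) u 0 i * v 0 i.

Fact dot_is_hermitian u v : dot u v = (-1) ^+ false * idfun (dot v u).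
Proof. by rewrite expr0 mul1r; apply: eq_bigr => i _; rewrite mulrC. Qed.

Fact dot_is_bilinear :
  bilinear_for (GRing.Scale.Law.clone _ _ *%R _)
    (GRing.Scale.Law.clone _ _ (@idfun R \; *%R) _) dot.
Proof.
have dotl w : linear_for *%R (dot ^~ w).
  move=> a u v; rewrite /dot /= mulr_sumr -big_split /=.
  by apply: eq_bigr => i _; rewrite !mxE mulrDl mulrA.
split=> // u a v w /=.
by rewrite ![dot u _]dot_is_hermitian !expr0 !mul1r /= dotl.
Qed.

HB.instance Definition _ := bilinear_isBilinear.Build R _ _ _ _ _ dot
  dot_is_bilinear.

HB.instance Definition _ := @isHermitianSesquilinear.Build R _ false idfun dot
  dot_is_hermitian.

Definition enorm x : R := Num.sqrt (dot x x).

(* The library's [projv] projects along an arbitrary complement. *)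
Definition orthoproj V : 'End('rV[R]_n) := daddv_pi V (orthov dot V).

Lemma dot_eq0 x : dot x x = 0 -> x = 0.
Proof.
move=> /eqP; rewrite psumr_eq0; last by move=> i _; rewrite -expr2 sqr_ge0.
move=> /allP x0; apply/rowP => i; rewrite mxE.
by have /(_ (mem_index_enum i)) := x0 i; rewrite mulf_eq0 orbb => /eqP.
Qed.

Lemma capv_orthov V : (V :&: orthov dot V = 0)%VS.
Proof.
apply/eqP; rewrite -subv0; apply/subvP => x; rewrite memv_cap memv0.
by case/andP=> xV /mem_orthovP/(_ x xV) /dot_eq0 ->.
Qed.

Lemma addv_orthov V : (V + orthov dot V = fullv)%VS.
Proof.
apply/eqP; rewrite eqEdim subvf dimv_disjoint_sum ?capv_orthov //.
pose f (u : 'rV[R]_n) : 'rV[R]_(\dim V) := \row_i dot u (vbasis V)`_i.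
have flin : linear f.
  move=> a u v; apply/rowP => i; rewrite !mxE.
  by rewrite linearPl.
pose fL := GRing.isLinear.Build R _ _ _ f flin.
pose F : {linear 'rV[R]_n -> 'rV[R]_(\dim V)} := HB.pack f fL.
rewrite -(limg_ker_dim (linfun F) fullv) capfv addnC leq_add //.
  apply: leq_trans (dimvS (subvf _)) _.
  by rewrite dimvf /dim /= mul1n.
apply: dimvS; apply/subvP => u; rewrite memv_ker lfunE /= => /eqP/rowP fu0.
apply/mem_orthovP => v /coord_vbasis ->; rewrite linear_sumr big1 //= => i _.
by rewrite linearZr /=; have := fu0 i; rewrite !mxE => ->; rewrite mulr0.
Qed.

Lemma orthoprojP V x :
  orthoproj V x \in V /\ {in V, forall v, dot (x - orthoproj V x) v = 0}.
Proof.
split; first exact: memv_pi.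
apply/mem_orthovP.
have := daddv_pi_add (capv_orthov V) (_ : x \in (V + orthov dot V)%VS).
rewrite addv_orthov memvf => /(_ isT) {1}<-.
by rewrite addrC addKr memv_pi.
Qed.

End Euclid.

Section Grassmannian.
Context {R : realType} {n m : nat}.

Definition Gr (_ : (m <= n)%N) : Type :=
  {V : {vspace 'rV[R]_n} | \dim V == m}.

Variable le_mn : (m <= n)%N.
Local Notation G := (Gr le_mn).

HB.instance Definition _ := Choice.on G.

Lemma Gr_witness : \dim <<take m (vbasis {: 'rV[R]_n})>>%VS == m.
Proof.
have : free (vbasis {: 'rV[R]_n}) by exact: basis_free (vbasisP _).
rewrite -{1}(cat_take_drop m (vbasis _)) => /catl_free.
rewrite /free => /eqP ->; rewrite size_takel // size_tuple dimvf /dim /=.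
by rewrite mul1n.
Qed.

HB.instance Definition _ := isPointed.Build G
  (exist (fun V : {vspace 'rV[R]_n} => \dim V == m) _ Gr_witness).

(* The topology induced by the identification of a subspace with the matrix of
   the orthogonal projection onto it, i.e. that of the metric
   |pi_V - pi_W|. *)
Definition Gr_mx (V : G) : 'M[R]_n := lin1_mx (orthoproj (val V)).

HB.instance Definition _ := Topological.copy G (initial_topology Gr_mx).

Definition rotate (Q : 'M[R]_n) (V : G) : G :=
  insubd V (linfun (mulmxr Q) @: val V)%VS.

Lemma val_rotate Q V : Q \in unitmx ->
  val (rotate Q V) = (linfun (mulmxr Q) @: val V)%VS.
Proof.
move=> uQ; rewrite val_insubd limg_dim_eq ?(eqP (valP V)) ?eqxx //.
apply/eqP; rewrite -subv0; apply/subvP => x.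
rewrite memv_cap memv_ker lfunE /= memv0 => /andP[_ /eqP xQ0].
by rewrite -(mulmxK uQ x) xQ0 mul0mx.
Qed.

(* Among Borel probability measures on the Grassmannian, this property
   characterizes the natural measure gamma_{n,m}. *)
Definition rotation_invariant (gamma : set G -> \bar R) : Prop :=
  forall Q : 'M[R]_n, Q *m Q^T = 1%:M -> \det Q = 1 ->
  forall A : set (borel G), measurable A -> gamma (rotate Q @^-1` A) = gamma A.

End Grassmannian.
Arguments Gr R {n m} _.
Arguments rotation_invariant {R n m} le_mn gamma.

Section Dimensions.
Context {R : realType} {n : nat}.
Implicit Types (E F : set 'rV[R]_n) (theta s r eps : R).
Local Open Scope ereal_scope.

Definition diam (U : set 'rV[R]_n) : \bar R :=
  maxe 0 (ereal_sup [set (enorm (p.1 - p.2))%:E | p in U `*` U]).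

(* [D] is the set of indices, so that finite covers are included. *)
Definition admissible_cover theta r s eps F : Prop :=
  exists (D : set nat) (U : nat -> set 'rV[R]_n),
  [/\ F `<=` \bigcup_(i in D) U i,
      forall i, D i -> (r `^ theta^-1)%:E <= diam (U i) <= r%:E &
      \esum_(i in D) poweR (diam (U i)) s <= eps%:E].

Definition lower_idim theta F : \bar R :=
  ereal_inf [set s%:E | s in [set s | (0 <= s)%R /\
    forall eps r0, (0 < eps)%R -> (0 < r0)%R ->
    exists2 r, (0 < r <= r0)%R & admissible_cover theta r s eps F]].

Definition upper_idim theta F : \bar R :=
  ereal_inf [set s%:E | s in [set s | (0 <= s)%R /\
    forall eps, (0 < eps)%R ->
    exists2 r0, (0 < r0)%R &
    forall r, (0 < r <= r0)%R -> admissible_cover theta r s eps F]].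

End Dimensions.

Section Profiles.
Context {R : realType} {n : nat}.
Implicit Types (E : set 'rV[R]_n) (theta s r : R) (m : nat).

Definition phi m theta s r (x : 'rV[R]_n) : R :=
  if enorm x < r then 1
  else if enorm x < r `^ theta then (r / enorm x) `^ s
  else r `^ (theta * (m%:R - s) + s) / enorm x ^+ m.

Definition energy m theta s r (mu : probability (borel 'rV[R]_n) R) : \bar R :=
  (\int[mu]_y \int[mu]_x
    (phi m theta s r ((x : 'rV[R]_n) - (y : 'rV[R]_n)))%:E)%E.

Definition capacity m theta s r E : R :=
  (fine (ereal_inf [set energy m theta s r mu |
    mu in [set mu : probability (borel 'rV[R]_n) R |
             mu (closure E) = 1%E]]))^-1.

Definition log_capacity m theta s E (r : R) : \bar R :=
  (ln (capacity m theta s r E) / - ln r)%:E.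

(* For nonempty bounded [E], [0 < theta <= 1] and [m >= 1], exactly one [s]
   belongs to the set from which [get] chooses. *)
Definition lower_profile m theta E : R :=
  get [set s | 0 <= s <= m%:R /\
    limf_einf (log_capacity m theta s E) 0^'+ = s%:E].

Definition upper_profile m theta E : R :=
  get [set s | 0 <= s <= m%:R /\
    limf_esup (log_capacity m theta s E) 0^'+ = s%:E].

End Profiles.

(* Main.v *)
From HB Require Import structures.
Require Import Defs.
From mathcomp Require Import all_boot all_order all_algebra.
From mathcomp Require Import all_classical all_reals all_analysis.
From mathcomp Require Import measurable_realfun.
From mathcomp Require Import zify ring lra.

Set Implicit Arguments.
Unset Strict Implicit.
Unset Printing Implicit Defensive.

Import Order.TTheory GRing.Theory Num.Theory.
Import numFieldNormedType.Exports.

Local Open Scope classical_set_scope.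
Local Open Scope ring_scope.

(* All comparisons between kernels follow from the formula
     phi(x) = max_{r <= t <= r^theta} (r / t)^s min(1, t / |x|)^m.
   It gives 0 <= g_t - g_s <= (1 - theta)(t - s) for s <= t, where
   g_s = log C_r^s / -log r, so that each profile is the fixed point of a
   monotone self-map of [0, m].

   Capacities are compared with finite configurations: point masses bound the
   capacity from one side, and since the kernel varies slowly at scale r, moving
   the mass of an arbitrary measure to a finite r-net of E bounds it from the
   other side.

   Upper bound. A near-minimizer of the discrete energy has potential at least
   1 / (2 C) at every point, and a projection only increases potentials. Some
   dyadic ball around each projected point therefore has mass at least
   1 / (C phi(radius)), up to a logarithmic factor; Vitali's lemma selects
   disjoint ones, and their dilates are cut into pieces of diameter in
   [r, r^theta], as many as an m-dimensional ball requires.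

   Lower bound. gamma {V : |pi_V x| <= rho} <= K (rho / |x|)^m: by rotation
   invariance the left-hand side depends on x only through rho / |x|, so it can
   be averaged over the lattice points x of a large box, few of which are close
   to V^perp. Hence the mean over V of a truncated energy of the projected
   configuration is at most log(1/r) times the energy. A Borel-Cantelli argument
   over scales r_k <= 2^-k bounds the truncated energies for almost every V, and
   the mass distribution principle excludes cheap covers. Rational theta and s
   suffice since the profiles are left-continuous in theta. *)

(** * The kernel *)

(** The two halves meet because [t] has two meanings in the formula for phi. It is a diameter of
    covering sets: an m-dimensional ball of radius rho >= t takes about (rho / t)^m sets of diameter
    t, of total s-weight t^s (rho / t)^m, and (r / t)^s (t / rho)^m is r^s divided by that weight,
    so the maximum selects the cheapest admissible cover. It is also a radius of concentration:
    min(1, t / |x|)^m bounds, up to a constant, the probability that x is projected into the ball of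
    radius t about 0. Both estimates can then be made term by term.

    Each half loses a factor log(1/r), the number of dyadic scales. Only exponents matter, so this
    factor is bounded by a multiple of r^(-eta) and absorbed by a small gap between exponents.

    Equilibrium measures would require weak compactness; weights on finitely many points require
    only an infimum of real numbers. An uncountable union of null sets need not be null, so the
    almost sure bound is proved for countably many pairs (theta, s), and a strict inequality at one
    theta must leave room in both parameters. *)

Section Kernel.
Context {R : realType}.
Implicit Types (m : nat) (r s t rho theta : R).

Lemma expr_le m (x y : R) : 0 < x -> x <= y -> x ^+ m <= y ^+ m.
Proof.
by move=> x0 xy; apply: lerXn2r; rewrite // nnegrE ltW// (lt_le_trans x0).
Qed.

Lemma powR_le s (x y : R) : 0 <= s -> 0 < x -> x <= y -> x `^ s <= y `^ s.
Proof.
by move=> s0 x0 xy; apply: ge0_ler_powR; rewrite // nnegrE ltW// (lt_le_trans x0).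
Qed.

Definition phir m theta s r rho : R :=
  if rho < r then 1
  else if rho < r `^ theta then (r / rho) `^ s
  else r `^ (theta * (m%:R - s) + s) / rho ^+ m.

(** For t > 0 this is min(1, t / rho)^m. The maximum in the denominator gives the right value 1 at
    rho = 0, where t / rho is 0 by convention. *)
Definition kap m t rho : R := (t / Num.max t rho) ^+ m.

Lemma phi_phir n m theta s r (x : 'rV[R]_n) :
  phi m theta s r x = phir m theta s r (enorm x).
Proof. by []. Qed.

Lemma le_r_rtheta r theta : 0 < r <= 1 -> 0 < theta <= 1 -> r <= r `^ theta.
Proof. by move=> r01 /andP[_ th1]; rewrite ger1_powR. Qed.

Lemma rtheta_le1 r theta : 0 < r <= 1 -> 0 < theta <= 1 -> r `^ theta <= 1.
Proof.
move=> r01 /andP[th0 _]; rewrite -(powRr0 r).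
by apply: ger_powR => //; exact: ltW.
Qed.

Lemma divr_max_ge0 t rho : 0 < t -> 0 < t / Num.max t rho.
Proof. by move=> t0; rewrite divr_gt0// lt_max t0. Qed.

Lemma divr_max_le1 t rho : 0 < t -> t / Num.max t rho <= 1.
Proof. by move=> t0; rewrite ler_pdivrMr ?lt_max ?t0// mul1r le_max lexx. Qed.

Lemma kap_gt0 m t rho : 0 < t -> 0 < kap m t rho.
Proof. by move=> t0; rewrite exprn_gt0 ?divr_max_ge0. Qed.

Lemma kap_le1 m t rho : 0 < t -> kap m t rho <= 1.
Proof. by move=> t0; rewrite exprn_ile1 ?divr_max_le1// ltW ?divr_max_ge0. Qed.

Lemma kap_near m t rho : 0 < t -> rho <= t -> kap m t rho = 1.
Proof. by move=> t0 h; rewrite /kap max_l// divff ?expr1n// gt_eqF. Qed.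

Lemma kap_far m t rho : t <= rho -> kap m t rho = (t / rho) ^+ m.
Proof. by move=> h; rewrite /kap max_r. Qed.

Lemma le_kap m c t rho rho' : 0 < c -> 0 < t ->
  Num.max t rho' <= c * Num.max t rho -> kap m t rho <= c ^+ m * kap m t rho'.
Proof.
move=> c0 t0 h; rewrite /kap -exprMn expr_le ?divr_max_ge0//.
rewrite mulrCA; apply: ler_wpM2l; first exact: ltW.
have mt0 x : 0 < Num.max t x by rewrite lt_max t0.
rewrite ler_pdivlMr// mulrC ler_pdivrMr//.
Qed.

Lemma kap_scale m t t' rho : 0 < t' -> t' <= t ->
  kap m t rho <= (t / t') ^+ m * kap m t' rho.
Proof.
move=> t0' tt; have t0 : 0 < t by exact: lt_le_trans tt.
have mt0 x : 0 < Num.max t x by rewrite lt_max t0.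
have mt0' x : 0 < Num.max t' x by rewrite lt_max t0'.
rewrite /kap -exprMn expr_le ?divr_max_ge0//.
rewrite -mulrA [t'^-1 * _]mulrA mulVf ?gt_eqF// mul1r ler_pM2l//.
by rewrite lef_pV2 ?posrE// ge_max !le_max tt lexx orbT.
Qed.

Lemma powR_le_expr m s x : 0 < x -> x <= 1 -> s <= m%:R -> x ^+ m <= x `^ s.
Proof.
by move=> x0 x1 sm; rewrite -powR_mulrn ?(ltW x0)// ger_powR ?x0.
Qed.

Lemma powR_div_mul s (a b c : R) : 0 < a -> 0 < b -> 0 < c ->
  (a / b) `^ s * (b / c) `^ s = (a / c) `^ s.
Proof.
move=> a0 b0 c0; rewrite -powRM ?divr_ge0 ?(ltW a0) ?(ltW b0) ?(ltW c0)//; congr (_ `^ _).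
by rewrite mulrA divfK// gt_eqF.
Qed.

Section Fixed.
Variables (m : nat) (theta r : R).
Hypotheses (r01 : 0 < r <= 1) (th01 : 0 < theta <= 1).
Let r0 : 0 < r. Proof. by case/andP: r01. Qed.
Let a := r `^ theta.
Let ra : r <= a. Proof. exact: le_r_rtheta. Qed.
Let a0 : 0 < a. Proof. exact: powR_gt0. Qed.

(** With a = r^theta, the exponent [theta * (m - s) + s] is that of (r / a)^s a^m: the third branch
    of the kernel is the term t = r^theta of the maximum. *)
Lemma phir_far s rho : 0 < rho ->
  r `^ (theta * (m%:R - s) + s) / rho ^+ m = (r / a) `^ s * (a / rho) ^+ m.
Proof.
move=> rho0; rewrite expr_div_n mulrA; congr (_ / _).
have -> : r / a = r `^ (1 - theta).
  by rewrite powRB ?powRr1 ?(ltW r0)// (gt_eqF r0) implybT.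
rewrite -powR_mulrn ?(ltW a0)// -!powRrM -powRD ?(gt_eqF r0) ?implybT//.
by congr (_ `^ _); ring.
Qed.

(* [phir_ge] and [phir_eq] together say that [phir rho] is the maximum of
   [(r / t) ^ s * min(1, t / rho) ^ m] over [r <= t <= r ^ theta]. *)
Lemma phir_ge s t rho : 0 <= s <= m%:R -> r <= t <= a -> 0 <= rho ->
  (r / t) `^ s * kap m t rho <= phir m theta s r rho.
Proof.
move=> /andP[s0 sm] /andP[rt ta] rho0.
have t0 : 0 < t by exact: lt_le_trans rt.
have rt1 : r / t <= 1 by rewrite ler_pdivrMr ?mul1r.
have rtp : 0 < r / t by rewrite divr_gt0.
have pw1 : (r / t) `^ s <= 1.
  by rewrite -(powRr0 (r / t)) ger_powR ?rtp.
rewrite /phir; case: ltP => [_|rrho].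
  by rewrite -[leRHS]mulr1 ler_pM ?powR_ge0 ?kap_le1 ?(ltW (kap_gt0 _ _ _)).
have rhop : 0 < rho by exact: lt_le_trans rrho.
case: ltP => [rhoa|arho].
  case: (leP rho t) => rhot.
    by rewrite kap_near// mulr1 powR_le// ler_pM2l// lef_pV2 ?posrE.
  rewrite kap_far ?(ltW rhot)//.
  apply: (@le_trans _ _ ((r / t) `^ s * (t / rho) `^ s)).
    rewrite ler_wpM2l ?powR_ge0// powR_le_expr ?divr_gt0//.
    by rewrite ler_pdivrMr ?mul1r ?(ltW rhot).
  by rewrite powR_div_mul.
rewrite -/a phir_far// kap_far; last exact: le_trans arho.
have -> : (r / a) `^ s * (a / rho) ^+ m =
   (r / a) `^ s * (a / t) ^+ m * (t / rho) ^+ m.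
  by rewrite -mulrA -exprMn mulrA divfK// gt_eqF.
rewrite ler_wpM2r ?exprn_ge0 ?divr_ge0 ?(ltW t0) ?(ltW rhop)// -(powR_div_mul s r0 a0 t0).
rewrite ler_wpM2l ?powR_ge0// -powR_mulrn ?divr_ge0 ?(ltW a0) ?(ltW t0)//.
by rewrite ler_powR// ler_pdivlMr ?mul1r.
Qed.

Lemma phir_eq s rho : 0 <= rho ->
  exists2 t, r <= t <= a & phir m theta s r rho = (r / t) `^ s * kap m t rho.
Proof.
move=> rho0; rewrite /phir; case: ltP => [rhor|rrho].
  exists r; rewrite ?lexx ?ra// divff ?gt_eqF// powR1 mul1r kap_near//.
  exact: ltW.
have rhop : 0 < rho by exact: lt_le_trans rrho.
case: ltP => [rhoa|arho].
  by exists rho; rewrite ?rrho ?ltW// kap_near// mulr1.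
exists a; first by rewrite ra lexx.
by rewrite phir_far// kap_far.
Qed.

Lemma phir_gt0 s rho : 0 <= rho -> 0 < phir m theta s r rho.
Proof.
move=> rho0; have [t /andP[rt _] ->] := phir_eq s rho0.
have t0 : 0 < t by exact: lt_le_trans rt.
by rewrite mulr_gt0 ?kap_gt0 ?powR_gt0 ?divr_gt0.
Qed.

Lemma phir_le1 s rho : 0 <= s -> 0 <= rho -> phir m theta s r rho <= 1.
Proof.
move=> s0 rho0; have [t /andP[rt _] ->] := phir_eq s rho0.
have t0 : 0 < t by exact: lt_le_trans rt.
rewrite -[leRHS]mulr1 ler_pM ?powR_ge0 ?kap_le1 ?(ltW (kap_gt0 _ _ _))//.
rewrite -[leRHS](powRr0 (r / t)) ger_powR// divr_gt0//=.
by rewrite ler_pdivrMr ?mul1r.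
Qed.

(** Slow variation at scale r. Take the t attaining the maximum at [rho]; as t >= r and c >= 1, the
    comparison of max(r, .) passes to max(t, .), and this one term loses at most c^m. *)
Lemma le_phir s c rho rho' : 0 <= s <= m%:R -> 1 <= c -> 0 <= rho -> 0 <= rho' ->
  Num.max r rho' <= c * Num.max r rho ->
  phir m theta s r rho <= c ^+ m * phir m theta s r rho'.
Proof.
move=> sm c1 rho0 rho0' h; have [t /andP[rt ta] ->] := phir_eq s rho0.
have t0 : 0 < t by exact: lt_le_trans rt.
have c0 : 0 < c by exact: lt_le_trans c1.
apply: (@le_trans _ _ (c ^+ m * ((r / t) `^ s * kap m t rho'))); last first.
  by rewrite ler_wpM2l ?exprn_ge0 ?(ltW c0) ?phir_ge ?rt.
rewrite mulrCA ler_wpM2l ?powR_ge0// le_kap//.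
rewrite ge_max; apply/andP; split.
  by rewrite -[leLHS]mul1r ler_pM ?(ltW t0)// le_max lexx.
apply: le_trans (_ : rho' <= c * Num.max r rho) _.
  by apply: le_trans h; rewrite le_max lexx orbT.
by rewrite ler_wpM2l ?(ltW c0)// ge_max !le_max rt lexx orbT.
Qed.

Lemma phir_antitone s rho rho' : 0 <= s <= m%:R -> 0 <= rho -> rho <= rho' ->
  phir m theta s r rho' <= phir m theta s r rho.
Proof.
move=> sm rho0 h; have rho0' : 0 <= rho' by exact: le_trans h.
have := @le_phir s 1 rho' rho sm (lexx _) rho0' rho0; rewrite expr1n !mul1r; apply.
by rewrite ge_max !le_max lexx h orbT.
Qed.

Lemma phir_lb s rho : 0 <= s <= m%:R -> 0 <= rho ->
  (r / Num.max r rho) ^+ m <= phir m theta s r rho.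
Proof.
move=> sm rho0; have := @phir_ge s r rho sm _ rho0.
by rewrite divff ?gt_eqF// powR1 mul1r; apply; rewrite lexx.
Qed.

Lemma phir_exponent_antitone s s' rho : 0 <= s -> s <= s' -> s' <= m%:R -> 0 <= rho ->
  phir m theta s' r rho <= phir m theta s r rho.
Proof.
move=> s0 ss sm rho0; have [t /andP[rt ta] ->] := phir_eq s' rho0.
have t0 : 0 < t by exact: lt_le_trans rt.
apply: (@le_trans _ _ ((r / t) `^ s * kap m t rho)); last first.
  by rewrite phir_ge// ?rt// s0 (le_trans ss).
rewrite ler_wpM2r ?(ltW (kap_gt0 _ _ _))// ger_powR// divr_gt0//=.
by rewrite ler_pdivrMr ?mul1r.
Qed.

(** Termwise: changing the exponent multiplies a term by (r / t)^(s' - s), and t <= r^theta bounds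
    this factor below by r^((1 - theta)(s' - s)). *)
Lemma phir_exponent_ratio s s' rho : 0 <= s -> s <= s' -> s' <= m%:R -> 0 <= rho ->
  phir m theta s r rho <= r `^ (- ((1 - theta) * (s' - s))) * phir m theta s' r rho.
Proof.
move=> s0 ss sm rho0; have [t /andP[rt ta] ->] := phir_eq s rho0.
have t0 : 0 < t by exact: lt_le_trans rt.
have rtp : 0 < r / t by rewrite divr_gt0.
apply: (@le_trans _ _ (r `^ (- ((1 - theta) * (s' - s))) *
   ((r / t) `^ s' * kap m t rho))); last first.
  by rewrite ler_wpM2l ?powR_ge0// phir_ge// ?rt// (le_trans s0).
rewrite mulrA ler_wpM2r ?(ltW (kap_gt0 _ _ _))//.
have -> : (r / t) `^ s' = (r / t) `^ (s' - s) * (r / t) `^ s.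
  by rewrite -powRD ?subrK// (gt_eqF rtp) implybT.
rewrite mulrA -[leLHS]mul1r ler_wpM2r ?powR_ge0//.
rewrite powRN powRrM ler_pdivlMl ?powR_gt0 ?powR_gt0//.
rewrite mulr1 powR_le ?subr_ge0 ?powR_gt0//.
rewrite powRB ?powRr1 ?(ltW r0) ?(gt_eqF r0) ?implybT//.
by rewrite ler_wpM2l ?(ltW r0)// lef_pV2 ?posrE.
Qed.

End Fixed.

(** A smaller [q] only enlarges the range of t, up to r^q. A term with t > r^theta is replaced by
    the one at a = r^theta, at a cost of (t / a)^m <= r^((q - theta) m). *)
Lemma phir_theta_ratio m q theta r s rho : 0 < r <= 1 -> 0 < q -> q <= theta ->
  theta <= 1 -> 0 <= s <= m%:R -> 0 <= rho ->
  phir m q s r rho <= r `^ (- ((theta - q) * m%:R)) * phir m theta s r rho.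
Proof.
move=> r01 q0 qth th1 sm rho0.
have r0 : 0 < r by case/andP: r01.
have th01 : 0 < theta <= 1 by rewrite th1 (lt_le_trans q0).
have q01 : 0 < q <= 1 by rewrite q0 (le_trans qth).
have [t /andP[rt ta] ->] := phir_eq m r01 q01 s rho0.
have t0 : 0 < t by exact: lt_le_trans rt.
have ra := le_r_rtheta r01 th01; set a := r `^ theta in ra.
have a0 : 0 < a by exact: powR_gt0.
have f1 : 1 <= r `^ (- ((theta - q) * m%:R)).
  rewrite -{1}(powRr0 r); apply: ger_powR => //.
  by rewrite oppr_le0 mulr_ge0 ?subr_ge0.
case: (leP t a) => ta'.
  rewrite -[leLHS]mul1r ler_pM// ?mulr_ge0 ?powR_ge0 ?(ltW (kap_gt0 _ _ _))//.
  by rewrite phir_ge ?rt.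
apply: (@le_trans _ _ (r `^ (- ((theta - q) * m%:R)) *
   ((r / a) `^ s * kap m a rho))); last first.
  by rewrite ler_wpM2l ?powR_ge0// phir_ge// ra lexx.
rewrite mulrCA ler_pM ?powR_ge0 ?(ltW (kap_gt0 _ _ _))//.
  have /andP[s0 _] := sm.
  by rewrite powR_le ?divr_gt0// ler_pM2l// lef_pV2 ?posrE// ltW.
apply: le_trans (kap_scale m rho a0 (ltW ta')) _.
rewrite ler_wpM2r ?(ltW (kap_gt0 _ _ _))//.
rewrite -mulNr powRrM opprB powR_mulrn ?powR_ge0//.
rewrite expr_le ?divr_gt0//.
rewrite powRB ?(gt_eqF r0) ?implybT// ler_pM2r ?invr_gt0//.
Qed.

End Kernel.

(** * Euclidean geometry *)

Section EuclidTheory.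
Context {R : realType} {n : nat}.
Implicit Types (u v x y c : 'rV[R]_n) (V W : {vspace 'rV[R]_n}).

Lemma dotC u v : dot u v = dot v u.
Proof. by apply: eq_bigr => i _; rewrite mulrC. Qed.

Lemma dotDl u v x : dot (u + v) x = dot u x + dot v x.
Proof. by rewrite -big_split; apply: eq_bigr => i _; rewrite !mxE mulrDl. Qed.

Lemma dotZl (a : R) u v : dot (a *: u) v = a * dot u v.
Proof. by rewrite mulr_sumr; apply: eq_bigr => i _; rewrite !mxE mulrA. Qed.

Lemma dotNl u v : dot (- u) v = - dot u v.
Proof. by rewrite -scaleN1r dotZl mulN1r. Qed.

Lemma dotBl u v x : dot (u - v) x = dot u x - dot v x.
Proof. by rewrite dotDl dotNl. Qed.

Lemma dotDr u v x : dot x (u + v) = dot x u + dot x v.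
Proof. by rewrite !(dotC x) dotDl. Qed.

Lemma dotZr (a : R) u v : dot u (a *: v) = a * dot u v.
Proof. by rewrite !(dotC u) dotZl. Qed.

Lemma dotNr u v : dot u (- v) = - dot u v.
Proof. by rewrite !(dotC u) dotNl. Qed.

Lemma dotBr u v x : dot x (u - v) = dot x u - dot x v.
Proof. by rewrite dotDr dotNr. Qed.

Lemma dot0l u : dot 0 u = 0.
Proof. by rewrite -(scale0r u) dotZl mul0r. Qed.

Lemma dot_ge0 x : 0 <= dot x x.
Proof. by apply: sumr_ge0 => i _; rewrite -expr2 sqr_ge0. Qed.

Lemma enorm_ge0 x : 0 <= enorm x.
Proof. exact: sqrtr_ge0. Qed.

Lemma enorm_sqr x : enorm x ^+ 2 = dot x x.
Proof. by rewrite sqr_sqrtr ?dot_ge0. Qed.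

Lemma enormZ (a : R) x : enorm (a *: x) = `|a| * enorm x.
Proof.
by rewrite /enorm dotZl dotZr mulrA -expr2 sqrtrM ?sqr_ge0// sqrtr_sqr.
Qed.

Lemma enormN x : enorm (- x) = enorm x.
Proof. by rewrite /enorm dotNl dotNr opprK. Qed.

Lemma enormBC x y : enorm (x - y) = enorm (y - x).
Proof. by rewrite -enormN opprB. Qed.

Lemma enorm0 : enorm (0 : 'rV[R]_n) = 0.
Proof. by rewrite /enorm dot0l sqrtr0. Qed.

Lemma enorm_eq0 x : (enorm x == 0) = (x == 0).
Proof.
apply/eqP/eqP => [h|->]; last exact: enorm0.
by apply: dot_eq0; rewrite -enorm_sqr h expr0n.
Qed.

Lemma enorm_gt0 x : (0 < enorm x) = (x != 0).
Proof. by rewrite lt_neqAle enorm_ge0 andbT eq_sym enorm_eq0. Qed.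

Lemma le_dot_enorm u v : dot u v <= enorm u * enorm v.
Proof.
have [->|v0] := eqVneq v 0; first by rewrite dotC dot0l enorm0 mulr0.
have [->|u0] := eqVneq u 0; first by rewrite dot0l enorm0 mul0r.
rewrite -enorm_gt0 in v0; rewrite -enorm_gt0 in u0.
have := dot_ge0 (enorm v *: u - enorm u *: v).
rewrite dotBl !dotBr !dotZl !dotZr (dotC v u) -!enorm_sqr => h.
have : 0 <= (2 * enorm u * enorm v) * (enorm u * enorm v - dot u v).
  by apply: le_trans h _; rewrite le_eqVlt; apply/orP; left; apply/eqP; ring.
by rewrite pmulr_rge0 ?subr_ge0// !mulr_gt0.
Qed.

Lemma ler_enormD u v : enorm (u + v) <= enorm u + enorm v.
Proof.
rewrite -(@ler_pXn2r _ 2)// ?nnegrE ?addr_ge0 ?enorm_ge0//.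
rewrite enorm_sqr dotDl !dotDr sqrrD !enorm_sqr (dotC v u).
have := le_dot_enorm u v; rewrite mulr2n; lra.
Qed.

Lemma ler_enormB x y z : enorm (x - z) <= enorm (x - y) + enorm (y - z).
Proof. by apply: le_trans (ler_enormD _ _); rewrite addrA subrK. Qed.

Lemma enorm_sum (I : Type) (s : seq I) (f : I -> 'rV[R]_n) :
  enorm (\sum_(i <- s) f i) <= \sum_(i <- s) enorm (f i).
Proof.
elim: s => [|i s IH]; first by rewrite !big_nil enorm0.
by rewrite !big_cons (le_trans (ler_enormD _ _))// lerD2l.
Qed.

Lemma coord_le_enorm x i : `|x 0 i| <= enorm x.
Proof.
rewrite -(@ler_pXn2r _ 2)// ?nnegrE ?enorm_ge0// enorm_sqr real_normK ?num_real//.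
rewrite /dot (bigD1 i)//= -expr2 lerDl.
by apply: sumr_ge0 => j _; rewrite -expr2 sqr_ge0.
Qed.

Lemma enorm_le_coord x (B : R) : 0 <= B -> (forall i, `|x 0 i| <= B) ->
  enorm x <= n%:R * B.
Proof.
move=> B0 h; rewrite -(@ler_pXn2r _ 2)// ?nnegrE ?enorm_ge0 ?mulr_ge0//.
rewrite enorm_sqr exprMn; apply: (@le_trans _ _ (n%:R * B ^+ 2)).
  apply: (@le_trans _ _ (\sum_(i < n) B ^+ 2)).
    apply: ler_sum => i _; rewrite -expr2 -[leLHS]real_normK ?num_real//.
    by rewrite lerXn2r// nnegrE.
  by rewrite sumr_const card_ord mulr_natl lexx.
rewrite ler_wpM2r ?sqr_ge0// -natrX ler_nat.
by case: (n) => // k; rewrite -mulnn leq_pmulr.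
Qed.

Lemma enorm_delta (i : 'I_n) : enorm (delta_mx 0 i : 'rV[R]_n) = 1.
Proof.
rewrite /enorm /dot (bigD1 i)//= big1 ?addr0.
  by rewrite !mxE !eqxx mulr1 sqrtr1.
by move=> j ji; rewrite !mxE (negbTE ji) andbF mulr0.
Qed.

(** Induction on the dimension: normalize a nonzero vector of [W] and continue in its orthogonal
    complement inside [W]. *)
Lemma orthonormal_basis d W : \dim W = d -> exists e : 'I_d -> 'rV[R]_n,
  [/\ forall i, e i \in W, forall i j, dot (e i) (e j) = (i == j)%:R &
      forall w, w \in W -> w = \sum_i dot w (e i) *: e i].
Proof.
elim: d W => [|d IH] W dW.
  exists (fun _ => 0); split; [by case|by case|move=> w].
  by move/eqP: dW; rewrite dimv_eq0 => /eqP ->; rewrite memv0 big_ord0 => /eqP.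
have W0 : vpick W != 0 by rewrite vpick0 -dimv_eq0 dW.
pose u := (enorm (vpick W))^-1 *: vpick W.
have uW : u \in W by rewrite memvZ ?memv_pick.
have nu : dot u u = 1.
  rewrite -enorm_sqr enormZ ger0_norm ?invr_ge0 ?enorm_ge0// mulVf ?expr1n//.
  by rewrite enorm_eq0.
have uo : u \notin orthov dot W.
  apply/negP => /mem_orthovP/(_ _ uW) h.
  by have : dot u u = 0 := h; rewrite nu => /eqP; rewrite oner_eq0.
have dW' : \dim (W :&: orthov dot <[u]>)%VS = d.
  by rewrite -eq_dim_orthov1 ?dW.
have [e [eW eo es]] := IH _ dW'.
have ue i : dot (e i) u = 0.
  by have := eW i; rewrite memv_cap mem_orthov1 => /andP[_ /eqP h]; exact: h.
exists (fun i => if unlift ord0 i is Some j then e j else u); split.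
- by move=> i; case: unliftP => // j _; have := eW j; rewrite memv_cap => /andP[].
- move=> i j; case: unliftP => [i'|] ->; case: unliftP => [j'|] ->.
  + by rewrite eo (inj_eq lift_inj).
  + by rewrite ue eq_sym (negbTE (neq_lift _ _)).
  + by rewrite dotC ue (negbTE (neq_lift _ _)).
  + by rewrite nu eqxx.
- move=> w wW; rewrite big_ord_recl unlift_none.
  have wW' : w - dot w u *: u \in (W :&: orthov dot <[u]>)%VS.
    rewrite memv_cap; apply/andP; split; first exact: memvB wW (memvZ _ uW).
    rewrite mem_orthov1; apply/eqP.
    by have := dotBl w (dot w u *: u) u; rewrite dotZl nu mulr1 subrr.
  rewrite -[LHS](subrK (dot w u *: u)) addrC; congr (_ + _).
  rewrite [LHS](es _ wW'); apply: eq_bigr => i _; rewrite liftK.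
  by rewrite dotBl dotZl (dotC u) ue mulr0 subr0.
Qed.

Lemma orthoproj_uniq V x y : y \in V -> {in V, forall v, dot (x - y) v = 0} ->
  orthoproj V x = y.
Proof.
move=> yV h; have [pV hp] := orthoprojP V x.
apply/eqP; rewrite -subr_eq0; apply/eqP/dot_eq0.
have dV : orthoproj V x - y \in V by rewrite memvB.
rewrite -[X in dot X _](_ : (x - y) - (x - orthoproj V x) = _).
  by rewrite dotBl h// hp// subrr.
by rewrite opprB addrC addrA subrK.
Qed.

Lemma orthoproj_id V x : x \in V -> orthoproj V x = x.
Proof. by move=> xV; apply: orthoproj_uniq => // v _; rewrite subrr dot0l. Qed.

Lemma orthoproj_pythagoras V x :
  enorm x ^+ 2 = enorm (orthoproj V x) ^+ 2 + enorm (x - orthoproj V x) ^+ 2.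
Proof.
have [pV hp] := orthoprojP V x.
have h := hp _ pV; rewrite !enorm_sqr.
move: h; set p := orthoproj V x => h.
have -> : x = p + (x - p) by rewrite addrC subrK.
move: h; rewrite [p + _ - p]addrC addKr; move: (x - p) => z h.
by rewrite dotDl !dotDr h (dotC p) h addr0 add0r.
Qed.

Lemma orthoproj_le V x : enorm (orthoproj V x) <= enorm x.
Proof.
rewrite -(@ler_pXn2r _ 2)// ?nnegrE ?enorm_ge0// (orthoproj_pythagoras V x).
by rewrite lerDl sqr_ge0.
Qed.

Lemma enorm_orthoprojD V x :
  enorm x <= enorm (orthoproj V x) + enorm (x - orthoproj V x).
Proof. by apply: le_trans (ler_enormD _ _); rewrite addrC subrK. Qed.

Definition eball c (rho : R) : set 'rV[R]_n := [set x | enorm (x - c) <= rho].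

(** The exact value matters, since admissible covers also bound diameters from below; it is attained
    at two antipodal points. *)
Lemma diam_eball c rho : (0 < n)%N -> 0 <= rho ->
  diam (eball c rho) = (2 * rho)%:E.
Proof.
move=> n0 rho0; rewrite /diam max_r.
  apply/le_anti/andP; split.
    apply: ge_ereal_sup => _ [[x y] /= [xb yb] <-]; rewrite lee_fin.
    apply: le_trans (ler_enormB _ c _) _; rewrite (enormBC c) mulrDl mul1r.
    exact: lerD.
  pose d : 'rV[R]_n := delta_mx 0 (Ordinal n0).
  apply: ereal_sup_ubound; exists (c + rho *: d, c - rho *: d) => /=.
    by split; rewrite /eball/= addrC addKr ?enormN enormZ enorm_delta ger0_norm ?mulr1.
  rewrite opprB addrC addrA subrK -scalerDl enormZ enorm_delta mulr1 ger0_norm.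
    by congr (_%:E); ring.
  by rewrite addr_ge0.
apply: ereal_sup_ubound; exists (c, c) => /=; last by rewrite subrr enorm0.
by rewrite /eball/= subrr enorm0.
Qed.

Lemma enorm_le_diam (U : set 'rV[R]_n) (d : R) x y : (diam U <= d%:E)%E ->
  U x -> U y -> enorm (x - y) <= d.
Proof.
move=> Ud Ux Uy; rewrite -lee_fin; apply: le_trans Ud.
by rewrite le_max; apply/orP; right; apply: ereal_sup_ubound; exists (x, y).
Qed.

Lemma diam_ge0 (U : set 'rV[R]_n) : (0 <= diam U)%E.
Proof. by rewrite le_max lexx. Qed.

(* Grid of side [t / 2m] in the coordinates of an orthonormal basis. *)
Lemma subspace_ball_cover m V c (t rho : R) : (0 < m)%N -> \dim V = m ->
  c \in V -> 0 < t -> t <= rho ->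
  exists L : seq 'rV[R]_n,
    (size L)%:R <= (13 * m%:R) ^+ m * (rho / t) ^+ m /\
    forall v, v \in V -> enorm (v - c) <= 3 * rho ->
      exists2 l, l \in L & enorm (v - l) <= t / 2.
Proof.
move=> m0 dV cV t0 trho; have [e [eV eo es]] := orthonormal_basis dV.
have m0' : 0 < m%:R :> R by rewrite ltr0n.
have rho0 : 0 < rho by exact: lt_le_trans trho.
pose h := t / (2 * m%:R).
have h0 : 0 < h by rewrite divr_gt0// mulr_gt0.
pose N := (Num.truncn (6 * rho / h)).+1.
have xr0 : 0 <= 6 * rho / h by rewrite divr_ge0 ?(ltW h0)// mulr_ge0// ltW.
(* The interval [-3 rho, 3 rho] has 6 rho / h = 12 m rho / t cells, and the one added by truncation
   is at most m rho / t because t <= rho. *)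
have Nle : N%:R <= 13 * m%:R * (rho / t).
  rewrite /N -natr1; have /andP[Nx _] := truncn_itv xr0.
  apply: le_trans (lerD Nx (lexx 1)) _.
  have -> : 6 * rho / h = 12 * m%:R * (rho / t).
    by rewrite /h; field; rewrite !gt_eqF.
  have h1 : 1 <= m%:R * (rho / t).
    rewrite -[leLHS]mulr1 ler_pM// ?ler1n//.
    by rewrite ler_pdivlMr ?mul1r.
  rewrite -!mulrA; lra.
pose g (k : {ffun 'I_m -> 'I_N}) := c + \sum_i (h * (k i)%:R - 3 * rho) *: e i.
exists [seq g k | k <- enum {ffun 'I_m -> 'I_N}]; split.
  rewrite size_map -cardE card_ffun !card_ord natrX -exprMn.
  by apply: lerXn2r; rewrite ?nnegrE// !mulr_ge0// ?invr_ge0 ltW.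
move=> v vV vc.
pose a i := dot (v - c) (e i).
have na i : `|a i| <= 3 * rho.
  have ne : enorm (e i) = 1 by rewrite /enorm eo eqxx sqrtr1.
  rewrite ler_norml; apply/andP; split.
    rewrite lerNl -dotNl; apply: le_trans (le_dot_enorm _ _) _.
    by rewrite enormN ne mulr1.
  by apply: le_trans (le_dot_enorm _ _) _; rewrite ne mulr1.
have ar i : 0 <= (a i + 3 * rho) / h.
  by rewrite divr_ge0 ?(ltW h0)//; have := na i; rewrite ler_norml; lra.
have kN i : (Num.truncn ((a i + 3 * rho) / h) < N)%N.
  rewrite ltnS le_truncn// ler_pM2r ?invr_gt0//.
  by have := na i; rewrite ler_norml; lra.
pose k : {ffun 'I_m -> 'I_N} := [ffun i => Ordinal (kN i)].
exists (g k); first by apply/mapP; exists k; rewrite ?mem_enum.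
have -> : v - g k = \sum_i (a i + 3 * rho - h * (k i)%:R) *: e i.
  rewrite /g opprD addrA (es (v - c)) ?memvB// -sumrB.
  by apply: eq_bigr => i _; rewrite -scalerBl /a; congr (_ *: _); ring.
apply: le_trans (enorm_sum _ _) _.
apply: (@le_trans _ _ (\sum_(i < m) h)); last first.
  by rewrite sumr_const card_ord -mulr_natr /h le_eqVlt; apply/orP; left; apply/eqP;
     field; rewrite gt_eqF.
apply: ler_sum => i _; rewrite enormZ /enorm eo eqxx sqrtr1 mulr1 ffunE /=.
have /andP[t1 t2] := truncn_itv (ar i).
rewrite ler_pdivlMr// in t1; rewrite ltr_pdivrMr// -[X in _ < X * _]natr1 in t2.
rewrite ler_norml; apply/andP; split; move: t1 t2 h0; lra.
Qed.

End EuclidTheory.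

(** * Energies and capacities *)

Section Measurability.
Context {R : realType}.

Lemma borel_continuous_measurable (T : ptopologicalType) (f : T -> R) :
  continuous f -> measurable_fun setT (f : borel T -> R).
Proof.
move=> /continuousP cf; apply: (measurability _ (RGenOpens.measurableE R)).
move=> _ [_ [a [b ->] <-]]; rewrite setTI.
by apply: sub_sigma_algebra; exact/cf/interval_open.
Qed.

Lemma borel_coord_measurable n (i : 'I_n) :
  measurable_fun setT ((fun x : 'rV[R]_n => x 0 i) : borel 'rV[R]_n -> R).
Proof. apply: borel_continuous_measurable; exact: coord_continuous. Qed.

Lemma enorm_measurable d (X : measurableType d) n (f : X -> 'rV[R]_n) :
  (forall i, measurable_fun setT (fun w => f w 0 i)) ->
  measurable_fun setT (fun w => enorm (f w)).
Proof.
move=> mf; rewrite (_ : (fun w => _) =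
    fun w => (\sum_(i <- index_enum 'I_n) f w 0 i * f w 0 i) `^ 2^-1); last first.
  by apply/funext => w; rewrite powR12_sqrt//; exact: dot_ge0.
apply: (measurableT_comp (measurable_powR _)).
by apply: measurable_sum => i; exact: measurable_funM.
Qed.

Lemma phir_measurable d (X : measurableType d) m theta s r (f : X -> R) :
  (forall w, 0 <= f w) -> measurable_fun setT f ->
  measurable_fun setT (fun w => phir m theta s r (f w)).
Proof.
move=> f0 mf; rewrite (_ : (fun w => _) = fun w =>
  if f w < r then 1 else if f w < r `^ theta then (r * f w `^ (- 1)) `^ s
  else r `^ (theta * (m%:R - s) + s) * f w `^ (- m%:R)); last first.
  by apply/funext => w; rewrite /phir powR_inv1// powR_invn.
apply: measurable_fun_ifT; first exact: measurable_fun_ltr.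
  exact: measurable_cst.
apply: measurable_fun_ifT; first exact: measurable_fun_ltr.
  apply: (measurableT_comp (measurable_powR _)).
  apply: measurable_funM; first exact: measurable_cst.
  exact: (measurableT_comp (measurable_powR _)).
apply: measurable_funM; first exact: measurable_cst.
exact: (measurableT_comp (measurable_powR _)).
Qed.

End Measurability.

Section Capacity.
Context {R : realType} {n : nat}.
Local Notation T := (borel 'rV[R]_n).
Implicit Types (E : set 'rV[R]_n) (theta s r : R) (m : nat).

Lemma kernel_measurable d (X : measurableType d) m theta s r (f g : X -> T) :
  measurable_fun setT f -> measurable_fun setT g ->
  measurable_fun setT
    (fun w => (phi m theta s r ((f w : 'rV[R]_n) - (g w : 'rV[R]_n)))%:E).
Proof.
move=> mf mg; apply/measurable_EFinP; apply: phir_measurable => [w|].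
  exact: enorm_ge0.
apply: enorm_measurable => i.
rewrite (_ : (fun w => _) = (fun w => (f w : 'rV[R]_n) 0 i - (g w : 'rV[R]_n) 0 i)).
  apply: measurable_funB; exact: (measurableT_comp (borel_coord_measurable i)).
by apply/funext => w; rewrite !mxE.
Qed.

Lemma phi_ge0 m theta s r (x : 'rV[R]_n) : 0 < r <= 1 -> 0 < theta <= 1 ->
  0 <= phi m theta s r x.
Proof. by move=> r01 th01; rewrite phi_phir ltW// phir_gt0// enorm_ge0. Qed.

Lemma potential_measurable m theta s r (mu : probability T R) :
  0 < r <= 1 -> 0 < theta <= 1 ->
  measurable_fun setT (fun y : T => (\int[mu]_x
    (phi m theta s r ((x : 'rV[R]_n) - (y : 'rV[R]_n)))%:E)%E).
Proof.
move=> r01 th01.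
apply: (@measurable_fun_fubini_tonelli_G _ _ T T R mu
  (fun z : T * T => (phi m theta s r ((z.1 : 'rV[R]_n) - (z.2 : 'rV[R]_n)))%:E)).
  exact: kernel_measurable.
by move=> z /=; rewrite lee_fin phi_ge0.
Qed.

Lemma energy_le m1 th1 s1 r1 m2 th2 s2 r2 (c : R) (mu : probability T R) :
  0 < r1 <= 1 -> 0 < th1 <= 1 -> 0 < r2 <= 1 -> 0 < th2 <= 1 -> 0 <= c ->
  (forall rho, 0 <= rho -> phir m1 th1 s1 r1 rho <= c * phir m2 th2 s2 r2 rho) ->
  (energy m1 th1 s1 r1 mu <= c%:E * energy m2 th2 s2 r2 mu)%E.
Proof.
move=> r1P th1P r2P th2P c0 h; rewrite /energy.
have mk m th s r (y : T) : measurable_fun setT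
    (fun x : T => (phi m th s r ((x : 'rV[R]_n) - (y : 'rV[R]_n)))%:E).
  by apply: kernel_measurable => //; exact: measurable_cst.
rewrite -ge0_integralZl_EFin//=; last 2 first.
- by move=> y _; apply: integral_ge0 => x _; rewrite lee_fin phi_ge0.
- exact: potential_measurable.
apply: ge0_le_integral => //=.
- by move=> y _; apply: integral_ge0 => x _; rewrite lee_fin phi_ge0.
- exact: potential_measurable.
- by apply: measurable_funeM; exact: potential_measurable.
move=> y _; rewrite -ge0_integralZl_EFin//=; last first.
  by move=> x _; rewrite lee_fin phi_ge0.
apply: ge0_le_integral => //=.
- by move=> x _; rewrite lee_fin phi_ge0.
- by apply: measurable_funeM; exact: mk.
by move=> x _; rewrite -EFinM lee_fin !phi_phir h ?enorm_ge0.
Qed.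

Lemma energy_le1 m theta s r (mu : probability T R) :
  0 < r <= 1 -> 0 < theta <= 1 -> 0 <= s -> (energy m theta s r mu <= 1)%E.
Proof.
move=> r01 th01 s0; rewrite /energy.
have h1 : (\int[mu]_(y in setT) (cst 1%E) y = 1)%E.
  by rewrite integral_cst// mul1e; exact: probability_setT.
rewrite -[leRHS]h1; apply: ge0_le_integral => //=.
- by move=> y _; apply: integral_ge0 => x _; rewrite lee_fin phi_ge0.
- exact: potential_measurable.
move=> y _; rewrite -[leRHS]h1; apply: ge0_le_integral => //=.
- by move=> x _; rewrite lee_fin phi_ge0.
- by apply: kernel_measurable => //; exact: measurable_cst.
by move=> x _; rewrite lee_fin phi_phir phir_le1 ?enorm_ge0.
Qed.

(** The step function equal to [a i j] on A i x A j lies below the kernel; it is integrated in one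
    variable at a time. It serves both for the cells of a net and, with a single set, for the
    closure of E. *)
Lemma energy_ge_step m theta s r (mu : probability T R) N (A : 'I_N -> set T)
    (a : 'I_N -> 'I_N -> R) :
  0 < r <= 1 -> 0 < theta <= 1 ->
  (forall i, measurable (A i)) -> trivIset setT A -> (forall i j, 0 <= a i j) ->
  (forall i j x y, A i x -> A j y ->
    a i j <= phi m theta s r ((x : 'rV[R]_n) - (y : 'rV[R]_n))) ->
  (\sum_(j < N) \sum_(i < N) (a i j)%:E * mu (A i) * mu (A j) <=
    energy m theta s r mu)%E.
Proof.
move=> r01 th01 mA tA a0 h.
have step (F : 'I_N -> R) (f : T -> \bar R) :
    (forall i, 0 <= F i) -> (forall x, 0 <= f x)%E -> measurable_fun setT f ->
    (forall i x, A i x -> (F i)%:E <= f x)%E ->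
    (\sum_(i < N) (F i)%:E * mu (A i) <= \int[mu]_x f x)%E.
  move=> F0 f0 mf hf.
  have -> : (\sum_(i < N) (F i)%:E * mu (A i) =
      \int[mu]_x \sum_(i < N) ((F i)%:E * (\1_(A i) x)%:E))%E.
    rewrite ge0_integral_sum//.
    - apply: eq_bigr => i _; rewrite ge0_integralZl_EFin//.
      + by rewrite integral_indic// setIT.
      + by apply/measurable_EFinP; exact: measurable_indic.
    - by move=> i; apply: measurable_funeM; apply/measurable_EFinP; exact: measurable_indic.
    - by move=> i x _; rewrite mule_ge0// lee_fin.
  apply: ge0_le_integral => //.
  - by move=> x _; apply: sume_ge0 => i _; rewrite mule_ge0// lee_fin.
  - apply: emeasurable_sum => i; apply: measurable_funeM.
    by apply/measurable_EFinP; exact: measurable_indic.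
  move=> x _; have [[i Aix]|nA] := pselect (exists i, A i x).
    rewrite (bigD1 i)//= big1 ?adde0.
      by rewrite indicE mem_set// mule1 hf.
    move=> j ji; rewrite indicE memNset ?mule0// => Ajx.
    by move/eqP: ji; apply; apply: tA => //; exists x.
  rewrite big1// => i _; rewrite indicE memNset ?mule0// => Aix.
  by apply: nA; exists i.
have muF i : (mu (A i)) \is a fin_num by exact: fin_num_measure.
have -> : (\sum_(j < N) \sum_(i < N) (a i j)%:E * mu (A i) * mu (A j) =
    \sum_(j < N) (\sum_(i < N) a i j * fine (mu (A i)))%:E * mu (A j))%E.
  apply: eq_bigr => j _; rewrite -sumEFin ge0_sume_distrl.
    by apply: eq_bigr => i _; rewrite EFinM fineK.
  by move=> i _; rewrite lee_fin mulr_ge0// fine_ge0.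
apply: (step _ _ _ _ _ _).
- by move=> j; apply: sumr_ge0 => i _; rewrite mulr_ge0// fine_ge0.
- by move=> y; apply: integral_ge0 => x _; rewrite lee_fin phi_ge0.
- exact: potential_measurable.
move=> j y Ajy; rewrite -sumEFin.
under eq_bigr do rewrite EFinM fineK//.
apply: (step _ _ _ _ _ _) => //.
- by move=> x; rewrite lee_fin phi_ge0.
- by apply: kernel_measurable => //; exact: measurable_cst.
by move=> i x Aix; rewrite lee_fin h.
Qed.

End Capacity.

(** * Point masses and finite nets *)

Section DiscreteMeasures.
Context {R : realType}.

Lemma discrete_probability d (T : measurableType d) N (x : nat -> T)
    (p : nat -> R) : (forall i, 0 <= p i) -> \sum_(i < N) p i = 1 ->
  exists mu : probability T R,
    (forall A, (forall i, A (x i)) -> mu A = 1%E) /\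
    forall f : T -> \bar R, (forall y, 0 <= f y)%E -> measurable_fun setT f ->
      (\int[mu]_y f y = \sum_(i < N) (p i)%:E * f (x i))%E.
Proof.
move=> p0 p1.
pose q i : {nonneg R} := NngNum (p0 i).
pose m_ i : {measure set T -> \bar R} := mscale (q i) (dirac (x i)).
pose mu0 : {measure set T -> \bar R} := msum m_ N.
have mu1 : mu0 setT = 1%E.
  rewrite /mu0/= /msum /= (eq_bigr (fun i : 'I_N => (p i)%:E)).
    by rewrite sumEFin p1.
  by move=> i _; rewrite /mscale/= diracT mule1.
pose B := Measure_isProbability.Build _ _ _ mu0 mu1.
pose mu : probability T R := HB.pack (Measure.sort mu0) B.
exists mu; split.
  move=> A xA.
  have -> : mu A = (\sum_(i < N) (p i)%:E * \d_(x i) A)%E by [].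
  rewrite -[RHS]/(1%:E) -p1 -sumEFin; apply: eq_bigr => i _.
  by rewrite diracE mem_set// mule1.
move=> f f0 mf.
have -> : (\int[mu]_y f y = \int[mu0]_y f y)%E by [].
rewrite ge0_integral_measure_sum//; apply: eq_bigr => i _.
by rewrite ge0_integral_mscale// integral_dirac// diracT mul1e.
Qed.

End DiscreteMeasures.

Section Nets.
Context {R : realType} {n : nat}.
Implicit Types (E : set 'rV[R]_n) (r : R).

Lemma coord_le_norm (x : 'rV[R]_n) i : `|x 0 i| <= `|x|.
Proof.
rewrite [leRHS]/Num.norm/= mx_normrE.
exact: (le_bigmax _ (fun ij => `|x ij.1 ij.2|) (0, i)).
Qed.

Lemma closure_enorm_le E (x : 'rV[R]_n) (e : R) : closure E x -> 0 < e ->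
  exists2 y, E y & enorm (x - y) <= e.
Proof.
(* Balls of the ambient topology are taken in the sup norm, and enorm is at most n times that norm;
   [n.+1] keeps the denominator nonzero. *)
move=> Ex e0; pose e' := e / n.+1%:R.
have e'0 : 0 < e' by rewrite divr_gt0.
have [y [Ey xy]] := Ex _ (nbhsx_ballx x e' e'0).
exists y => //; rewrite -ball_normE/= in xy.
apply: le_trans (@enorm_le_coord _ _ _ e' (ltW e'0) _) _.
  by move=> i; apply: le_trans (coord_le_norm _ _) (ltW xy).
rewrite /e' mulrA ler_pdivrMr// mulrC ler_pM2l// ler_nat; exact: leqnSn.
Qed.

Lemma bounded_closure_enorm E : bounded_set E ->
  exists2 D, 0 < D & forall x y, closure E x -> closure E y -> enorm (x - y) <= D.
Proof.
move=> [M [_ /(_ (`|M| + 1)) h]].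
have hM x : E x -> enorm x <= n%:R * (`|M| + 1).
  move=> Ex; apply: enorm_le_coord; first by rewrite addr_ge0.
  move=> i; apply: le_trans (coord_le_norm _ _) _; apply: h => //.
  by rewrite ltr_pwDr// ler_norm.
have hc x : closure E x -> enorm x <= n%:R * (`|M| + 1) + 1.
  move=> /closure_enorm_le/(_ ltr01)[y Ey xy].
  rewrite -(subrK y x) addrC (le_trans (ler_enormD _ _))// lerD// hM//.
exists (2 * (n%:R * (`|M| + 1) + 1)).
  by rewrite mulr_gt0// ltr_wpDl// mulr_ge0// addr_ge0.
move=> x y /hc hx /hc hy; rewrite mulrDl mul1r.
by apply: le_trans (ler_enormD _ _) _; rewrite enormN lerD.
Qed.

(** The net covers the closure of E but lies in E, so that its projection lies in the projection of
    E. A point of the closure moves by r / 2 into E, by r / 4 to a grid point, and by r / 4 back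
    into E. *)
Lemma finite_net E r : (0 < n)%N -> E !=set0 -> bounded_set E -> 0 < r ->
  exists N (x : nat -> 'rV[R]_n), (forall i, E (x i)) /\
    forall y, closure E y -> exists2 i, (i < N)%N & enorm (y - x i) <= r.
Proof.
move=> n0 [c Ec] bE r0; have [D D0 hD] := bounded_closure_enorm bE.
have r2 : 0 < r / 2 by rewrite divr_gt0.
have dV : \dim (fullv : {vspace 'rV[R]_n}) = n by rewrite dimvf /dim /= mul1n.
have rD : r / 2 <= Num.max (r / 2) D by rewrite le_max lexx.
have [L [_ hL]] := subspace_ball_cover n0 dV (memvf c) r2 rD.
(* A grid point far from E receives the default [c], itself a point of E. *)
pose g l := xget c [set z | E z /\ enorm (z - l) <= r / 4].
have Eg l : E (g l) by rewrite /g; case: xgetP => [z _ []|].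
exists (size L), (fun i => g (nth 0 L i)); split => // y Ey.
have r4 : 0 < r / 4 by rewrite divr_gt0.
have [z Ez yz] := closure_enorm_le Ey r2.
have [|l lL zl] := hL z (memvf _).
  apply: le_trans (hD _ _ (subset_closure Ez) (subset_closure Ec)) _.
  apply: (@le_trans _ _ (Num.max (r / 2) D)); first by rewrite le_max lexx orbT.
  by rewrite ler_peMl ?ler1n// (le_trans (ltW r2)).
exists (index l L); first by rewrite index_mem.
rewrite nth_index//.
have gl : enorm (g l - l) <= r / 4.
  rewrite /g; case: xgetP => [w _ []//|/(_ z)[]]; split=> //.
  by apply: le_trans zl _; lra.
apply: le_trans (ler_enormB _ z _) _.
have := ler_enormB z l (g l); rewrite (enormBC l) => h.
have {zl} : enorm (z - l) <= r / 4 by apply: le_trans zl _; lra.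
lra.
Qed.

End Nets.

Section CapacityTheory.
Context {R : realType} {n : nat}.
Local Notation T := (borel 'rV[R]_n).
Implicit Types (E : set 'rV[R]_n) (theta s r : R) (m : nat).

Definition min_energy m theta s r E : \bar R :=
  ereal_inf [set energy m theta s r mu |
    mu in [set mu : probability T R | mu (closure E) = 1%E]].

Lemma capacityE m theta s r E :
  capacity m theta s r E = (fine (min_energy m theta s r E))^-1.
Proof. by []. Qed.

(** Points and weights are total functions on nat of which only the first [N] values count, so that
    configurations of different sizes form one type and can be chosen scale by scale. *)
Definition discrete_energy m theta s r N (x : nat -> 'rV[R]_n) (p : nat -> R) : R :=
  \sum_(j < N) \sum_(i < N) p i * p j * phi m theta s r (x i - x j).

Lemma min_energy_le_discrete m theta s r E N (x : nat -> 'rV[R]_n) (p : nat -> R) :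
  0 < r <= 1 -> 0 < theta <= 1 -> (forall i, E (x i)) -> (forall i, 0 <= p i) ->
  \sum_(i < N) p i = 1 ->
  (min_energy m theta s r E <= (discrete_energy m theta s r N x p)%:E)%E.
Proof.
move=> r01 th01 Ex p0 p1; have [mu [mu1 muf]] := discrete_probability (x : nat -> T) p0 p1.
apply: ereal_inf_lbound; exists mu => /=.
  by apply: mu1 => i; exact: subset_closure.
rewrite /energy muf; last 2 first.
- by move=> y; apply: integral_ge0 => z _; rewrite lee_fin phi_ge0.
- exact: potential_measurable.
rewrite /discrete_energy -sumEFin; apply: eq_bigr => j _.
rewrite muf; last 2 first.
- by move=> z; rewrite lee_fin phi_ge0.
- by apply: kernel_measurable => //; exact: measurable_cst.
rewrite ge0_sume_distrr.
  by rewrite -sumEFin; apply: eq_bigr => i _; rewrite -!EFinM mulrA (mulrC (p j)).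
by move=> i _; rewrite -EFinM lee_fin mulr_ge0// phi_ge0.
Qed.

Lemma closure_measurable E : measurable (closure E : set T).
Proof.
rewrite -[X in measurable X]setCK; apply: measurableC.
apply: sub_sigma_algebra; apply: closed_openC; exact: closed_closure.
Qed.

Lemma eball_measurable (c : 'rV[R]_n) r : measurable (eball c r : set T).
Proof.
have mc : measurable_fun setT (fun w : T => enorm ((w : 'rV[R]_n) - c)).
  apply: enorm_measurable => i.
  rewrite (_ : (fun w => _) = (fun w : T => (w : 'rV[R]_n) 0 i - c 0 i)).
    by apply: measurable_funB; [exact: borel_coord_measurable|exact: measurable_cst].
  by apply/funext => w; rewrite !mxE.
have := mc measurableT _ (measurable_itv `]-oo, r]); rewrite setTI.
by congr measurable; apply/seteqP; split => x; rewrite /eball/= in_itv.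
Qed.

(** The balls of an r-net are cut into disjoint cells, and each centre receives the mass of its cell
    as weight. *)
Lemma energy_discretize m theta s r E (mu : probability T R) (e : R) :
  (0 < n)%N -> 0 < r <= 1 -> 0 < theta <= 1 -> 0 <= s <= m%:R ->
  E !=set0 -> bounded_set E -> mu (closure E) = 1%E ->
  (energy m theta s r mu <= e%:E)%E ->
  exists N (x : nat -> 'rV[R]_n) (p : nat -> R),
    [/\ forall i, E (x i), forall i, 0 <= p i, \sum_(i < N) p i = 1 &
     discrete_energy m theta s r N x p <= 3 ^+ m * e].
Proof.
move=> n0 r01 th01 sm E0 bE mu1 mue.
have r0 : 0 < r by case/andP: r01.
have [N [x [Ex hx]]] := finite_net n0 E0 bE r0.
pose B i : set T := eball (x i) r.
pose A := seqDU B.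
have mB i : measurable (B i) by exact: eball_measurable.
have mA i : measurable (A i) by exact: seqDU_measurable.
pose p i := fine (mu (A i)).
have muE i : mu (A i) = (p i)%:E by rewrite /p fineK// fin_num_measure.
exists N, x, p; split => //.
- by move=> i; exact: fine_ge0.
- apply: EFin_inj; rewrite -sumEFin.
  under eq_bigr do rewrite -muE.
  rewrite -(measure_semi_additive_ord_I mu (F := A)) => //; last first.
  + by apply: bigsetU_measurable => i _; exact: mA.
  + exact: sub_trivIset (@trivIset_seqDU _ B).
  rewrite -bigsetU_seqDU; apply/le_anti/andP; split.
    by apply: probability_le1; apply: bigsetU_measurable => i _; exact: mB.
  rewrite -mu1; apply: le_measure; rewrite ?inE.
  + exact: closure_measurable.
  + by apply: bigsetU_measurable => i _; exact: mB.
  move=> y /hx[i iN yi]; rewrite -bigcup_mkord; exists i => //.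
rewrite -ler_pdivrMl ?exprn_gt0//.
rewrite -lee_fin; apply: le_trans mue.
pose a (i j : 'I_N) := (3 ^+ m)^-1 * phi m theta s r (x i - x j).
have := @energy_ge_step R n m theta s r mu N (fun i => A i) a r01 th01.
have -> : (\sum_(j < N) \sum_(i < N) (a i j)%:E * mu (A i) * mu (A j) =
   ((3 ^+ m)^-1 * discrete_energy m theta s r N x p)%:E)%E.
  rewrite /discrete_energy mulr_sumr -sumEFin; apply: eq_bigr => j _.
  rewrite mulr_sumr -sumEFin; apply: eq_bigr => i _.
  rewrite !muE -!EFinM; congr (_%:E); rewrite /a; ring.
apply => //.
- have := @trivIset_seqDU _ B; rewrite -/A => tA i j _ _ AA.
  by apply: val_inj; apply: tA.
- by move=> i j; rewrite mulr_ge0// ?invr_ge0 ?exprn_ge0// phi_ge0.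
move=> i j y z Ay Az.
have By : B i y by exact: subset_seqDU Ay.
have Bz : B j z by exact: subset_seqDU Az.
rewrite /a ler_pdivrMl ?exprn_gt0// !phi_phir.
apply: le_phir => //; rewrite ?enorm_ge0 ?ler1n//.
(* Each point is within r of the centre of its cell, so max(r, |y - z|) <= 3 max(r, |x_i - x_j|);
   this is the origin of 3^m. *)
have h : enorm (y - z) <= enorm (x i - x j) + 2 * r.
  apply: le_trans (ler_enormB _ (x i) _) _.
  have := ler_enormB (x i) (x j) z; rewrite (enormBC (x j)).
  rewrite /B /eball/= in By Bz; lra.
rewrite ge_max; apply/andP; split.
  have : r <= Num.max r (enorm (x i - x j)) by rewrite le_max lexx.
  lra.
have h1 : r <= Num.max r (enorm (x i - x j)) by rewrite le_max lexx.
have h2 : enorm (x i - x j) <= Num.max r (enorm (x i - x j)) by rewrite le_max lexx orbT.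
lra.
Qed.

Section Bounds.
Variables (E : set 'rV[R]_n) (D : R).
Hypotheses (E0 : E !=set0)
  (hD : forall x y, closure E x -> closure E y -> enorm (x - y) <= D).

Lemma min_energy_le1 m theta s r : 0 < r <= 1 -> 0 < theta <= 1 -> 0 <= s ->
  (min_energy m theta s r E <= 1)%E.
Proof.
move=> r01 th01 s0; have [c Ec] := E0.
apply: (@le_trans _ _ (energy m theta s r (dirac (c : T)))).
  apply: ereal_inf_lbound; exists (dirac (c : T)) => //=.
  by rewrite /dirac/= indicE mem_set//; exact: subset_closure.
exact: energy_le1.
Qed.

Lemma min_energy_ge m theta s r : 0 < r <= 1 -> 0 < theta <= 1 -> 0 <= s <= m%:R ->
  (((r / Num.max r D) ^+ m)%:E <= min_energy m theta s r E)%E.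
Proof.
move=> r01 th01 sm; apply: le_ereal_inf_tmp => _ [mu mu1 <-].
have r0 : 0 < r by case/andP: r01.
have := @energy_ge_step R n m theta s r mu 1 (fun _ => closure E)
  (fun _ _ => (r / Num.max r D) ^+ m) r01 th01.
rewrite !big_ord1 mu1 !mule1; apply.
- by move=> _; exact: closure_measurable.
- by move=> i j _ _ _; rewrite (ord1 i) (ord1 j).
- by move=> _ _; rewrite exprn_ge0// divr_ge0// ?ltW// lt_max r0.
move=> _ _ x y Ex Ey; rewrite phi_phir.
apply: le_trans (phir_lb r01 th01 sm (enorm_ge0 _)).
apply: expr_le; first by rewrite divr_gt0// lt_max r0.
rewrite ler_pM2l// lef_pV2 ?posrE ?lt_max ?r0//.
by rewrite ge_max !le_max lexx hD ?orbT.
Qed.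

(** The infimum lies between a positive number and 1, so neither [fine] nor the inverse in
    [capacity] falls back on a default value. *)
Lemma min_energy_fin m theta s r : 0 < r <= 1 -> 0 < theta <= 1 -> 0 <= s <= m%:R ->
  min_energy m theta s r E = ((capacity m theta s r E)^-1)%:E.
Proof.
move=> r01 th01 sm; rewrite capacityE invrK fineK//.
have /andP[s0 _] := sm.
rewrite fin_numE; apply/andP; split; apply/eqP => h.
  by have := min_energy_ge r01 th01 sm; rewrite h.
by have := min_energy_le1 m r01 th01 s0; rewrite h.
Qed.

Lemma capacity_ge1 m theta s r : 0 < r <= 1 -> 0 < theta <= 1 -> 0 <= s <= m%:R ->
  1 <= capacity m theta s r E.
Proof.
move=> r01 th01 sm; have /andP[s0 _] := sm; have r0 : 0 < r by case/andP: r01.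
have := min_energy_le1 m r01 th01 s0; have := min_energy_ge r01 th01 sm.
rewrite min_energy_fin// !lee_fin => h1 h2.
have c0 : 0 < (capacity m theta s r E)^-1.
  by apply: lt_le_trans h1; rewrite exprn_gt0// divr_gt0// lt_max r0.
by rewrite -(invrK (capacity _ _ _ _ _)) invf_ge1.
Qed.

Lemma capacity_le m theta s r : 0 < r <= 1 -> 0 < theta <= 1 -> 0 <= s <= m%:R ->
  capacity m theta s r E <= (Num.max r D / r) ^+ m.
Proof.
move=> r01 th01 sm; have r0 : 0 < r by case/andP: r01.
have := min_energy_ge r01 th01 sm; have := capacity_ge1 r01 th01 sm.
rewrite min_energy_fin// lee_fin => h1 h2.
have c0 : 0 < (capacity m theta s r E)^-1 by rewrite invr_gt0 (lt_le_trans ltr01).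
have d0 : 0 < (r / Num.max r D) ^+ m by rewrite exprn_gt0// divr_gt0// lt_max r0.
by rewrite -invf_div exprVn -[leLHS]invrK lef_pV2 ?posrE.
Qed.

Lemma capacity_compare m th1 s1 th2 s2 r (c : R) :
  0 < r <= 1 -> 0 < th1 <= 1 -> 0 < th2 <= 1 -> 0 <= s1 <= m%:R -> 0 <= s2 <= m%:R ->
  0 < c ->
  (forall rho, 0 <= rho -> phir m th1 s1 r rho <= c * phir m th2 s2 r rho) ->
  capacity m th2 s2 r E <= c * capacity m th1 s1 r E.
Proof.
move=> r01 th1P th2P s1P s2P c0 h.
have c1 := capacity_ge1 r01 th1P s1P; have c2 := capacity_ge1 r01 th2P s2P.
have C1 : 0 < capacity m th1 s1 r E by exact: lt_le_trans c1.
have C2 : 0 < capacity m th2 s2 r E by exact: lt_le_trans c2.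
suff : (capacity m th1 s1 r E)^-1 <= c * (capacity m th2 s2 r E)^-1.
  move: (capacity m th1 s1 r E) (capacity m th2 s2 r E) C1 C2 => a b a0 b0.
  by rewrite ler_pdivlMr// mulrC ler_pdivrMr.
rewrite -ler_pdivrMl// -lee_fin -(min_energy_fin r01 th2P s2P).
apply: le_ereal_inf_tmp => _ [mu mu1 <-].
rewrite EFinM lee_pdivrMl//.
apply: le_trans (energy_le mu r01 th1P r01 th2P (ltW c0) h).
by rewrite -(min_energy_fin r01 th1P s1P); apply: ereal_inf_lbound; exists mu.
Qed.

End Bounds.
End CapacityTheory.

(** * Profiles *)

Section LimInfSup.
Context {R : realType}.
Implicit Types (f g : R -> \bar R) (c : R).
Local Notation F := ((0 : R)^'+).

Lemma near0_and (P Q : R -> Prop) : (\forall r \near F, P r) ->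
  (\forall r \near F, Q r) -> \forall r \near F, P r /\ Q r.
Proof.
by have FF := at_right_proper_filter (0 : R) => hP hQ; exact: filterI hP hQ.
Qed.

Lemma near0_ex (P : R -> Prop) : (\forall r \near F, P r) -> exists r, P r.
Proof.
by have FF := at_right_proper_filter (0 : R) => hP; have [r] := filter_ex hP; exists r.
Qed.

Lemma near0_sub (P Q : R -> Prop) : (forall r, P r -> Q r) ->
  (\forall r \near F, P r) -> \forall r \near F, Q r.
Proof.
by have FF := at_right_proper_filter (0 : R) => PQ; exact: filterS.
Qed.

Local Open Scope ereal_scope.

Lemma limf_einf_shift f g c : (\forall x \near F, g x <= f x + c%:E) ->
  limf_einf g F <= limf_einf f F + c%:E.
Proof.
move=> FW; rewrite !limf_einfE; apply: ge_ereal_sup => _ [V FV <-].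
have FU : F (V `&` [set x | g x <= f x + c%:E]) by exact: near0_and.
rewrite -leeBlDr//; apply: (@le_trans _ _ (ereal_inf (f @` (V `&` [set x | g x <= f x + c%:E])))).
  apply: le_ereal_inf_tmp => _ [x [Vx Wx] <-]; rewrite leeBlDr//.
  by apply: le_trans Wx; apply: ereal_inf_lbound; exists x.
by apply: ereal_sup_ubound; exists (V `&` [set x | g x <= f x + c%:E]).
Qed.

Lemma limf_esup_shift f g c : (\forall x \near F, g x <= f x + c%:E) ->
  limf_esup g F <= limf_esup f F + c%:E.
Proof.
move=> FW; rewrite !limf_esupE -leeBlDr//.
apply: le_ereal_inf_tmp => _ [V FV <-]; rewrite leeBlDr//.
have FU : F (V `&` [set x | g x <= f x + c%:E]) by exact: near0_and.
apply: (@le_trans _ _ (ereal_sup (g @` (V `&` [set x | g x <= f x + c%:E])))).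
  by apply: ereal_inf_lbound; exists (V `&` [set x | g x <= f x + c%:E]).
apply: ge_ereal_sup => _ [x [Vx Wx] <-]; apply: (le_trans Wx).
by rewrite leeD2r//; apply: ereal_sup_ubound; exists x.
Qed.

Lemma limf_einf_near f (a : \bar R) : a < limf_einf f F -> \forall x \near F, a < f x.
Proof.
rewrite limf_einfE => /ereal_sup_gt[_ [V FV <-] h].
apply: near0_sub FV => x Vx; apply: (lt_le_trans h).
by apply: ereal_inf_lbound; exists x.
Qed.

Lemma limf_esup_freq f (a : \bar R) V : a < limf_esup f F -> F V ->
  exists2 x, V x & a < f x.
Proof.
rewrite limf_esupE => h FV.
have : a < ereal_sup (f @` V).
  by apply: (lt_le_trans h); apply: ereal_inf_lbound; exists V.
by move=> /ereal_sup_gt[_ [x Vx <-] ax]; exists x.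
Qed.

Lemma limf_esup_near f (a : \bar R) : limf_esup f F < a -> \forall x \near F, f x < a.
Proof.
rewrite limf_esupE => /ereal_inf_lt[_ [V FV <-] h].
apply: near0_sub FV => x Vx; apply: le_lt_trans h.
by apply: ereal_sup_ubound; exists x.
Qed.

Lemma limf_einf_freq f (a : \bar R) V : limf_einf f F < a -> F V ->
  exists2 x, V x & f x < a.
Proof.
rewrite limf_einfE => h FV.
have : ereal_inf (f @` V) < a.
  by apply: le_lt_trans h; apply: ereal_sup_ubound; exists V.
by move=> /ereal_inf_lt[_ [x Vx <-] ax]; exists x.
Qed.

End LimInfSup.

Section Tarski.
Context {R : realType}.

(** Knaster-Tarski on [0, M]: the supremum of the s with s <= L s is fixed. Monotonicity between the
    two end conditions makes all values of [L] finite. *)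
Lemma monotone_fixpoint (L : R -> \bar R) (M : R) : 0 <= M ->
  (forall s s', 0 <= s -> s <= s' -> s' <= M -> (L s <= L s')%E) ->
  (0 <= L 0%R)%E -> (L M <= M%:E)%E ->
  exists2 s, 0 <= s <= M & L s = s%:E.
Proof.
move=> M0 mono L0 LM.
have b s : 0 <= s <= M -> (0 <= L s <= M%:E)%E.
  move=> /andP[s0 sM]; rewrite (le_trans L0) ?mono//=.
  by rewrite (le_trans _ LM)// mono.
have Lf s : 0 <= s <= M -> L s = (fine (L s))%:E.
  move=> /b /andP[l u]; rewrite fineK// fin_numE.
  by apply/andP; split; apply/eqP => h; rewrite h in l u.
pose S := [set s | 0 <= s <= M /\ (s%:E <= L s)%E].
have S0 : S 0 by split; rewrite ?lexx//.
have Sub : has_sup S by split; [exists 0|exists M => s [/andP[]]].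
pose t := sup S.
have t01 : 0 <= t <= M.
  apply/andP; split; first by apply: ub_le_sup => //; case: Sub.
  by apply: ge_sup; [exists 0|move=> s [/andP[]]].
have /andP[t0 tM] := t01.
have tL : (t%:E <= L t)%E.
  rewrite (Lf t t01) lee_fin; apply: ge_sup; first by exists 0.
  move=> s Ss; have [/andP[s0 sM] sL] := Ss.
  rewrite -lee_fin -(Lf t t01); apply: (le_trans sL); apply: mono => //.
  by apply: ub_le_sup => //; case: Sub.
exists t => //; apply/le_anti/andP; split => //.
have Lt := Lf t t01; have /andP[l0 l1] := b t t01; rewrite Lt lee_fin in l0 l1 tL *.
rewrite !lee_fin in l0 l1.
apply: ub_le_sup; first by case: Sub.
split; first by rewrite l0 l1.
by rewrite -Lt; apply: mono.
Qed.

End Tarski.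

Section ProfileTheory.
Context {R : realType} {n : nat}.
Variables (m : nat) (E : set 'rV[R]_n).
Hypotheses (n0 : (0 < n)%N) (E0 : E !=set0) (bE : bounded_set E).
Implicit Types (theta s r : R).

Lemma near0_lt (e : R) : 0 < e -> \forall r \near 0^'+, 0 < r < e.
Proof.
move=> e0; near=> r; apply/andP; split; near: r.
  exact: nbhs_right_gt.
exact: nbhs_right_lt.
Unshelve. all: by end_near.
Qed.

Lemma neg_ln_gt0 r : 0 < r < 1 -> 0 < - ln r.
Proof. by move=> r01; rewrite oppr_gt0 ln_lt0. Qed.

Let Dex := bounded_closure_enorm bE.

Lemma bounded_capacity_ge1 theta s r : 0 < r <= 1 -> 0 < theta <= 1 -> 0 <= s <= m%:R ->
  1 <= capacity m theta s r E.
Proof. by have [D D0 hD] := Dex; move=> *; apply: (@capacity_ge1 _ _ E D). Qed.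

(** A pointwise bound on kernels passes to energies and is reversed by inversion; dividing
    logarithms by -ln r turns the factor r^(-c) into the summand c. *)
Lemma log_capacity_compare th1 s1 th2 s2 r (c : R) :
  0 < r < 1 -> 0 < th1 <= 1 -> 0 < th2 <= 1 -> 0 <= s1 <= m%:R -> 0 <= s2 <= m%:R ->
  (forall rho, 0 <= rho -> phir m th1 s1 r rho <= r `^ (- c) * phir m th2 s2 r rho) ->
  (log_capacity m th2 s2 E r <= log_capacity m th1 s1 E r + c%:E)%E.
Proof.
move=> r01 th1P th2P s1P s2P h; have [D D0 hD] := Dex.
have r01' : 0 < r <= 1 by case/andP: r01 => -> /ltW ->.
have r0 : 0 < r by case/andP: r01.
have l0 := neg_ln_gt0 r01.
have c1 := bounded_capacity_ge1 r01' th1P s1P; have c2 := bounded_capacity_ge1 r01' th2P s2P.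
have := capacity_compare E0 hD r01' th1P th2P s1P s2P (powR_gt0 _ r0) h.
rewrite /log_capacity -EFinD lee_fin.
move: (capacity m th1 s1 r E) (capacity m th2 s2 r E) c1 c2 => a b a1 b1 ba.
have a0 : 0 < a by exact: lt_le_trans a1.
have b0 : 0 < b by exact: lt_le_trans b1.
rewrite ler_pdivrMr// mulrDl divfK ?gt_eqF//.
have -> : c * - ln r = ln (r `^ (- c)) by rewrite ln_powR mulNr mulrN.
by rewrite addrC -lnM ?posrE ?powR_gt0// ler_ln ?posrE// mulr_gt0// powR_gt0.
Qed.

Lemma log_capacity_mono theta s s' r : 0 < r < 1 -> 0 < theta <= 1 ->
  0 <= s -> s <= s' -> s' <= m%:R ->
  (log_capacity m theta s E r <= log_capacity m theta s' E r)%E.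
Proof.
move=> r01 th01 s0 ss sm; rewrite -[leRHS]adde0.
have r01' : 0 < r <= 1 by case/andP: r01 => -> /ltW ->.
apply: log_capacity_compare => //; rewrite ?s0 ?sm ?(le_trans s0) ?(le_trans ss)//.
by move=> rho rho0; rewrite oppr0 powRr0 mul1r phir_exponent_antitone.
Qed.

Lemma log_capacity_lip theta s s' r : 0 < r < 1 -> 0 < theta <= 1 ->
  0 <= s -> s <= s' -> s' <= m%:R ->
  (log_capacity m theta s' E r <=
   log_capacity m theta s E r + ((1 - theta) * (s' - s))%:E)%E.
Proof.
move=> r01 th01 s0 ss sm.
have r01' : 0 < r <= 1 by case/andP: r01 => -> /ltW ->.
apply: log_capacity_compare => //; rewrite ?s0 ?sm ?(le_trans s0) ?(le_trans ss)//.
by move=> rho rho0; rewrite phir_exponent_ratio.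
Qed.

Lemma log_capacity_theta q theta s r : 0 < r < 1 -> 0 < q -> q <= theta ->
  theta <= 1 -> 0 <= s <= m%:R ->
  (log_capacity m theta s E r <= log_capacity m q s E r + ((theta - q) * m%:R)%:E)%E.
Proof.
move=> r01 q0 qth th1 sm.
have r01' : 0 < r <= 1 by case/andP: r01 => -> /ltW ->.
apply: log_capacity_compare => //; first by rewrite q0 (le_trans qth).
  by rewrite th1 (lt_le_trans q0).
by move=> rho rho0; rewrite phir_theta_ratio.
Qed.

Lemma log_capacity_ge0 theta s r : 0 < r < 1 -> 0 < theta <= 1 -> 0 <= s <= m%:R ->
  (0 <= log_capacity m theta s E r)%E.
Proof.
move=> r01 th01 sm; rewrite lee_fin divr_ge0//.
  by rewrite ln_ge0// bounded_capacity_ge1//; case/andP: r01 => -> /ltW ->.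
by rewrite ltW// neg_ln_gt0.
Qed.

Lemma log_capacity_le theta s (e : R) : 0 < theta <= 1 -> 0 <= s <= m%:R -> 0 < e ->
  \forall r \near 0^'+, (log_capacity m theta s E r <= (m%:R + e)%:E)%E.
Proof.
move=> th01 sm e0; have [D D0 hD] := Dex.
(* Once -ln r >= k, the contribution m ln D to the logarithm of (D / r)^m is at most e times -ln
   r. *)
pose k := `|ln D| *+ m / e.
have e1 : 0 < Num.min 1 (Num.min D (expR (- k))).
  by rewrite !lt_min ltr01 D0 expR_gt0.
apply: near0_sub (near0_lt e1) => r /andP[r0]; rewrite !lt_min => /and3P[r1 rD rk].
have r01 : 0 < r <= 1 by rewrite r0 ltW.
have l0 : 0 < - ln r by apply: neg_ln_gt0; rewrite r0.
have lk : k <= - ln r by rewrite -lerNr -(expRK (- k)) ler_ln ?posrE ?expR_gt0// ltW.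
rewrite lee_fin ler_pdivrMr//.
have := capacity_le E0 hD r01 th01 sm; rewrite max_r ?(ltW rD)// => h.
have c0 : 0 < capacity m theta s r E by rewrite (lt_le_trans ltr01)// bounded_capacity_ge1.
have Dr : 0 < D / r by rewrite divr_gt0.
rewrite -(ler_ln (x := capacity m theta s r E)) ?posrE ?exprn_gt0// in h.
apply: (le_trans h); rewrite lnXn// ln_div ?posrE// mulrnBl mulrDl -mulNrn.
rewrite mulr_natl addrC lerD2l.
apply: (@le_trans _ _ (`|ln D| *+ m)); first by rewrite lerMn2r ler_norm orbT.
by rewrite mulrC -ler_pdivrMr.
Qed.

Section Fix.
Variable theta : R.
Hypothesis th01 : 0 < theta <= 1.
Let gf s := log_capacity m theta s E.

Let near01 : \forall r \near (0 : R)^'+, 0 < r < 1. Proof. exact: near0_lt. Qed.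

Lemma limf_einf_log_capacity_lip s s' : 0 <= s -> s <= s' -> s' <= m%:R ->
  (limf_einf (gf s) 0^'+ <= limf_einf (gf s') 0^'+ /\
  limf_einf (gf s') 0^'+ <= limf_einf (gf s) 0^'+ + ((1 - theta) * (s' - s))%:E)%E.
Proof.
move=> s0 ss sm; split.
  rewrite -[leRHS]adde0; apply: limf_einf_shift.
  by apply: near0_sub near01 => r r01; rewrite adde0 log_capacity_mono.
by apply: limf_einf_shift; apply: near0_sub near01 => r r01; exact: log_capacity_lip.
Qed.

Lemma limf_esup_log_capacity_lip s s' : 0 <= s -> s <= s' -> s' <= m%:R ->
  (limf_esup (gf s) 0^'+ <= limf_esup (gf s') 0^'+ /\
  limf_esup (gf s') 0^'+ <= limf_esup (gf s) 0^'+ + ((1 - theta) * (s' - s))%:E)%E.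
Proof.
move=> s0 ss sm; split.
  rewrite -[leRHS]adde0; apply: limf_esup_shift.
  by apply: near0_sub near01 => r r01; rewrite adde0 log_capacity_mono.
by apply: limf_esup_shift; apply: near0_sub near01 => r r01; exact: log_capacity_lip.
Qed.

Let ge0 s : 0 <= s <= m%:R -> \forall r \near 0^'+, (0 <= gf s r)%E.
Proof. by move=> sm; apply: near0_sub near01 => r r01; exact: log_capacity_ge0. Qed.


Lemma limf_einf_log_capacity_ge0 s : 0 <= s <= m%:R -> (0 <= limf_einf (gf s) 0^'+)%E.
Proof.
move=> sm; rewrite leNgt; apply/negP => /limf_einf_freq/(_ (ge0 sm))[r].
by move=> h1 h2; move: (lt_le_trans h2 h1); rewrite ltxx.
Qed.

Lemma limf_esup_log_capacity_ge0 s : 0 <= s <= m%:R -> (0 <= limf_esup (gf s) 0^'+)%E.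
Proof.
move=> sm; rewrite leNgt; apply/negP => lt_h; have h := limf_esup_near lt_h.
have [r [h1 h2]] := near0_ex (near0_and (ge0 sm) h).
by move: (lt_le_trans h2 h1); rewrite ltxx.
Qed.

Lemma limf_einf_log_capacity_le s : 0 <= s <= m%:R -> (limf_einf (gf s) 0^'+ <= m%:R%:E)%E.
Proof.
move=> sm; apply/lee_addgt0Pr => e e0; rewrite leNgt; apply/negP => lt_h; have h := limf_einf_near lt_h.
have [r [h1 h2]] := near0_ex (near0_and (log_capacity_le th01 sm e0) h).
by move: (lt_le_trans h2 h1); rewrite EFinD ltxx.
Qed.

Lemma limf_esup_log_capacity_le s : 0 <= s <= m%:R -> (limf_esup (gf s) 0^'+ <= m%:R%:E)%E.
Proof.
move=> sm; apply/lee_addgt0Pr => e e0; rewrite leNgt; apply/negP => h.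
have [r h1 h2] := limf_esup_freq h (log_capacity_le th01 sm e0).
by move: (lt_le_trans h2 h1); rewrite EFinD ltxx.
Qed.

(** Once a fixed point of the monotone map exists, the value selected by [get] is one. *)
Lemma lower_profileP : 0 <= lower_profile m theta E <= m%:R /\
  limf_einf (gf (lower_profile m theta E)) 0^'+ = (lower_profile m theta E)%:E.
Proof.
rewrite /lower_profile; case: xgetP => [s _ //|].
have [||||s s01 Ls] := @monotone_fixpoint R (fun s => limf_einf (gf s) 0^'+) m%:R.
- by [].
- by move=> s s' s0 ss sm; have [] := limf_einf_log_capacity_lip s0 ss sm.
- by apply: limf_einf_log_capacity_ge0; rewrite lexx ler0n.
- by apply: limf_einf_log_capacity_le; rewrite lexx ler0n.
by move=> /(_ s)[]; split.
Qed.

Lemma upper_profileP : 0 <= upper_profile m theta E <= m%:R /\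
  limf_esup (gf (upper_profile m theta E)) 0^'+ = (upper_profile m theta E)%:E.
Proof.
rewrite /upper_profile; case: xgetP => [s _ //|].
have [||||s s01 Ls] := @monotone_fixpoint R (fun s => limf_esup (gf s) 0^'+) m%:R.
- by [].
- by move=> s s' s0 ss sm; have [] := limf_esup_log_capacity_lip s0 ss sm.
- by apply: limf_esup_log_capacity_ge0; rewrite lexx ler0n.
- by apply: limf_esup_log_capacity_le; rewrite lexx ler0n.
by move=> /(_ s)[]; split.
Qed.

End Fix.

(** Chains a Lipschitz bound in s with one in theta; in the extended reals it applies to the limits
    before they are known to be finite. *)
Lemma ereal_lip_gt (a b c : \bar R) (c1 c2 P s : R) : a = P%:E ->
  (a <= b + c1%:E)%E -> (b <= c + c2%:E)%E -> s < P - c1 - c2 -> (s%:E < c)%E.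
Proof.
move=> ->; case: c => [c| |] //; case: b => [b| |] //; rewrite -?EFinD ?lee_fin ?lte_fin//.
  lra.
all: by rewrite ?ltry.
Qed.

(* At [theta] the limit exceeds [s] by at least [theta * (P - s)], and passing
   to [q] costs at most [(theta - q) * m]. *)
Lemma lower_profile_gap theta s : 0 < theta <= 1 -> 0 <= s ->
  s < lower_profile m theta E -> exists2 e, 0 < e & forall q, 0 < q -> q <= theta ->
  theta - q < e -> (s%:E < limf_einf (log_capacity m q s E) 0^'+)%E.
Proof.
move=> th01 s0; have [/andP[P0 Pm] PL] := lower_profileP th01.
have [th0 th1] := andP th01.
set P := lower_profile m theta E in P0 Pm PL * => sP.
have sm : s <= m%:R by rewrite (le_trans (ltW sP)).
have [_ h] := limf_einf_log_capacity_lip th01 s0 (ltW sP) Pm.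
(* This keeps [(theta - q) * m] below [theta * (P - s)]; [m.+1] is positive for every [m]. *)
exists (theta * (P - s) / m.+1%:R).
  by rewrite divr_gt0// mulr_gt0// subr_gt0.
move=> q q0 qth; rewrite ltr_pdivlMr// -natr1 mulrDr mulr1 => hq.
have h2 : (limf_einf (log_capacity m theta s E) 0^'+ <=
   limf_einf (log_capacity m q s E) 0^'+ + ((theta - q) * m%:R)%:E)%E.
  apply: limf_einf_shift; apply: near0_sub (near0_lt ltr01) => r r01.
  by apply: log_capacity_theta => //; rewrite s0.
apply: (ereal_lip_gt PL h h2); move: hq; set x := (theta - q) * m%:R => hq.
have : 0 <= theta - q by rewrite subr_ge0.
have -> : P - (1 - theta) * (P - s) - x = s + theta * (P - s) - x by ring.
lra.
Qed.

Lemma upper_profile_gap theta s : 0 < theta <= 1 -> 0 <= s ->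
  s < upper_profile m theta E -> exists2 e, 0 < e & forall q, 0 < q -> q <= theta ->
  theta - q < e -> (s%:E < limf_esup (log_capacity m q s E) 0^'+)%E.
Proof.
move=> th01 s0; have [/andP[P0 Pm] PL] := upper_profileP th01.
have [th0 th1] := andP th01.
set P := upper_profile m theta E in P0 Pm PL * => sP.
have sm : s <= m%:R by rewrite (le_trans (ltW sP)).
have [_ h] := limf_esup_log_capacity_lip th01 s0 (ltW sP) Pm.
exists (theta * (P - s) / m.+1%:R).
  by rewrite divr_gt0// mulr_gt0// subr_gt0.
move=> q q0 qth; rewrite ltr_pdivlMr// -natr1 mulrDr mulr1 => hq.
have h2 : (limf_esup (log_capacity m theta s E) 0^'+ <=
   limf_esup (log_capacity m q s E) 0^'+ + ((theta - q) * m%:R)%:E)%E.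
  apply: limf_esup_shift; apply: near0_sub (near0_lt ltr01) => r r01.
  by apply: log_capacity_theta => //; rewrite s0.
apply: (ereal_lip_gt PL h h2); move: hq; set x := (theta - q) * m%:R => hq.
have : 0 <= theta - q by rewrite subr_ge0.
have -> : P - (1 - theta) * (P - s) - x = s + theta * (P - s) - x by ring.
lra.
Qed.

End ProfileTheory.

(** * Covers of projections *)

Section QuadraticForm.
Context {R : realType}.
Variables (N : nat) (Phi : nat -> nat -> R).
Hypotheses (Phi_sym : forall i j, Phi i j = Phi j i) (Phi_le1 : forall i, Phi i i <= 1).

Let B (p q : nat -> R) : R := \sum_(j < N) \sum_(i < N) p i * q j * Phi i j.

Let B_sym p q : B p q = B q p.
Proof.
rewrite /B exchange_big; apply: eq_bigr => j _; apply: eq_bigr => i _ /=.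
by rewrite Phi_sym (mulrC (p j)).
Qed.

Let B_lin a b p q w : B (fun i => a * p i + b * q i) w = a * B p w + b * B q w.
Proof.
rewrite /B !mulr_sumr -big_split; apply: eq_bigr => j _ /=.
rewrite !mulr_sumr -big_split; apply: eq_bigr => i _ /=; ring.
Qed.

Let e (i : 'I_N) (j : nat) : R := ((i : nat) == j)%:R.

Let sum_e (i : 'I_N) (f : nat -> R) : \sum_(j < N) e i j * f j = f i.
Proof.
rewrite (bigD1 i)//= big1 ?addr0 /e ?eqxx ?mul1r// => j ji.
by rewrite (inj_eq val_inj) eq_sym (negbTE ji) mul0r.
Qed.

Let B_e p (i : 'I_N) : B (e i) p = \sum_(j < N) p j * Phi i j.
Proof.
apply: eq_bigr => j _; under eq_bigr do rewrite mulrAC -mulrA.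
by rewrite (sum_e i (fun k => Phi k j * p j)) mulrC.
Qed.

(* First-order optimality of an approximate minimizer [p], tested against
   moving mass [tau = gamma / 4] to the point [i]; working with an
   approximate minimizer avoids any compactness argument. *)
Lemma near_minimizer_potential (gamma : R) : (0 < N)%N -> 0 < gamma -> gamma <= 1 ->
  (forall p : nat -> R, (forall i, 0 <= p i) -> \sum_(i < N) p i = 1 ->
    gamma <= \sum_(j < N) \sum_(i < N) p i * p j * Phi i j) ->
  exists p : nat -> R, [/\ forall i, 0 <= p i, \sum_(i < N) p i = 1 &
    forall i : 'I_N, gamma / 2 <= \sum_(j < N) p j * Phi i j].
Proof.
move=> N0 g0 g1 hg.
pose simplex p := (forall i : nat, 0 <= p i :> R) /\ \sum_(i < N) p i = 1 :> R.
have se (i : 'I_N) : simplex (e i).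
  split; first by move=> j; exact: ler0n.
  by have := sum_e i (fun _ => 1); under eq_bigr do rewrite mulr1.
pose S := [set B p p | p in simplex].
have Sl : has_lbound S by exists gamma => _ [p [p0 p1] <-]; exact: hg.
have Si : has_inf S.
  by split => //; exists (B (e (Ordinal N0)) (e (Ordinal N0))); exists (e (Ordinal N0)).
have gS : gamma <= inf S.
  by apply: lb_le_inf; [case: Si|move=> _ [p [p0 p1] <-]; exact: hg].
pose tau := gamma / 4.
have tau0 : 0 < tau by rewrite divr_gt0.
(* The slack tau^2 has the order of the quadratic part of the perturbation: after division by [tau],
   the loss in the first-order condition is of order [tau]. *)
have [_ [p [p0 p1] <-] hp] := inf_adherent (exprn_gt0 2 tau0) Si.
exists p; split => // i.
rewrite -B_e; set b := B (e i) p.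
pose p' j := (1 - tau) * p j + tau * e i j.
have tau1 : 0 <= 1 - tau by rewrite /tau; lra.
have [ei0 ei1] := se i.
have sp' : simplex p'.
  split; first by move=> j; rewrite addr_ge0// mulr_ge0// ltW.
  by rewrite big_split/= -!mulr_sumr p1 ei1 !mulr1 subrK.
have : inf S <= B p' p' by apply: ge_inf => //; exists p'.
rewrite B_lin (B_sym p) (B_sym (e i)) !B_lin (B_sym p (e i)) -/b.
have -> : B (e i) (e i) = Phi i i by rewrite B_e (sum_e i (fun j => Phi i j)).
have := Phi_le1 i; move: hp; rewrite -/S.
move: (B p p) (inf S) gS (Phi i i) => Q I gI f hQ hf hI.
have h1 : I <= (1 - tau) ^+ 2 * (I + tau ^+ 2) + 2 * tau * (1 - tau) * b + tau ^+ 2.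
  apply: (le_trans hI).
  have -> : (1 - tau) * ((1 - tau) * Q + tau * b) + tau * ((1 - tau) * b + tau * f) =
    (1 - tau) ^+ 2 * Q + 2 * tau * (1 - tau) * b + tau ^+ 2 * f by ring.
  rewrite lerD ?lerD2r//.
    by rewrite ler_wpM2l ?sqr_ge0// ltW.
  by rewrite -[leRHS]mulr1 ler_wpM2l ?sqr_ge0.
have {h1} h2 : tau * (2 * I - tau * I - tau * ((1 - tau) ^+ 2 + 1)) <= tau * (2 * (1 - tau) * b).
  by rewrite -subr_ge0; move: h1; rewrite -subr_ge0 => h1; apply: le_trans h1 _;
     rewrite le_eqVlt; apply/orP; left; apply/eqP; ring.
rewrite ler_pM2l// in h2.
have h3 : (1 - tau) ^+ 2 <= 1.
  by rewrite expr_le1// /tau; lra.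
have h4 : gamma <= 2 * (1 - tau) * b.
  apply: le_trans h2; have : tau * ((1 - tau) ^+ 2 + 1) <= tau * 2.
    by rewrite ler_wpM2l ?(ltW tau0)//; lra.
  have : (2 - tau) * gamma <= (2 - tau) * I by rewrite ler_wpM2l// /tau; lra.
  have : tau * gamma <= tau * 1 by rewrite ler_wpM2l ?(ltW tau0).
  by rewrite /tau; lra.
have b0 : 0 <= b.
  rewrite leNgt; apply/negP => b0.
  have : 2 * (1 - tau) * b <= 0 by rewrite mulr_ge0_le0 ?mulr_ge0// ltW.
  lra.
have : (1 - tau) * b <= b by rewrite ler_piMl// /tau; lra.
lra.
Qed.

End QuadraticForm.

Section Vitali.
Context {R : realType} {n : nat}.

(** Greedy selection: keep a ball of largest radius, discard every ball whose centre is within the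
    sum of the radii, and recurse on the rest. Each discarded ball is charged to a kept one that is
    at least as large. *)
Lemma finite_vitali N (y : nat -> 'rV[R]_n) (rad : 'I_N -> R) :
  (forall i, 0 <= rad i) ->
  exists S : {set 'I_N},
    (forall i j, i \in S -> j \in S -> i != j ->
       rad i + rad j < enorm (y i - y j)) /\
    forall i, exists2 j, j \in S & rad i <= rad j /\ enorm (y i - y j) <= rad i + rad j.
Proof.
move=> rad0.
suff H k (A : {set 'I_N}) : (#|A| <= k)%N -> exists2 S : {set 'I_N}, S \subset A &
    (forall i j, i \in S -> j \in S -> i != j ->
       rad i + rad j < enorm (y i - y j)) /\
    forall i, i \in A -> exists2 j, j \in S &
      rad i <= rad j /\ enorm (y i - y j) <= rad i + rad j.
  have [S _ [S1 S2]] := H _ [set: 'I_N]%SET (leqnn _).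
  by exists S; split => // i; apply: S2; rewrite inE.
elim: k A => [|k IH] A.
  rewrite leqn0 cards_eq0 => /eqP ->; exists finset.set0; first exact: finset.sub0set.
  by split => [i j|i]; rewrite inE.
move=> Ak; have [A0|[a aA]] := set_0Vmem A.
  by apply: IH; rewrite A0 cards0.
pose i0 := [arg max_(i > a in A) rad i]%O.
have [i0A i0max] : i0 \in A /\ forall i, i \in A -> rad i <= rad i0.
  by rewrite /i0; case: arg_maxP => // i iA h; split.
pose A' := [set i in A | rad i + rad i0 < enorm (y i - y i0)]%SET.
have A'A : A' \subset A by apply/fintype.subsetP => i; rewrite inE => /andP[].
have [|S SA' [S1 S2]] := IH A'.
  rewrite -ltnS; apply: leq_trans Ak; apply: proper_card.
  apply/properP; split => //; exists i0 => //.
  by rewrite inE i0A /= subrr enorm0 -leNgt addr_ge0.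
exists (i0 |: S)%SET.
  by rewrite finset.subUset finset.sub1set i0A (fintype.subset_trans SA' A'A).
split.
  have h i : i \in S -> rad i + rad i0 < enorm (y i - y i0).
    by move=> /(fintype.subsetP SA'); rewrite inE => /andP[].
  move=> i j; rewrite !inE => /orP[/eqP ->|iS] /orP[/eqP ->|jS].
  - by rewrite eqxx.
  - by move=> _; rewrite addrC enormBC h.
  - by move=> _; exact: h.
  - exact: S1.
move=> i iA; have [iA'|] := boolP (i \in A').
  by have [j jS hj] := S2 _ iA'; exists j => //; rewrite !inE jS orbT.
rewrite inE iA /= -leNgt => h; exists i0; first by rewrite !inE eqxx.
by split => //; exact: i0max.
Qed.

End Vitali.

Section ProjectionCover.
Context {R : realType} {n : nat}.
Implicit Types (V : {vspace 'rV[R]_n}) (E : set 'rV[R]_n) (theta s r : R) (m L : nat).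

(** Only the least k with z <= 2^k r is used: there the radius 2^k r exceeds max(r, z) by a factor
    at most 2, whence 2^m. The bound turns a potential into a sum of masses of balls. *)
Lemma phir_dyadic m theta s r L z : 0 < r <= 1 -> 0 < theta <= 1 ->
  0 <= s <= m%:R -> 0 <= z <= 2 ^+ L * r ->
  phir m theta s r z <=
    \sum_(k < L.+1) 2 ^+ m * phir m theta s r (2 ^+ k * r) * (z <= 2 ^+ k * r)%R%:R.
Proof.
move=> r01 th01 sm /andP[z0 zL]; have r0 : 0 < r by case/andP: r01.
have p0 k : 0 <= 2 ^+ k * r by rewrite mulr_ge0 ?exprn_ge0 ?(ltW r0).
have ex : exists k, z <= 2 ^+ k * r by exists L.
have := ex_minnP ex; case=> k zk kmin.
have kL : (k < L.+1)%N by rewrite ltnS kmin.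
rewrite (bigD1 (Ordinal kL))//= zk mulr1.
apply: (@le_trans _ _ (2 ^+ m * phir m theta s r (2 ^+ k * r))); last first.
  rewrite lerDl; apply: sumr_ge0 => i _; rewrite !mulr_ge0 ?ler0n ?exprn_ge0//.
  by rewrite ltW// phir_gt0.
apply: le_phir => //; first by rewrite ler1n.
case: k zk kmin kL => [|k] zk kmin _.
  rewrite expr0 mul1r maxxx -[leLHS]mul1r ler_pM ?ler1n ?(ltW r0)//.
  by rewrite le_max lexx.
have kz : 2 ^+ k * r < z.
  by rewrite ltNge; apply/negP => /kmin; rewrite ltnn.
rewrite ge_max; apply/andP; split.
  rewrite -[leLHS]mul1r ler_pM ?ler1n ?(ltW r0)//.
  by rewrite le_max lexx.
rewrite exprS -mulrA ler_pM2l// le_max; apply/orP; right; exact: ltW.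
Qed.

(** The kernel scale [r] produces diameters in [r, r^theta], which is the range allowed at scale
    r^theta in the definition of the dimension. The pairs hold a centre and a diameter. *)
Lemma projection_cover m V E : (0 < n)%N -> (0 < m)%N -> \dim V = m ->
  E !=set0 -> bounded_set E ->
  forall theta s r L, 0 < theta <= 1 -> 0 <= s <= m%:R -> 0 < r <= 1 ->
  (forall x y, E x -> E y -> enorm (x - y) <= 2 ^+ L * r) ->
  exists Lc : seq ('rV[R]_n * R),
   [/\ forall x, E x -> exists2 c, c \in Lc & enorm (orthoproj V x - c.1) <= c.2 / 2,
       forall c, c \in Lc -> r <= c.2 <= r `^ theta &
       \sum_(c <- Lc) c.2 `^ s <=
         (13 * m%:R) ^+ m * 2 ^+ m.+1 * L.+1%:R * r `^ s * capacity m theta s r E].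
Proof.
move=> n0 m0 dV E0 bE theta s r L th01 sm r01 EL.
have r0 : 0 < r by case/andP: r01.
have [N [x [Ex hx]]] := finite_net n0 E0 bE r0.
have N0 : (0 < N)%N.
  by have [c /subset_closure/hx[i iN _]] := E0; exact: leq_trans iN.
have [D _ hD] := bounded_closure_enorm bE.
have C1 := capacity_ge1 E0 hD r01 th01 sm.
set C := capacity m theta s r E in C1 *.
have C0 : 0 < C by exact: lt_le_trans C1.
pose gamma := C^-1.
have g0 : 0 < gamma by rewrite invr_gt0.
have g1 : gamma <= 1 by rewrite invf_le1.
pose Phi i j := phi m theta s r (x i - x j).
have [|i|p p0 p1|p [p0 p1 pg]] := @near_minimizer_potential R N Phi _ _ gamma N0 g0 g1.
- by move=> i j; rewrite /Phi !phi_phir enormBC.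
- by rewrite /Phi phi_phir phir_le1 ?enorm_ge0//; case/andP: sm.
- rewrite -lee_fin; apply: le_trans (min_energy_le_discrete m s r01 th01 Ex p0 p1).
  by rewrite (min_energy_fin E0 hD r01 th01 sm).
pose y i := orthoproj V (x i).
have yx i j : enorm (y i - y j) <= enorm (x i - x j).
  by rewrite /y -linearB orthoproj_le.
pose P (i : 'I_N) (k : 'I_L.+1) := \sum_(j < N) p j * (enorm (y i - y j) <= 2 ^+ k * r)%R%:R.
have hP0 i k : 0 <= P i k by apply: sumr_ge0 => j _; rewrite mulr_ge0.
have fk (k : nat) : 0 < phir m theta s r (2 ^+ k * r).
  by rewrite phir_gt0// mulr_ge0// ltW.
(* Pigeonhole: of the L + 1 dyadic terms bounding the potential at x_i, one carries at least an
   equal share of gamma / 2. *)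
have hk (i : 'I_N) : exists k : 'I_L.+1,
    gamma / 2 / L.+1%:R <= 2 ^+ m * phir m theta s r (2 ^+ k * r) * P i k.
  apply/not_existsP => h.
  have : gamma / 2 <= \sum_(k < L.+1) 2 ^+ m * phir m theta s r (2 ^+ k * r) * P i k.
    apply: (le_trans (pg i)).
    apply: (@le_trans _ _ (\sum_(j < N) \sum_(k < L.+1) p j *
        (2 ^+ m * phir m theta s r (2 ^+ k * r) * (enorm (y i - y j) <= 2 ^+ k * r)%R%:R))).
      apply: ler_sum => j _; rewrite -mulr_sumr ler_wpM2l//.
      apply: (@le_trans _ _ (phir m theta s r (enorm (y i - y j)))).
        by rewrite /Phi phi_phir phir_antitone ?enorm_ge0.
      apply: phir_dyadic => //; rewrite enorm_ge0 /=.
      by apply: le_trans (yx i j) _; exact: EL.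
    rewrite exchange_big /=; apply: ler_sum => k _; rewrite /P mulr_sumr.
    by apply: ler_sum => j _; rewrite mulrCA.
  apply/negP; rewrite -ltNge.
  apply: (@lt_le_trans _ _ (\sum_(k < L.+1) gamma / 2 / L.+1%:R)).
    apply: ltr_sum => [|k _]; first by apply/hasP; exists ord0; rewrite ?mem_index_enum.
    by rewrite ltNge; apply/negP; exact: h.
  by rewrite sumr_const card_ord -[leLHS]mulr_natr divfK.
have [k {}hk] := choice hk.
pose rad (i : 'I_N) := 2 ^+ k i * r.
have rad_r i : r <= rad i.
  by rewrite /rad -[leLHS]mul1r ler_pM ?(ltW r0)// exprn_ege1// ler1n.
have rad0 i : 0 < rad i by exact: lt_le_trans (rad_r i).
have [S [S1 S2]] := finite_vitali y (fun i => ltW (rad0 i)).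
(* No projected point lies in two selected balls, so each weight is counted at most once. *)
have PS : \sum_(i in S) P i (k i) <= 1.
  rewrite /P exchange_big /= -[leRHS]p1; apply: ler_sum => j _.
  rewrite -mulr_sumr -[leRHS]mulr1 ler_wpM2l//.
  have [[a [aS aj]]|nex] := pselect (exists a, a \in S /\ enorm (y a - y j) <= rad a).
    rewrite (bigD1 a)//= big1.
      by rewrite addr0 lern1 leq_b1.
    move=> b /andP[bS ba]; case: (leP (enorm (y b - y j)) (rad b)) => // bj.
    have := S1 b a bS aS ba; rewrite ltNge; apply: contraNeq => _.
    apply: le_trans (ler_enormB _ (y j) _) _; apply: lerD => //.
    by rewrite enormBC.
  rewrite big1// => a aS; case: leP => // aj.
  by exfalso; apply: nex; exists a.
have hc (i : 'I_N) : exists c : seq 'rV[R]_n * R,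
   [/\ forall v, v \in V -> enorm (v - y i) <= 3 * rad i ->
        exists2 l, l \in c.1 & enorm (v - l) <= c.2 / 2,
      r <= c.2 <= r `^ theta &
      (size c.1)%:R * c.2 `^ s <= (13 * m%:R) ^+ m * r `^ s / phir m theta s r (rad i)].
  (* The maximizing t becomes the size of the pieces: with R = max(t, rad i), (R / t)^m pieces of
     weight t^s cost exactly r^s / phi(rad i). *)
  have [t /andP[rt ta] ht] := phir_eq m r01 th01 s (ltW (rad0 i)).
  have t0 : 0 < t by exact: lt_le_trans rt.
  have tR : t <= Num.max t (rad i) by rewrite le_max lexx.
  have [|l [lsize lcov]] := subspace_ball_cover (c := y i) m0 dV _ t0 tR.
    by rewrite /y; have [] := orthoprojP V (x i).
  exists (l, t); split => //=.
  - move=> v vV vy; apply: lcov => //; apply: le_trans vy _.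
    by rewrite ler_pM2l// le_max lexx orbT.
  - by rewrite rt.
  apply: (le_trans (ler_wpM2r (powR_ge0 _ _) lsize)).
  rewrite le_eqVlt; apply/orP; left; apply/eqP; rewrite ht /kap.
  rewrite -!mulrA; congr (_ * _).
  have -> : r `^ s = (r / t) `^ s * t `^ s.
    by rewrite -powRM ?divfK ?divr_ge0 ?gt_eqF ?(ltW r0) ?(ltW t0).
  have A0 : (r / t) `^ s != 0 by rewrite gt_eqF// powR_gt0 ?divr_gt0.
  have M0 : Num.max t (rad i) ^+ m != 0 by rewrite gt_eqF// exprn_gt0// lt_max t0.
  have T0 : t ^+ m != 0 by rewrite gt_eqF// exprn_gt0.
  by rewrite !expr_div_n; field; rewrite A0 M0 T0.
have [f hf] := choice hc.
exists (flatten [seq [seq (l, (f i).2) | l <- (f i).1] | i <- enum S]); split.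
- move=> z Ez; have [i iN zi] := hx _ (subset_closure Ez).
  have [j jS [rij dij]] := S2 (Ordinal iN).
  have [hj1 _ _] := hf j.
  have [||l lj zl] := hj1 (orthoproj V z).
  + by have [] := orthoprojP V z.
  (* The net costs r <= rad j and the selection rad i + rad j <= 2 rad j, hence the dilation by
     3. *)
  + apply: le_trans (ler_enormB _ (y i) _) _.
    have h1 : enorm (orthoproj V z - y i) <= r.
      by rewrite /y -linearB; apply: le_trans zi; exact: orthoproj_le.
    have := rad_r j; move: dij rij; rewrite /=; lra.
  exists (l, (f j).2) => //; apply/flattenP.
  exists [seq (l, (f j).2) | l <- (f j).1]; first by apply/mapP; exists j => //; rewrite mem_enum.
  by apply/mapP; exists l.
- move=> c /flattenP[_ /mapP[j _ ->]] /mapP[l _ ->] /=.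
  by have [] := hf j.
rewrite big_flatten /= big_map.
apply: (@le_trans _ _ (\sum_(j <- enum S) (13 * m%:R) ^+ m * r `^ s * (2 ^+ m.+1 * L.+1%:R * C * P j (k j)))).
  apply: ler_sum => j _; rewrite big_map /= big_const_seq count_predT iter_addr_0 -[leLHS]mulr_natl.
  have [_ _ h] := hf j; apply: (le_trans h); rewrite ler_pM2l; last first.
    by rewrite mulr_gt0 ?powR_gt0// exprn_gt0// mulr_gt0// ltr0n.
  (* Solved for 1 / phi(rad j), the pigeonhole bound replaces the cost of a ball by its mass. In
     2^(m+1) one factor 2 comes from gamma / 2, the others from the dyadic rounding. *)
  have := hk j; rewrite -/(rad j) /gamma => h2.
  have fj : 0 < phir m theta s r (rad j) by exact: fk.
  rewrite -[leLHS]div1r ler_pdivrMr//.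
  have L0 : 0 < L.+1%:R :> R by rewrite ltr0n.
  move: h2; rewrite ler_pdivrMr// ler_pdivrMr// -[leLHS]div1r ler_pdivrMr// => h2.
  apply: (le_trans h2); rewrite le_eqVlt; apply/orP; left; apply/eqP.
  by rewrite exprS; ring.
rewrite -mulr_sumr -mulr_sumr big_enum /=.
have -> : (13 * m%:R) ^+ m * 2 ^+ m.+1 * L.+1%:R * r `^ s * C =
  (13 * m%:R) ^+ m * r `^ s * (2 ^+ m.+1 * L.+1%:R * C * 1) by ring.
rewrite !ler_wpM2l// !mulr_ge0 ?powR_ge0 ?exprn_ge0 ?mulr_ge0//; exact: ltW.
Qed.

End ProjectionCover.

(** * The upper bound for every subspace *)

Section Upper.
Context {R : realType}.
Implicit Types (theta s r eps eta : R) (m L : nat).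

(** About log(D / r) doublings lead from r to D, and -ln r <= r^(-eta) / eta; [K] does not depend on
    r. *)
Lemma dyadic_scales (D eta : R) : 0 < D -> 0 < eta ->
  exists2 K, 0 < K & forall r, 0 < r < 1 ->
  exists2 L, D <= 2 ^+ L * r & L.+1%:R <= K * r `^ (- eta).
Proof.
move=> D0 eta0; pose M := Num.max 1 D.
have M1 : 1 <= M by rewrite le_max lexx.
have M0 : 0 < M by exact: lt_le_trans M1.
have l2 : 0 < ln 2 :> R by rewrite ln_gt0// ltr1n.
have lM : 0 <= ln M by rewrite ln_ge0.
exists ((ln M + eta^-1) / ln 2 + 2).
  by rewrite ltr_wpDl// divr_ge0 ?(ltW l2)// addr_ge0 ?invr_ge0 ?(ltW eta0).
move=> r r01; have r0 : 0 < r by case/andP: r01.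
have Mr0 : 0 < M / r by rewrite divr_gt0.
pose L := (Num.truncn (ln (M / r) / ln 2)).+1.
have lr : 0 < - ln r by rewrite oppr_gt0 ln_lt0.
have lMr : ln (M / r) = ln M - ln r by rewrite ln_div.
have x0 : 0 <= ln (M / r) / ln 2.
  by rewrite divr_ge0 ?(ltW l2)// lMr addr_ge0 ?(ltW lr).
have /andP[tl tu] := truncn_itv x0.
exists L.
  rewrite -ler_pdivrMr//; apply: (@le_trans _ _ (M / r)).
    by rewrite ler_pM2r ?invr_gt0// le_max lexx orbT.
  rewrite -ler_ln ?posrE ?exprn_gt0// lnXn// -[leRHS]mulr_natl -ler_pdivrMr//.
  exact: ltW.
have re1 : 1 <= r `^ (- eta).
  rewrite -[leLHS](powRr0 r) ger_powR ?oppr_le0 ?(ltW eta0)//.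
  by case/andP: r01 => -> /ltW ->.
have lnr : - ln r <= eta^-1 * r `^ (- eta).
  rewrite ler_pdivlMl//.
  have := ln_sublinear (powR_gt0 (- eta) r0); rewrite ln_powR mulNr -mulrN; exact: ltW.
have h : ln (M / r) <= (ln M + eta^-1) * r `^ (- eta).
  by rewrite lMr mulrDl lerD// -[leLHS]mulr1 ler_pM.
apply: (@le_trans _ _ (ln (M / r) / ln 2 + 2)).
  by rewrite -natr1 /L -natr1 -addrA lerD.
rewrite mulrDl; apply: lerD; last by rewrite -[leLHS]mulr1 ler_pM2l.
by rewrite mulrAC; apply: ler_wpM2r h; rewrite invr_ge0 ltW.
Qed.

Lemma near0E (Q : R -> Prop) : (\forall r \near (0 : R)^'+, Q r) ->
  exists2 e, 0 < e & forall r, 0 < r < e -> Q r.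
Proof.
move=> [e /= e0 he]; exists e => // r /andP[r0 re]; apply: he => //=.
by rewrite sub0r normrN gtr0_norm.
Qed.

Context {n : nat}.
Implicit Types (E F : set 'rV[R]_n).

(** The covering sets are full balls of the ambient space, whose diameters are exactly the
    prescribed numbers whatever subspace contains [F]. *)
Lemma admissible_seq theta r s eps F (Lc : seq ('rV[R]_n * R)) : (0 < n)%N -> 0 < r ->
  (forall x, F x -> exists2 c, c \in Lc & enorm (x - c.1) <= c.2 / 2) ->
  (forall c, c \in Lc -> r `^ theta^-1 <= c.2 <= r) ->
  \sum_(c <- Lc) c.2 `^ s <= eps -> admissible_cover theta r s eps F.
Proof.
move=> n0 r0 cov rad sm.
pose c i := nth (0, 0) Lc i.
have dU i : (i < size Lc)%N -> diam (eball (c i).1 ((c i).2 / 2)) = ((c i).2)%:E.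
  move=> iL; have /andP[h _] := rad _ (mem_nth (0, 0) iL).
  have c0 : 0 <= (c i).2 by apply: le_trans h; exact: powR_ge0.
  by rewrite diam_eball ?divr_ge0// mulrC divfK.
exists `I_(size Lc), (fun i => eball (c i).1 ((c i).2 / 2)); split.
- move=> x /cov[d dL xd]; exists (index d Lc); first by rewrite /= index_mem.
  by rewrite /c nth_index.
- by move=> i iL; rewrite dU// !lee_fin rad// mem_nth.
rewrite esum_fset//; last by move=> i _; exact: poweR_ge0.
rewrite -fsbig_ord /=.
rewrite (eq_bigr (fun i : 'I_(size Lc) => ((c i).2 `^ s)%:E)); last first.
  by move=> i _; rewrite dU// poweR_EFin.
rewrite sumEFin lee_fin; apply: le_trans sm.
by rewrite (big_nth (0, 0)) big_mkord.
Qed.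

Section Main.
Variables (m : nat) (V : {vspace 'rV[R]_n}) (E : set 'rV[R]_n).
Hypotheses (n0 : (0 < n)%N) (m0 : (0 < m)%N) (dV : \dim V = m)
  (E0 : E !=set0) (bE : bounded_set E).
Variable theta : R.
Hypothesis th01 : 0 < theta <= 1.
Let th0 : 0 < theta. Proof. by case/andP: th01. Qed.

(* With [eta = theta * delta / 4], the covers of the projection have total
   [P]-weight at most [r ^ (- 2 eta)] up to a constant; the extra factor
   [(r ^ theta) ^ delta = r ^ (4 eta)] absorbs it. *)
Lemma projection_admissible (P delta eps : R) : 0 <= P <= m%:R -> 0 < delta ->
  0 < eps -> exists2 e, 0 < e <= 1 & forall r, 0 < r < e ->
    (log_capacity m theta P E r < (P + theta * delta / 4)%:E)%E ->
    admissible_cover theta (r `^ theta) (P + delta) eps (orthoproj V @` E).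
Proof.
move=> Pm d0 eps0; have [D D0 hD] := bounded_closure_enorm bE.
pose eta := theta * delta / 4.
have eta0 : 0 < eta by rewrite divr_gt0// mulr_gt0.
have [K K0 hK] := dyadic_scales D0 eta0.
pose K1 := (13 * m%:R) ^+ m * 2 ^+ m.+1 * K.
have K10 : 0 < K1 by rewrite !mulr_gt0 ?exprn_gt0// mulr_gt0// ltr0n.
(* The solution of K1 * e0^(2 eta) = eps. *)
pose e0 := (eps / K1) `^ (2 * eta)^-1.
have e00 : 0 < e0 by rewrite powR_gt0// divr_gt0.
exists (Num.min 1 e0); first by rewrite lt_min ltr01 e00 ge_min lexx.
move=> r /andP[r0]; rewrite lt_min => /andP[r1 re] hlog.
have r01 : 0 < r <= 1 by rewrite r0 ltW.
have r01' : 0 < r < 1 by rewrite r0.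
have [L DL LK] := hK _ r01'.
have EL x y : E x -> E y -> enorm (x - y) <= 2 ^+ L * r.
  by move=> Ex Ey; apply: le_trans DL; apply: hD; exact: subset_closure.
have [Lc [cov rad sm]] := projection_cover n0 m0 dV E0 bE th01 Pm r01 EL.
have C1 := capacity_ge1 E0 hD r01 th01 Pm.
have lr : 0 < - ln r by rewrite oppr_gt0 ln_lt0.
have hC : capacity m theta P r E <= r `^ (- (P + eta)).
  move: hlog; rewrite /log_capacity lte_fin ltr_pdivrMr// => /ltW.
  have -> : (P + theta * delta / 4) * - ln r = ln (r `^ (- (P + eta))).
    by rewrite ln_powR mulrN mulNr.
  by rewrite ler_ln ?posrE ?powR_gt0// (lt_le_trans ltr01).
apply: (@admissible_seq _ _ _ _ _ Lc) => //.
- exact: powR_gt0.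
- by move=> _ [x Ex <-]; exact: cov.
- by move=> c /rad; rewrite -powRrM divff ?gt_eqF// powRr1 ?(ltW r0).
have th4 : theta * delta = 4 * eta by rewrite /eta; field.
apply: (@le_trans _ _ (\sum_(c <- Lc) c.2 `^ P * r `^ (4 * eta))).
  rewrite big_seq [leRHS]big_seq; apply: ler_sum => c /rad /andP[rc cr].
  have c0 : 0 < c.2 by exact: lt_le_trans rc.
  rewrite powRD ?(gt_eqF c0) ?implybT// ler_wpM2l ?powR_ge0//.
  by rewrite -th4 powRrM powR_le ?(ltW d0).
rewrite -mulr_suml; apply: (le_trans (ler_wpM2r (powR_ge0 _ _) sm)).
have K00 : 0 <= (13 * m%:R) ^+ m * 2 ^+ m.+1 :> R by rewrite mulr_ge0 ?exprn_ge0 ?mulr_ge0.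
apply: (@le_trans _ _ ((13 * m%:R) ^+ m * 2 ^+ m.+1 * (K * r `^ (- eta)) *
   r `^ P * r `^ (- (P + eta)) * r `^ (4 * eta))).
  rewrite ler_wpM2r ?powR_ge0//; apply: ler_pM => //.
  - by rewrite !mulr_ge0 ?powR_ge0 ?ler0n.
  - by rewrite (le_trans ler01).
  - by rewrite ler_wpM2r ?powR_ge0// ler_wpM2l.
have -> : (13 * m%:R) ^+ m * 2 ^+ m.+1 * (K * r `^ (- eta)) *
   r `^ P * r `^ (- (P + eta)) * r `^ (4 * eta) = K1 * r `^ (2 * eta).
  have -> : r `^ (2 * eta) = r `^ (- eta) * r `^ P * r `^ (- (P + eta)) * r `^ (4 * eta).
    by rewrite -!powRD ?(gt_eqF r0) ?implybT//; congr (_ `^ _); ring.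
  by rewrite /K1; ring.
rewrite mulrC -ler_pdivlMr//.
have -> : eps / K1 = e0 `^ (2 * eta).
  rewrite /e0 -powRrM mulVf ?powRr1 ?divr_ge0 ?(ltW eps0) ?(ltW K10)//.
  by rewrite gt_eqF// mulr_gt0.
by rewrite powR_le ?mulr_ge0 ?(ltW eta0)// ltW.
Qed.

Lemma lower_idim_projection_le :
  (lower_idim theta (orthoproj V @` E) <= (lower_profile m theta E)%:E)%E.
Proof.
have [P01 PL] := lower_profileP m E0 bE th01.
set P := lower_profile m theta E in P01 PL *.
apply/lee_addgt0Pr => delta d0; rewrite -EFinD; apply: ereal_inf_lbound.
exists (P + delta) => //=; split; first by rewrite addr_ge0 ?(ltW d0)//; case/andP: P01.
move=> eps r0 eps0 r00.
have [e /andP[e0 e1] he] := projection_admissible P01 d0 eps0.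
have e'0 : 0 < Num.min e (r0 `^ theta^-1) by rewrite lt_min e0 powR_gt0.
have lt4 : (limf_einf (log_capacity m theta P E) 0^'+ < (P + theta * delta / 4)%:E)%E.
  by rewrite PL lte_fin ltrDl divr_gt0// mulr_gt0.
have [r /andP[rp]] := limf_einf_freq lt4 (near0_lt e'0).
rewrite lt_min => /andP[re rr] hr.
exists (r `^ theta); last by apply: he; rewrite ?rp.
rewrite powR_gt0//=; apply: (@le_trans _ _ ((r0 `^ theta^-1) `^ theta)).
  by rewrite powR_le ?(ltW th0)// ltW.
by rewrite -powRrM mulVf ?gt_eqF// powRr1 ?(ltW r00).
Qed.

Lemma upper_idim_projection_le :
  (upper_idim theta (orthoproj V @` E) <= (upper_profile m theta E)%:E)%E.
Proof.
have [P01 PL] := upper_profileP m E0 bE th01.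
set P := upper_profile m theta E in P01 PL *.
apply/lee_addgt0Pr => delta d0; rewrite -EFinD; apply: ereal_inf_lbound.
exists (P + delta) => //=; split; first by rewrite addr_ge0 ?(ltW d0)//; case/andP: P01.
move=> eps eps0.
have [e /andP[e0 e1] he] := projection_admissible P01 d0 eps0.
have lt4 : (limf_esup (log_capacity m theta P E) 0^'+ < (P + theta * delta / 4)%:E)%E.
  by rewrite PL lte_fin ltrDl divr_gt0// mulr_gt0.
have [e' e'0 he'] := near0E (limf_esup_near lt4).
(* Halved because the definition asks for all r <= r0, while both bounds hold strictly below e and
   e'. *)
have e20 : 0 < Num.min e e' / 2 by rewrite divr_gt0// lt_min e0.
exists ((Num.min e e' / 2) `^ theta); first exact: powR_gt0.
move=> r' /andP[r'0 r'e].
have rE : r' = (r' `^ theta^-1) `^ theta.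
  by rewrite -powRrM mulVf ?gt_eqF// powRr1 ?(ltW r'0).
have re : r' `^ theta^-1 < Num.min e e'.
  apply: (@le_lt_trans _ _ (Num.min e e' / 2)); last first.
    by rewrite ltr_pdivrMr// ltr_pMr ?ltr1n// lt_min e0.
  have -> : Num.min e e' / 2 = ((Num.min e e' / 2) `^ theta) `^ theta^-1.
    by rewrite -powRrM divff ?gt_eqF// powRr1 ?(ltW e20).
  by rewrite powR_le ?invr_ge0 ?(ltW th0).
have rp : 0 < r' `^ theta^-1 by exact: powR_gt0.
move: re; rewrite lt_min => /andP[re re'].
by rewrite rE; apply: he; rewrite ?rp//; apply: he'; rewrite rp.
Qed.

End Main.
End Upper.

(** * Measures of slabs in the Grassmannian *)

Section Rotations.
Context {R : realType} {n : nat}.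
Implicit Types (a b x y u v : 'rV[R]_n) (Q : 'M[R]_n).

Lemma dot_mx u v : u *m v^T = (dot u v)%:M.
Proof.
apply/matrixP => i j; rewrite !ord1 !mxE mulr1n.
by apply: eq_bigr => k _; rewrite mxE.
Qed.

Lemma dot_isometry Q u v : Q *m Q^T = 1%:M -> dot (u *m Q) (v *m Q) = dot u v.
Proof.
move=> QQ; have := dot_mx (u *m Q) (v *m Q).
rewrite trmx_mul mulmxA -(mulmxA u) QQ mulmx1 dot_mx => /matrixP/(_ 0 0).
by rewrite !mxE /= !mulr1n.
Qed.

Lemma enorm_isometry Q u : Q *m Q^T = 1%:M -> enorm (u *m Q) = enorm u.
Proof. by move=> QQ; rewrite /enorm dot_isometry. Qed.

Definition reflection a : 'M[R]_n := 1%:M - (2 / dot a a) *: (a^T *m a).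

Lemma mul_reflection a v : v *m reflection a = v - (2 / dot a a * dot v a) *: a.
Proof.
rewrite /reflection mulmxBr mulmx1 -scalemxAr mulmxA dot_mx mul_scalar_mx.
by rewrite scalerA.
Qed.

Lemma tr_reflection a : (reflection a)^T = reflection a.
Proof. by rewrite /reflection linearB linearZ /= trmx1 trmx_mul trmxK. Qed.

Lemma reflectionK a : a != 0 -> reflection a *m reflection a = 1%:M.
Proof.
move=> a0; apply/row_matrixP => i; rewrite !rowE mulmxA mulmx1 !mul_reflection.
rewrite dotBl dotZl.
have d0 : dot a a != 0 by apply: contraNneq a0 => /dot_eq0 ->.
move: (delta_mx 0 i) => e; apply/rowP => j; rewrite !mxE.
by field.
Qed.

Lemma reflection_swap x y : x != y -> enorm x = enorm y -> x *m reflection (x - y) = y.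
Proof.
move=> xy nxy; rewrite mul_reflection.
have dxy : dot x x = dot y y by rewrite -!enorm_sqr nxy.
have d0 : dot (x - y) (x - y) != 0.
  by apply: contraNneq xy => /dot_eq0/eqP; rewrite subr_eq0.
have -> : 2 / dot (x - y) (x - y) * dot x (x - y) = 1.
  rewrite mulrAC -[RHS](divff d0); congr (_ / _).
  by rewrite !dotBl !dotBr (dotC y x) -dxy; ring.
by rewrite scale1r opprB addrC subrK.
Qed.

(* Reflections in vectors of equal length are conjugate. *)
Lemma det_reflection a b : a != 0 -> enorm a = enorm b ->
  \det (reflection a) = \det (reflection b).
Proof.
move=> a0 ab; have [->//|nab] := eqVneq a b.
have [P [PP Pt aP]] : exists P, [/\ P *m P = 1%:M, P^T = P & a *m P = b].
  exists (reflection (a - b)); split; last exact: reflection_swap.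
    by apply: reflectionK; rewrite subr_eq0.
  exact: tr_reflection.
have dab : dot a a = dot b b by rewrite -!enorm_sqr ab.
have -> : reflection b = P *m reflection a *m P.
  rewrite /reflection mulmxBr mulmx1 mulmxBl PP -dab; congr (_ - _).
  rewrite -scalemxAr -scalemxAl; congr (_ *: _).
  by rewrite -aP trmx_mul Pt !mulmxA.
have : \det P * \det P = 1 by rewrite -det_mulmx PP det1.
by rewrite !det_mulmx mulrAC => ->; rewrite mul1r.
Qed.

(** The reflection in a = x - y sends x to y. A second reflection, in a vector b orthogonal to y
    with |b| = |a|, fixes y and has the same determinant, so the product has determinant 1 without
    that determinant being computed. Such a b exists since n > 1. *)
Lemma rotation_transitive x y : (1 < n)%N -> enorm x = enorm y ->
  exists Q : 'M[R]_n, [/\ Q *m Q^T = 1%:M, \det Q = 1 & x *m Q = y].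
Proof.
move=> n1 nxy; have [->|xy] := eqVneq x y.
  by exists 1%:M; rewrite trmx1 !mulmx1 det1.
pose a := x - y; have a0 : a != 0 by rewrite subr_eq0.
have [b0 b00 yb0] : exists2 b0, b0 != 0 & dot y b0 = 0.
  exists (vpick (fullv :&: orthov dot <[y]>)%VS).
    rewrite vpick0 -dimv_eq0 -lt0n; apply: leq_trans (leq_dim_orthov1 _ _ _).
    by rewrite dimvf /dim /= mul1n -ltnS prednK// ltnW.
  have := memv_pick (fullv :&: orthov dot <[y]>)%VS.
  rewrite memv_cap mem_orthov1 => /andP[_ /eqP h]; rewrite dotC; exact: h.
pose b := (enorm a / enorm b0) *: b0.
have nb : enorm a = enorm b.
  rewrite enormZ ger0_norm ?divr_ge0 ?enorm_ge0// divfK//.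
  by rewrite enorm_eq0.
have b_n0 : b != 0 by rewrite -enorm_eq0 -nb enorm_eq0.
exists (reflection a *m reflection b); split.
- by rewrite trmx_mul !tr_reflection -!mulmxA (mulmxA (reflection b)) reflectionK// mul1mx reflectionK.
- by rewrite det_mulmx (det_reflection a0 nb) -det_mulmx reflectionK// det1.
- rewrite mulmxA (reflection_swap xy nxy) mul_reflection.
  have -> : dot y b = 0 by rewrite /b dotZr yb0 mulr0.
  by rewrite mulr0 scale0r subr0.
Qed.

End Rotations.

Section GrassmannianMeasure.
Context {R : realType} {n m : nat}.
Variable (le_mn : (m <= n)%N).
Local Notation G := (Gr R le_mn).
Implicit Types (V : G) (x y : 'rV[R]_n) (Q : 'M[R]_n).

Lemma orthoproj_rotate Q V x : Q *m Q^T = 1%:M ->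
  orthoproj (val (rotate Q V)) (x *m Q) = orthoproj (val V) x *m Q.
Proof.
move=> QQ; have uQ : Q \in unitmx by case/mulmx1_unit: QQ.
apply: orthoproj_uniq; rewrite val_rotate//.
  have [pV _] := orthoprojP (val V) x.
  by apply/memv_imgP; exists (orthoproj (val V) x) => //; rewrite lfunE.
move=> _ /memv_imgP[v vV ->]; rewrite lfunE /= -mulmxBl dot_isometry//.
by have [_] := orthoprojP (val V) x; apply.
Qed.

(** The coordinate is linear in the entries of the projection matrix, which are continuous in V
    because they define the topology. *)
Lemma orthoproj_coord_measurable x (i : 'I_n) :
  measurable_fun setT (fun V : borel G => orthoproj (val (V : G)) x 0 i : R).
Proof.
rewrite (_ : (fun V => _) = fun V : borel G =>
    \sum_(k <- index_enum 'I_n) x 0 k * Gr_mx (V : G) k i); last first.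
  apply/funext => V; rewrite -[in LHS](mul_rV_lin1 (orthoproj (val (V : G)))) mxE.
  by [].
apply: measurable_sum => k; apply: measurable_funM; first exact: measurable_cst.
apply: (@borel_continuous_measurable R G (fun V => Gr_mx V k i)).
move=> V; apply: (@continuous_comp _ _ _ (@Gr_mx R n m le_mn) (fun M : 'M[R]_n => M k i)).
  exact: initial_continuous.
exact: coord_continuous.
Qed.

Lemma enorm_orthoproj_measurable x :
  measurable_fun setT (fun V : borel G => enorm (orthoproj (val (V : G)) x)).
Proof. by apply: enorm_measurable => i; exact: orthoproj_coord_measurable. Qed.

Definition slab x (rho : R) : set (borel G) :=
  [set V : G | enorm (orthoproj (val V) x) <= rho].

Lemma slab_measurable x rho : measurable (slab x rho).
Proof.
have mx := enorm_orthoproj_measurable x.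
have := mx measurableT _ (measurable_itv `]-oo, rho]).
by rewrite setTI.
Qed.

Variable gamma : probability (borel G) R.
Hypothesis inv : rotation_invariant le_mn gamma.

Lemma slab_rotate x y rho : (1 < n)%N -> enorm x = enorm y ->
  gamma (slab x rho) = gamma (slab y rho).
Proof.
move=> n1 nxy; have [Q [QQ dQ xQ]] := rotation_transitive n1 nxy.
have pE V : enorm (orthoproj (val (rotate Q V)) y) = enorm (orthoproj (val V) x).
  by rewrite -xQ (orthoproj_rotate V x QQ) (enorm_isometry _ QQ).
rewrite -(inv QQ dQ (slab_measurable y rho)).
have -> : (rotate Q : G -> G) @^-1` slab y rho = slab x rho.
  by apply/predeqP => V; rewrite /slab /preimage /mkset pE.
by [].
Qed.

End GrassmannianMeasure.
Arguments slab {R n m} le_mn x rho.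
Arguments slab_measurable {R n m} le_mn x rho.

(** * Counting lattice points near the orthogonal complement *)

Lemma leq_exp2r_le a b k : (a <= b)%N -> (a ^ k <= b ^ k)%N.
Proof. by move=> ab; case: k => // k; rewrite leq_exp2r. Qed.

Lemma eq_mod_close (R : realDomainType) (a b B : nat) : a = b %[mod B.+1] ->
  `|a%:R - b%:R : R| <= B%:R -> a = b.
Proof.
wlog ab : a b / (a <= b)%N.
  move=> H; have [|/ltnW ba] := leqP a b; first exact: H.
  by move=> h1 h2; apply/esym; apply: H => //; rewrite distrC.
move/eqP; rewrite eq_sym eqn_mod_dvd// => dv; rewrite distrC -natrB// normr_nat ler_nat => le.
have [|h] := posnP (b - a)%N; last first.
  by have := dvdn_leq h dv; rewrite leqNgt ltnS le.
by move/eqP; rewrite subn_eq0 => ba; apply/eqP; rewrite eqn_leq ab.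
Qed.

Section LatticeCount.
Context {R : realType} {n m : nat}.

Definition lattice_point N (z : {ffun 'I_n -> 'I_N}) : 'rV[R]_n := \row_i (z i)%:R.

(* Points of [V^perp] are located up to bounded error by the integer parts of
   their coordinates in an orthonormal basis; the residue modulo [3n + 1] then
   separates the boundedly many lattice points left. *)
Lemma lattice_slab_card N (V : {vspace 'rV[R]_n}) : (m <= n)%N -> \dim V = m ->
  (#|[set z : {ffun 'I_n -> 'I_N} |
      (enorm (orthoproj V (lattice_point z)) <= n%:R)%R]%SET| <=
    (2 * n * N).+1 ^ (n - m) * (3 * n).+1 ^ n)%N.
Proof.
move=> le_mn dV; set A := finset _.
pose W := orthov dot V.
have dW : \dim W = (n - m)%N.
  have : (\dim V + \dim W)%N = n.
    rewrite -dimv_disjoint_sum ?capv_orthov// addv_orthov dimvf /dim /=.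
    by rewrite mul1n.
  by rewrite dV => h; apply/eqP; rewrite -(eqn_add2l m) h subnKC.
have [e [eW eo es]] := orthonormal_basis dW.
have ne i : enorm (e i) = 1 by rewrite /enorm eo eqxx sqrtr1.
have nz (z : {ffun 'I_n -> 'I_N}) : enorm (lattice_point z) <= n%:R * N%:R.
  apply: enorm_le_coord => // i; rewrite mxE ger0_norm// ler_nat.
  exact: ltnW.
have dz (z : {ffun 'I_n -> 'I_N}) i : `|dot (lattice_point z) (e i)| <= n%:R * N%:R.
  rewrite ler_norml; apply/andP; split.
    rewrite lerNl -dotNl; apply: le_trans (le_dot_enorm _ _) _.
    by rewrite enormN ne mulr1.
  by apply: le_trans (le_dot_enorm _ _) _; rewrite ne mulr1.
pose c (z : {ffun 'I_n -> 'I_N}) i : R := dot (lattice_point z) (e i) + n%:R * N%:R.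
have c0 z i : 0 <= c z i by have := dz z i; rewrite ler_norml /c; lra.
have cN z i : (Num.truncn (c z i) < (2 * n * N).+1)%N.
  rewrite ltnS -(@natrK R (2 * n * N)) le_truncn// !natrM.
  by have := dz z i; rewrite ler_norml /c; lra.
pose f (z : {ffun 'I_n -> 'I_N}) : {ffun 'I_(n - m) -> 'I_(2 * n * N).+1} *
    {ffun 'I_n -> 'I_(3 * n).+1} :=
  ([ffun i => Ordinal (cN z i)],
   [ffun i => Ordinal (ltn_pmod (z i) (ltn0Sn (3 * n)))]).
have finj : {in A &, injective f}.
  move=> z z'; rewrite !inE => zA zA' [/ffunP f1 /ffunP f2].
  pose u := lattice_point z - lattice_point z'.
  have du i : `|dot u (e i)| <= 1.
    have := f1 i; rewrite !ffunE => /(congr1 val) /= h.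
    have /andP[h1 h2] := truncn_itv (c0 z i).
    have /andP[h3 h4] := truncn_itv (c0 z' i).
    rewrite h -[X in _ < X]natr1 in h1 h2; rewrite -[X in _ < X]natr1 in h4.
    rewrite ler_norml dotBl; move: h1 h2 h3 h4; rewrite /c; lra.
  have pu : enorm (orthoproj V u) <= 2 * n%:R.
    rewrite linearB; apply: le_trans (ler_enormD _ _) _.
    by rewrite enormN mulrDl mul1r lerD.
  have [pV hp] := orthoprojP V u.
  have uW : u - orthoproj V u \in W by apply/mem_orthovP => v vV; exact: hp.
  have wu : enorm (u - orthoproj V u) <= n%:R.
    rewrite (es _ uW); apply: le_trans (enorm_sum _ _) _.
    apply: (@le_trans _ _ (\sum_(i < n - m) 1)).
      apply: ler_sum => i _; rewrite enormZ ne mulr1 dotBl.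
      have -> : dot (orthoproj V u) (e i) = 0.
        rewrite dotC; have /mem_orthovP h := eW i; exact: h.
      by rewrite subr0.
    by rewrite sumr_const card_ord ler_nat leq_subr.
  (* The component in V is at most 2 n, as both points project into the ball of radius n; the other
     has n - m coordinates of size at most 1. *)
  have nu : enorm u <= (3 * n)%:R.
    rewrite natrM; apply: le_trans (enorm_orthoprojD V u) _; lra.
  apply/ffunP => i; apply: val_inj => /=.
  have := f2 i; rewrite !ffunE => /(congr1 val) /= hmod.
  have := le_trans (coord_le_enorm u i) nu; rewrite !mxE => hi.
  exact: eq_mod_close hmod hi.
rewrite -(card_in_imset finj); apply: leq_trans (max_card _) _.
by rewrite card_prod !card_ffun !card_ord.
Qed.

End LatticeCount.

(** Integrate the number of sets containing a point, which never exceeds [M]. *)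
Lemma sum_measure_le d (T : measurableType d) (R : realType) (mu : probability T R)
    (I : finType) (A : I -> set T) (P : pred I) (M : nat) :
  (forall i, measurable (A i)) ->
  (forall x, (#|[set i | P i && `[< A i x >]]%SET| <= M)%N) ->
  (\sum_(i | P i) mu (A i) <= M%:R%:E)%E.
Proof.
move=> mA h.
have -> : (\sum_(i | P i) mu (A i) = \int[mu]_x (\sum_(i <- enum P) (\1_(A i) x)%:E))%E.
  rewrite ge0_integral_sum//.
  - by rewrite big_enum /=; apply: eq_bigr => i _; rewrite integral_indic// setIT.
  - by move=> i; apply/measurable_EFinP; exact: measurable_indic.
have -> : (M%:R%:E = \int[mu]_x (cst M%:R%:E) x)%E.
  rewrite integral_cst// -[LHS]mule1; congr (_ * _)%E.
  by apply/esym; exact: probability_setT.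
apply: ge0_le_integral => //.
- by move=> x _; apply: sume_ge0 => i _; rewrite lee_fin.
- by apply: emeasurable_sum => i; apply/measurable_EFinP; exact: measurable_indic.
move=> x _; rewrite sumEFin lee_fin /= big_enum /=.
apply: le_trans (_ : (\sum_(i | P i && `[< A i x >]) 1 <= _)); last first.
  by rewrite sumr_const ler_nat -cardsE; exact: h.
rewrite big_mkcondr /=; apply: ler_sum => i _; rewrite indicE.
case: ifPn => [|/asboolPn nA]; first by rewrite lern1 leq_b1.
by rewrite memNset.
Qed.

Section SmallBall.
Context {R : realType} {n m : nat}.
Variable (le_mn : (m <= n)%N).
Hypothesis m0 : (0 < m)%N.
Local Notation G := (Gr R le_mn).
Variable gamma : probability (borel G) R.
Hypothesis inv : rotation_invariant le_mn gamma.

Let n0 : (0 < n)%N. Proof. exact: leq_trans le_mn. Qed.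

Lemma slab_scale (x : 'rV[R]_n) (rho c : R) : 0 < c ->
  slab le_mn (c *: x) (c * rho) = slab le_mn x rho.
Proof.
move=> c0; apply/seteqP; split => V; rewrite /slab/= linearZ/= enormZ gtr0_norm//.
  by rewrite ler_pM2l.
by rewrite ler_pM2l.
Qed.

Let K0 : R := ((3 * n) ^ n * (3 * n).+1 ^ n)%:R.

(** With t = rho / |x|, scaling and rotation give {V : |pi_V z| <= t |z|} the same measure p for
    every lattice point z other than 0. In the box t |z| <= n, so each V belongs to at most [K0]
    N^(n-m) of these sets, while at least N^n / 2 points z are nonzero. Hence p N^n <= 2 [K0]
    N^(n-m). *)
Lemma slab_le_lattice (x : 'rV[R]_n) (rho : R) (N : nat) : (1 < n)%N -> (1 < N)%N ->
  0 < rho -> rho * N%:R <= enorm x ->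
  fine (gamma (slab le_mn x rho)) * N%:R ^+ m <= 2 * K0.
Proof.
move=> n1 N1 rho0 hN; set p := fine _.
have N0 : (0 < N)%N by exact: ltnW.
have x0 : 0 < enorm x by apply: lt_le_trans hN; rewrite mulr_gt0// ltr0n.
have mS := @slab_measurable R n m le_mn.
have gE : gamma (slab le_mn x rho) = p%:E by rewrite /p fineK// fin_num_measure.
have p0 : 0 <= p by exact: fine_ge0.
pose t := rho / enorm x.
have t0 : 0 < t by rewrite divr_gt0.
have tN : t * N%:R <= 1 by rewrite mulrAC ler_pdivrMr// mul1r.
pose lat := @lattice_point R n N.
pose P : pred {ffun 'I_n -> 'I_N} := fun z => lat z != 0.
have slabE z : P z -> gamma (slab le_mn (lat z) (t * enorm (lat z))) = p%:E.
  move=> z0; have lz0 : 0 < enorm (lat z) by rewrite enorm_gt0.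
  rewrite -gE -(@slab_scale _ _ (enorm x / enorm (lat z))) ?divr_gt0//.
  have -> : enorm x / enorm (lat z) * (t * enorm (lat z)) = rho.
    by rewrite /t; field; rewrite !gt_eqF.
  apply: slab_rotate => //.
  by rewrite enormZ gtr0_norm ?divr_gt0// divfK// gt_eqF.
have := @sum_measure_le _ (borel G) R gamma _
  (fun z => slab le_mn (lat z) (t * enorm (lat z))) P
  ((2 * n * N).+1 ^ (n - m) * (3 * n).+1 ^ n) (fun z => mS _ _) _.
have H (V : borel G) : (#|[set z | P z && `[< slab le_mn (lat z) (t * enorm (lat z)) V >]]%SET| <=
    (2 * n * N).+1 ^ (n - m) * (3 * n).+1 ^ n)%N.
  have dV : \dim (val (V : G)) = m by apply/eqP; exact: (valP (V : G)).
  apply: leq_trans (lattice_slab_card N le_mn dV).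
  apply: subset_leq_card; apply/fintype.subsetP => z; rewrite !inE => /andP[_ /asboolP h].
  apply: (le_trans h); apply: (@le_trans _ _ (t * (n%:R * N%:R))).
    rewrite ler_pM2l//; apply: enorm_le_coord => // i; rewrite mxE ger0_norm// ler_nat.
    exact: ltnW.
  by rewrite mulrCA -[leRHS]mulr1 ler_wpM2l.
move=> /(_ H); rewrite (eq_bigr _ slabE) sumEFin lee_fin sumr_const => h.
(* Only the origin is excluded, as it has no direction to rotate. *)
have cP : (N ^ n <= (#|P|).+1)%N.
  have -> : (N ^ n)%N = #|{ffun 'I_n -> 'I_N}| by rewrite card_ffun !card_ord.
  rewrite -(cardC P) -[leqRHS]addn1 leq_add2l.
  apply/card_le1_eqP => z z'; rewrite !inE /P /= !negbK => /eqP/rowP z0 /eqP/rowP z'0.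
  apply/ffunP => i; apply: val_inj; apply/eqP; rewrite -(eqr_nat R) /=.
  by have := z0 i; have := z'0 i; rewrite !mxE => -> ->.
have cP2 : (N ^ n <= 2 * #|P|)%N.
  have : (2 <= N ^ n)%N by rewrite -(exp1n n) ltn_exp2r.
  move: cP; lia.
have M1 : (((2 * n * N).+1 ^ (n - m) * (3 * n).+1 ^ n) * N ^ m <=
    ((3 * n) ^ n * (3 * n).+1 ^ n) * N ^ n)%N.
  rewrite mulnAC [leqRHS]mulnAC leq_mul2r; apply/orP; right.
  apply: (@leq_trans ((3 * n * N) ^ (n - m) * N ^ m)).
    rewrite leq_mul2r; apply/orP; right; apply: leq_exp2r_le; nia.
  rewrite expnMn -mulnA -expnD subnK// leq_mul2r; apply/orP; right.
  by apply: leq_pexp2l; rewrite ?leq_subr// muln_gt0 n0.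
have Nn : 0 < (N ^ n)%:R :> R by rewrite ltr0n expn_gt0 N0.
have Nm : 0 <= N%:R ^+ m :> R by rewrite exprn_ge0.
rewrite -(ler_pM2r Nn).
apply: (@le_trans _ _ (2 * (p *+ #|P|) * N%:R ^+ m)).
  by rewrite mulrAC ler_wpM2r// -[p *+ _]mulr_natr mulrCA ler_wpM2l// -natrM ler_nat.
apply: (@le_trans _ _ (2 * (((2 * n * N).+1 ^ (n - m) * (3 * n).+1 ^ n)%:R) * N%:R ^+ m)).
  by rewrite ler_wpM2r// ler_wpM2l.
by rewrite -mulrA -[leRHS]mulrA ler_wpM2l// /K0 -natrX -!natrM ler_nat.
Qed.

Lemma slab_small : exists2 K : R, 0 < K & forall (x : 'rV[R]_n) (rho : R), 0 < rho ->
  fine (gamma (slab le_mn x rho)) <= K * kap m rho (enorm x).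
Proof.
have K00 : 1 <= K0 by rewrite /K0 ler1n muln_gt0 !expn_gt0 muln_gt0 n0.
have K01 : 0 <= K0 by exact: le_trans K00.
exists (2 * K0 * 2 ^+ m).
  by rewrite !mulr_gt0 ?exprn_gt0// (lt_le_trans ltr01).
move=> x rho rho0; have mS := slab_measurable le_mn x rho.
have p1 : fine (gamma (slab le_mn x rho)) <= 1.
  by rewrite -lee_fin fineK ?fin_num_measure// probability_le1.
have [h|h] := leP (enorm x) (2 * rho).
  apply: (le_trans p1).
  have : kap m (2 * rho) (enorm x) <= 2 ^+ m * kap m rho (enorm x).
    rewrite -[X in X ^+ m](@mulfK _ rho) ?gt_eqF//.
    apply: kap_scale => //; lra.
  rewrite kap_near ?mulr_gt0// => h1; apply: (le_trans h1).
  rewrite -mulrA -[leLHS]mul1r ler_wpM2r//; lra.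
have x0 : 0 < enorm x by lra.
(* On the line rotations do not exchange x and -x. There V is the whole space, and the slab is empty
   because |x| > 2 rho. *)
have [n1|n1] := ltnP 1 n; last first.
  have nm : m = n by apply/eqP; rewrite eqn_leq le_mn (leq_trans n1).
  have -> : slab le_mn x rho = set0.
    apply/seteqP; split => V //; rewrite /slab/= orthoproj_id; first by lra.
    have dV : \dim (val (V : G)) = m by apply/eqP; exact: (valP (V : G)).
    suff -> : val (V : G) = fullv by rewrite memvf.
    by apply/eqP; rewrite eqEdim subvf dV dimvf /dim /= mul1n nm.
  rewrite measure0; apply: mulr_ge0; last exact: ltW (kap_gt0 _ _ rho0).
  by rewrite !mulr_ge0 ?exprn_ge0.
(* The largest box allowed by rho N <= |x|. From |x| > 2 rho follows N >= 2, and |x| / rho < N + 1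
   <= 2 N costs the factor 2^m. *)
pose N := Num.truncn (enorm x / rho).
have q0 : 0 <= enorm x / rho by rewrite divr_ge0 ?ltW.
have /andP[N1 N2] := truncn_itv q0.
have Ngt1 : (1 < N)%N.
  have : 2 <= enorm x / rho by rewrite ler_pdivlMr// ltW.
  by move/(le_truncn); rewrite natrK.
have hN : rho * N%:R <= enorm x by rewrite mulrC -ler_pdivlMr.
have := slab_le_lattice n1 Ngt1 rho0 hN.
have Np : 0 < N%:R :> R by rewrite ltr0n ltnW.
rewrite -ler_pdivlMr ?exprn_gt0// => h1; apply: (le_trans h1).
rewrite -mulrA ler_wpM2l ?mulr_ge0// kap_far; last by lra.
rewrite -exprVn -exprMn expr_le ?invr_gt0//.
rewrite -[leLHS]div1r ler_pdivrMr//.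
rewrite mulrAC -ler_pdivrMr ?divr_gt0//.
rewrite div1r invf_div.
have : N.+1%:R <= 2 * N%:R :> R by rewrite -natrM ler_nat mul2n -addnn -addn1 leq_add2l ltnW.
move: N2; rewrite -/N; move=> a b; apply/ltW; exact: lt_le_trans b.
Qed.

End SmallBall.

(** * Truncated energies of projections *)

Section MassDistribution.
Context {R : realType} {n : nat}.
Implicit Types (theta s r : R) (p : nat -> R) (y : nat -> 'rV[R]_n).

(** The cap at r^theta keeps every scale within the range of t in the formula for the kernel. *)
Definition scale theta r (k : nat) : R := Num.min (2 ^+ k * r) (r `^ theta).

(** The energy for the kernel sum_k (r / t_k)^s 1(|z| <= t_k), with t_k the k-th scale: a substitute
    for (r / |z|)^s that vanishes beyond r^theta. Indicators of balls become indicators of slabs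
    when y is a projection. *)
Definition multiscale_energy theta s r (L N : nat) p y : R :=
  \sum_(k < L.+1) \sum_(j < N) \sum_(i < N)
    (r / scale theta r k) `^ s * (p i * p j) *
    (enorm (y i - y j) <= scale theta r k)%R%:R.

Lemma scale_bounds theta r k : 0 < r <= 1 -> 0 < theta <= 1 ->
  r <= scale theta r k <= r `^ theta.
Proof.
move=> r01 th01; have r0 : 0 < r by case/andP: r01.
rewrite /scale le_min le_r_rtheta// ge_min lexx orbT !andbT.
by rewrite -[leLHS]mul1r ler_pM2r// exprn_ege1// ler1n.
Qed.

(** The first scale reaching delta. The range starts at r / 2 because covers are compared with
    scales matched only up to a factor 2. *)
Lemma scale_near theta r L (delta : R) : 0 < r <= 1 -> 0 < theta <= 1 ->
  1 <= 2 ^+ L * r -> r / 2 <= delta <= r `^ theta ->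
  exists2 k : 'I_L.+1, delta <= scale theta r k & scale theta r k <= 2 * delta.
Proof.
move=> r01 th01 Lr /andP[dr dth]; have r0 : 0 < r by case/andP: r01.
have ex : exists k, delta <= 2 ^+ k * r.
  by exists L; apply: le_trans Lr; apply: le_trans dth _; exact: rtheta_le1.
have := ex_minnP ex; case=> k dk kmin.
have kL : (k < L.+1)%N.
  by rewrite ltnS kmin//; apply: le_trans Lr; apply: le_trans dth _; exact: rtheta_le1.
exists (Ordinal kL); first by rewrite /scale le_min dk dth.
rewrite /scale ge_min; apply/orP; left => /=.
case: k dk kmin kL => [|k] dk kmin _; first by rewrite expr0 mul1r; lra.
have kd : 2 ^+ k * r < delta.
  by rewrite ltNge; apply/negP => /kmin; rewrite ltnn.
by rewrite exprS -mulrA ler_pM2l// ltW.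
Qed.

(** Summed over an index with [a] the total of the [w], this stands in for the Cauchy-Schwarz
    inequality. *)
Lemma ler_amgm_weighted (a w x : R) : 0 < a -> 0 < w -> 2 * x <= w / a + a * (x ^+ 2 / w).
Proof.
move=> a0 w0; rewrite -subr_ge0.
have -> : w / a + a * (x ^+ 2 / w) - 2 * x = (w - a * x) ^+ 2 / (a * w).
  by field; rewrite !gt_eqF.
by rewrite divr_ge0 ?sqr_ge0 ?mulr_ge0 ?(ltW a0) ?(ltW w0).
Qed.

(** Here [a] assigns to each point a covering set. Two points of class l are within delta l, so some
    scale of size at most 2 delta l sees the pair, and the class, of mass P l, satisfies (P l)^2 <=
    w l * J l with w l = (2 delta l / r)^s. The P l sum to 1, so Cauchy-Schwarz yields 1 <= (sum of
    w) * (sum of J). *)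
Lemma mass_distribution theta s r L N p y (a : 'I_N -> nat) (delta : nat -> R) B :
  0 < r <= 1 -> 0 < theta <= 1 -> 0 <= s -> 1 <= 2 ^+ L * r ->
  (forall i, 0 <= p i) -> \sum_(i < N) p i = 1 -> (forall i, (a i < B)%N) ->
  (forall i, r / 2 <= delta (a i) <= r `^ theta) ->
  (forall i j, a i = a j -> enorm (y i - y j) <= delta (a i)) ->
  1 <= multiscale_energy theta s r L N p y *
    \sum_(l < B | [exists i, a i == l]) (2 * delta l / r) `^ s.
Proof.
move=> r01 th01 s0 Lr p0 p1 aB ad ay; have r0 : 0 < r by case/andP: r01.
pose S (l : 'I_B) := [exists i, a i == l].
pose w (l : nat) := (2 * delta l / r) `^ s.
have d0 i : 0 < delta (a i).
  by have /andP[h _] := ad i; apply: lt_le_trans h; rewrite divr_gt0.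
have w0 i : 0 < w (a i) by rewrite powR_gt0// divr_gt0// mulr_gt0.
have wS l : S l -> 0 < w l by move=> /existsP[i /eqP <-].
pose psi (i j : 'I_N) := \sum_(k < L.+1) (r / scale theta r k) `^ s *
  (enorm (y i - y j) <= scale theta r k)%R%:R.
have psi0 i j : 0 <= psi i j.
  by apply: sumr_ge0 => k _; rewrite mulr_ge0 ?powR_ge0.
have JE : multiscale_energy theta s r L N p y =
    \sum_(j < N) \sum_(i < N) p i * p j * psi i j.
  rewrite /multiscale_energy exchange_big; apply: eq_bigr => j _ /=.
  rewrite exchange_big; apply: eq_bigr => i _ /=; rewrite mulr_sumr.
  by apply: eq_bigr => k _; rewrite mulrAC mulrC mulrA.
have wpsi i j : a i = a j -> 1 <= w (a i) * psi i j.
  move=> aij; have [k dk kd] := scale_near r01 th01 Lr (ad i).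
  have /andP[rk kr] := scale_bounds k r01 th01.
  have sk0 : 0 < scale theta r k by exact: lt_le_trans rk.
  have psik : (r / scale theta r k) `^ s <= psi i j.
    rewrite /psi (bigD1 k)//= (le_trans (ay _ _ aij) dk) mulr1 lerDl.
    by apply: sumr_ge0 => k' _; rewrite mulr_ge0 ?powR_ge0.
  apply: (@le_trans _ _ (w (a i) * (r / scale theta r k) `^ s)); last first.
    by rewrite ler_wpM2l// ltW.
  rewrite /w -powRM ?divr_ge0 ?mulr_ge0 ?(ltW r0) ?(ltW (d0 i)) ?(ltW sk0)//.
  apply: (@le_trans _ _ (1 `^ s)); first by rewrite powR1.
  rewrite mulrA divfK ?gt_eqF// powR_le//.
  by rewrite ler_pdivlMr// mul1r.
pose A := \sum_(l < B | S l) w l.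
rewrite -/A JE.
pose P l := \sum_(i < N | a i == l) p i.
pose J l := \sum_(j < N | a j == l) \sum_(i < N) p i * p j * psi i j.
have partS (f : 'I_N -> R) : \sum_(i < N) f i =
    \sum_(l < B | S l) \sum_(i < N | a i == l) f i.
  rewrite (partition_big (fun i => Ordinal (aB i)) S)//=.
  by move=> i _; apply/existsP; exists i.
have P1 : \sum_(l < B | S l) P l = 1 by rewrite /P -partS p1.
have PJ (l : 'I_B) : P l ^+ 2 <= w l * J l.
  rewrite expr2 /P big_distrlr /= exchange_big /= /J mulr_sumr.
  apply: ler_sum => j /eqP jl.
  rewrite mulr_sumr big_mkcond /=; apply: ler_sum => i _; case: ifP => [/eqP il|_].
    rewrite mulrCA -[leLHS]mulr1 ler_wpM2l ?mulr_ge0// -il wpsi//.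
    by rewrite il jl.
  by rewrite !mulr_ge0// -jl ltW.
have A0 : 0 < A.
  rewrite lt_neqAle; apply/andP; split; last by apply: sumr_ge0 => l /wS/ltW.
  apply/negP => /eqP/esym A0.
  have : \sum_(l < B | S l) P l = 0.
    rewrite big1// => l Sl.
    have := wS l Sl; have : w l <= A.
      by rewrite /A (bigD1 l)//= lerDl; apply: sumr_ge0 => l' /andP[/wS/ltW].
    by rewrite A0 leNgt => /negbTE ->.
  by rewrite P1 => /eqP; rewrite oner_eq0.
have : 2 * 1 <= \sum_(l < B | S l) (w l / A + A * J l).
  rewrite -[X in _ * X <= _]P1 mulr_sumr; apply: ler_sum => l Sl.
  apply: le_trans (ler_amgm_weighted (P l) A0 (wS l Sl)) _.
  rewrite lerD2l ler_pM2l// ler_pdivrMr ?wS// mulrC; exact: PJ.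
rewrite big_split /= -mulr_suml -/A divff ?gt_eqF// -mulr_sumr -partS.
by rewrite mulrC; lra.
Qed.

End MassDistribution.

Lemma geometric_sum_le (R : realFieldType) (q : R) k : 0 <= q < 1 ->
  \sum_(i < k) q ^+ i <= (1 - q)^-1.
Proof.
move=> /andP[q0 q1]; have q1' : 0 < 1 - q by rewrite subr_gt0.
rewrite -[leRHS]mul1r ler_pdivlMr// mulrC.
suff -> : (1 - q) * \sum_(i < k) q ^+ i = 1 - q ^+ k by rewrite lerBlDr lerDl exprn_ge0.
elim: k => [|k IH]; first by rewrite big_ord0 mulr0 expr0 subrr.
by rewrite big_ord_recr /= mulrDr IH exprS; ring.
Qed.

Lemma small_power (R : realType) (e : R) : 0 < e -> exists k, 2^-1 ^+ k < e.
Proof.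
move=> e0; exists (Num.truncn e^-1).+1.
rewrite exprVn -[ltRHS]invrK ltf_pV2 ?posrE ?exprn_gt0 ?invr_gt0//.
have /andP[_ h] : (Num.truncn e^-1)%:R <= e^-1 < (Num.truncn e^-1).+1%:R.
  by apply: truncn_itv; rewrite invr_ge0 ltW.
apply: (lt_le_trans h); rewrite -natrX ler_nat.
by apply: ltnW; apply: ltn_expl.
Qed.

(** The Borel-Cantelli step: sum_k f_k / b_k has finite integral, hence is finite almost everywhere,
    and its value bounds all its terms at once. *)
Lemma ae_bounded_geometric d (T : measurableType d) (R : realType)
    (mu : probability T R) (f : nat -> T -> R) (b : nat -> R) (C q : R) :
  (forall k x, 0 <= f k x) -> (forall k, measurable_fun setT (f k)) ->
  (forall k, 0 < b k) -> 0 <= C -> 0 <= q < 1 ->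
  (forall k, \int[mu]_x (f k x)%:E <= (C * q ^+ k * b k)%:E)%E ->
  {ae mu, forall x, exists2 B : R, 0 < B & forall k, f k x <= B * b k}.
Proof.
move=> f0 mf b0 C0 q01 hf; have /andP[q0 q1] := q01.
pose g k x : \bar R := ((b k)^-1 * f k x)%:E.
have g0 k x : (0 <= g k x)%E by rewrite lee_fin mulr_ge0// invr_ge0 ltW.
have mg k : measurable_fun setT (g k).
  by apply/measurable_EFinP; apply: measurable_funM.
have ig k : (\int[mu]_x g k x <= (C * q ^+ k)%:E)%E.
  rewrite /g; under eq_integral do rewrite EFinM.
  rewrite ge0_integralZl_EFin//; last 3 first.
  - by move=> x _; rewrite lee_fin.
  - exact/measurable_EFinP.
  - by rewrite invr_ge0 ltW.
  by rewrite lee_pdivrMl// muleC -EFinM.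
have sg : (\int[mu]_x (\sum_(k <oo) g k x) <= (C * (1 - q)^-1)%:E)%E.
  rewrite integral_nneseries//.
  apply: lime_le; first by apply: is_cvg_nneseries => k _ _; exact: integral_ge0.
  apply: nearW => N.
  apply: (@le_trans _ _ (\sum_(0 <= k < N) (C * q ^+ k)%:E)%E); first exact: lee_sum.
  rewrite sumEFin lee_fin big_mkord -mulr_sumr ler_wpM2l//.
  exact: geometric_sum_le.
have int : mu.-integrable setT (fun x => (\sum_(k <oo) g k x)%E).
  apply/integrableP; split; first exact: ge0_emeasurable_sum.
  apply: (@le_lt_trans _ _ (C * (1 - q)^-1)%:E); last exact: ltry.
  apply: le_trans sg; apply: ge0_le_integral => //.
  - by apply: measurableT_comp => //; exact: ge0_emeasurable_sum.
  - exact: ge0_emeasurable_sum.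
  - by move=> x _; rewrite gee0_abs// nneseries_ge0.
apply: filterS (integrable_ae measurableT int) => x /(_ Logic.I).
set S := (\sum_(k <oo) g k x)%E => Sfin.
have S0 : 0 <= fine S by apply: fine_ge0; exact: nneseries_ge0.
exists (fine S + 1); first by rewrite ltr_wpDl.
move=> k; rewrite -ler_pdivrMr// mulrC.
apply: (@le_trans _ _ (fine S)); last by rewrite lerDl.
rewrite -lee_fin fineK//.
apply: (@le_trans _ _ (\sum_(0 <= i < k.+1) g i x)%E); last first.
  by apply: nneseries_lim_ge => i _ _.
rewrite big_nat_recr//= leeDr//; exact: sume_ge0.
Qed.

Section Expectation.
Context {R : realType} {n m : nat}.
Variable (le_mn : (m <= n)%N).
Hypothesis m0 : (0 < m)%N.
Local Notation G := (Gr R le_mn).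
Variable gamma : probability (borel G) R.
Hypothesis inv : rotation_invariant le_mn gamma.
Implicit Types (theta s r : R) (x : nat -> 'rV[R]_n) (p : nat -> R).

Lemma multiscale_energyE theta s r L N p x (V : borel G) :
  multiscale_energy theta s r L N p (fun i => orthoproj (val (V : G)) (x i)) =
  \sum_(k < L.+1) \sum_(j < N) \sum_(i < N)
    (r / scale theta r k) `^ s * (p i * p j) *
     \1_(slab le_mn (x i - x j) (scale theta r k)) V.
Proof.
apply: eq_bigr => k _; apply: eq_bigr => j _; apply: eq_bigr => i _.
congr (_ * _); rewrite indicE -linearB; congr ((nat_of_bool _)%:R).
by apply/idP/idP => [h|]; [rewrite inE|rewrite inE].
Qed.

Lemma multiscale_energy_measurable theta s r L N p x :
  measurable_fun setT (fun V : borel G =>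
    multiscale_energy theta s r L N p (fun i => orthoproj (val (V : G)) (x i))).
Proof.
under eq_fun do rewrite multiscale_energyE.
apply: measurable_sum => k; apply: measurable_sum => j; apply: measurable_sum => i.
apply: measurable_funM; first exact: measurable_cst.
by apply: measurable_indic; exact: slab_measurable.
Qed.

(** For each pair and each scale t, (r / t)^s times the measure of the slab is at most K (r / t)^s
    min(1, t / |x|)^m, a term of the maximum defining the kernel. Adding the scales costs L + 1. *)
Lemma multiscale_expectation : exists2 K : R, 0 < K &
  forall theta s r L N p x, 0 < r <= 1 -> 0 < theta <= 1 -> 0 <= s <= m%:R ->
  (forall i, 0 <= p i) ->
  (\int[gamma]_V (multiscale_energy theta s r L N p
     (fun i => orthoproj (val (V : G)) (x i)))%:E <=
  (K * L.+1%:R * discrete_energy m theta s r N x p)%:E)%E.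
Proof.
have [K K0 hK] := slab_small m0 inv.
exists K => // theta s r L N p x r01 th01 sm p0.
have r0 : 0 < r by case/andP: r01.
pose c (k : 'I_L.+1) (j i : 'I_N) : R := (r / scale theta r k) `^ s * (p i * p j).
have c0 k j i : 0 <= c k j i by rewrite !mulr_ge0 ?powR_ge0.
pose A (k : 'I_L.+1) (j i : 'I_N) := slab le_mn (x i - x j) (scale theta r k).
have mI k j i : measurable_fun setT (fun V : borel G => (c k j i * \1_(A k j i) V)%:E).
  apply/measurable_EFinP; apply: measurable_funM; first exact: measurable_cst.
  by apply: measurable_indic; exact: slab_measurable.
have -> : (\int[gamma]_V (multiscale_energy theta s r L N p
     (fun i => orthoproj (val (V : G)) (x i)))%:E =
   \int[gamma]_V \sum_(k < L.+1) \sum_(j < N) \sum_(i < N) (c k j i * \1_(A k j i) V)%:E)%E.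
  apply: eq_integral => V _; rewrite multiscale_energyE -sumEFin.
  by apply: eq_bigr => k _; rewrite -sumEFin; apply: eq_bigr => j _; rewrite -sumEFin.
rewrite ge0_integral_sum//; last 2 first.
- by move=> k; apply: emeasurable_sum => j; exact: emeasurable_sum.
- by move=> k V _; apply: sume_ge0 => j _; apply: sume_ge0 => i _; rewrite lee_fin mulr_ge0.
apply: (@le_trans _ _ (\sum_(k < L.+1) (K * discrete_energy m theta s r N x p)%:E)%E); last first.
  by rewrite sumEFin lee_fin sumr_const card_ord -[leLHS]mulr_natr mulrAC lexx.
apply: lee_sum => k _.
rewrite ge0_integral_sum//; last 2 first.
- by move=> j; exact: emeasurable_sum.
- by move=> j V _; apply: sume_ge0 => i _; rewrite lee_fin mulr_ge0.
rewrite /discrete_energy mulr_sumr -sumEFin; apply: lee_sum => j _.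
rewrite ge0_integral_sum//; last first.
  by move=> i V _; rewrite lee_fin mulr_ge0.
rewrite mulr_sumr -sumEFin; apply: lee_sum => i _.
under eq_integral do rewrite EFinM.
have mA : measurable (A k j i) by exact: slab_measurable.
rewrite ge0_integralZl_EFin//; last first.
  by apply/measurable_EFinP; exact: measurable_indic.
have -> : (\int[gamma]_V (\1_(A k j i) V)%:E = (fine (gamma (A k j i)))%:E)%E.
  by rewrite integral_indic// setIT fineK// fin_num_measure.
rewrite -EFinM lee_fin.
have /andP[rk kr] := scale_bounds k r01 th01.
have sk0 : 0 < scale theta r k by exact: lt_le_trans rk.
apply: le_trans (ler_wpM2l (c0 _ _ _) (hK _ _ sk0)) _.
rewrite phi_phir.
have := @phir_ge R m theta r r01 s (scale theta r k) (enorm (x i - x j)) sm.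
rewrite rk kr enorm_ge0 => /(_ isT isT) h.
have -> : c k j i * (K * kap m (scale theta r k) (enorm (x i - x j))) =
  K * (p i * p j * ((r / scale theta r k) `^ s * kap m (scale theta r k) (enorm (x i - x j)))).
  by rewrite /c; ring.
by rewrite ler_pM2l// ler_wpM2l ?mulr_ge0.
Qed.

End Expectation.

(** * Almost sure lower bounds *)

Section CoverEnergy.
Context {R : realType} {n : nat}.
Implicit Types (theta s r : R).

(** Each of the finitely many points selects one covering set, and only the selected sets enter.
    Their diameters are at most 1, so passing from s' to s only lowers the weights, whose sum is at
    most 1. *)
Lemma admissible_cover_energy theta s s' r rho L N (p : nat -> R) (y : nat -> 'rV[R]_n)
    (F : set 'rV[R]_n) :
  0 < r <= 1 -> 0 < theta <= 1 -> 0 <= s' -> s' <= s -> 1 <= 2 ^+ L * r ->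
  r / 2 <= rho <= r -> (forall i, F (y i)) -> (forall i, 0 <= p i) ->
  \sum_(i < N) p i = 1 -> admissible_cover theta (rho `^ theta) s' 1 F ->
  1 <= multiscale_energy theta s r L N p y * (2 / r) `^ s.
Proof.
move=> r01 th01 s'0 ss Lr /andP[rrho rhor] Fy p0 p1 [D [U [cov dU sU]]].
have r0 : 0 < r by case/andP: r01.
have [th0 th1] := andP th01.
have s0 : 0 <= s by exact: le_trans ss.
have rho0 : 0 < rho by apply: lt_le_trans rrho; rewrite divr_gt0.
have hy (i : 'I_N) : exists l, D l /\ U l (y i).
  by have [l Dl Ul] := cov _ (Fy i); exists l.
have [a ha] := choice hy.
pose delta l := fine (diam (U l)).
have dE l : D l -> diam (U l) = (delta l)%:E.
  move=> /dU /andP[_ h]; rewrite /delta fineK// ge0_fin_numE ?diam_ge0//.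
  exact: le_lt_trans h (ltry _).
have dB l : D l -> rho <= delta l <= rho `^ theta.
  by move=> Dl; have := dU l Dl; rewrite dE// !lee_fin -powRrM divff ?gt_eqF// powRr1 ?(ltW rho0).
have rth : rho `^ theta <= r `^ theta by rewrite powR_le// ltW.
have r1 : r `^ theta <= 1 by exact: rtheta_le1.
(* A bound on the selected indices, reducing a possibly infinite cover to a finite sum. *)
pose B := (\max_(i < N) a i).+1.
have aB i : (a i < B)%N by rewrite ltnS; exact: leq_bigmax.
have dS (l : 'I_B) : [exists i, a i == l :> nat] -> D l.
  by move=> /existsP[i /eqP <-]; have [] := ha i.
have h1 := @mass_distribution R n theta s r L N p y a delta B r01 th01 s0 Lr p0 p1 aB.
apply: (le_trans (h1 _ _)).
- move=> i; have [Di _] := ha i; have /andP[h2 h3] := dB _ Di.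
  by rewrite (le_trans rrho h2) (le_trans h3).
- move=> i j aij; have [Di Ui] := ha i; have [_ Uj] := ha j.
  by rewrite aij in Ui Di *; apply: (enorm_le_diam _ Ui Uj); rewrite dE.
rewrite ler_wpM2l//.
  apply: sumr_ge0 => k _; apply: sumr_ge0 => j _; apply: sumr_ge0 => i _.
  by rewrite !mulr_ge0 ?powR_ge0.
apply: (@le_trans _ _ (\sum_(l < B | [exists i, a i == l :> nat]) (2 / r) `^ s * delta l `^ s')).
  apply: ler_sum => l /dS Dl; have /andP[h2 h3] := dB _ Dl.
  have d0 : 0 < delta l by exact: lt_le_trans h2.
  have -> : 2 * delta l / r = 2 / r * delta l by rewrite mulrAC.
  rewrite powRM ?divr_ge0 ?(ltW r0) ?(ltW d0)// ler_wpM2l ?powR_ge0//.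
  by rewrite ger_powR// d0/= (le_trans h3)// (le_trans rth).
rewrite -mulr_sumr -[leRHS]mulr1 ler_wpM2l ?powR_ge0//.
rewrite -lee_fin; apply: le_trans sU.
have DE : D = [set l | [pred l | `[< D l >]] l].
  by apply/seteqP; split => l /=; [move=> Dl; apply/asboolP|move/asboolP].
rewrite DE -nneseries_esum; last by move=> l _; exact: poweR_ge0.
apply: (@le_trans _ _ (\sum_(0 <= l < B | [pred l | `[< D l >]] l) poweR (diam (U l)) s')%E).
  rewrite big_mkord -sumEFin big_mkcond [leRHS]big_mkcond /=.
  apply: lee_sum => l _; case: ifP => [/dS Dl|_].
    by rewrite (introT (asboolP _) Dl) dE.
  by case: ifP => // _; exact: poweR_ge0.
by apply: nneseries_lim_ge => l _ _; exact: poweR_ge0.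
Qed.

Lemma discrete_of_log_capacity m theta s r (b : R) (E : set 'rV[R]_n) :
  (0 < n)%N -> E !=set0 -> bounded_set E ->
  0 < r < 1 -> 0 < theta <= 1 -> 0 <= s <= m%:R ->
  (b%:E < log_capacity m theta s E r)%E ->
  exists N (x : nat -> 'rV[R]_n) (p : nat -> R),
    [/\ forall i, E (x i), forall i, 0 <= p i, \sum_(i < N) p i = 1 &
     discrete_energy m theta s r N x p <= 3 ^+ m * r `^ b].
Proof.
move=> n0 E0 bE r01 th01 sm.
have r01' : 0 < r <= 1 by case/andP: r01 => -> /ltW ->.
have r0 : 0 < r by case/andP: r01.
have [D D0 hD] := bounded_closure_enorm bE.
have C1 := capacity_ge1 E0 hD r01' th01 sm.
have mE := min_energy_fin E0 hD r01' th01 sm.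
have lr : 0 < - ln r by rewrite oppr_gt0 ln_lt0.
rewrite /log_capacity lte_fin ltr_pdivlMr// => h.
have : (min_energy m theta s r E < (r `^ b)%:E)%E.
  rewrite mE lte_fin; move: C1 h; move: (capacity m theta s r E) => C C1 h.
  have C0 : 0 < C by exact: lt_le_trans C1.
  rewrite -[ltRHS]invrK ltf_pV2 ?posrE ?invr_gt0 ?powR_gt0//.
  by rewrite -ltr_ln ?posrE ?invr_gt0 ?powR_gt0// lnV ?posrE ?powR_gt0// ln_powR -mulrN.
move=> /ereal_inf_lt[_ [mu mu1 <-] /ltW hmu].
exact: energy_discretize mu1 hmu.
Qed.

End CoverEnergy.

Section AlmostEverywhere.
Context d (T : measurableType d) (R : realType) (mu : {measure set T -> \bar R}).
Implicit Types P Q S : T -> Prop.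

Lemma ae_mono P Q : (forall x, P x -> Q x) -> {ae mu, forall x, P x} ->
  {ae mu, forall x, Q x}.
Proof. by move=> PQ; apply: filterS. Qed.

Lemma ae_mono2 P Q S : (forall x, P x -> Q x -> S x) -> {ae mu, forall x, P x} ->
  {ae mu, forall x, Q x} -> {ae mu, forall x, S x}.
Proof. by move=> PQS; apply: filterS2. Qed.

Lemma ae_forall_rat2 (P : rat -> rat -> T -> Prop) :
  (forall q s, {ae mu, forall x, P q s x}) -> {ae mu, forall x, forall q s, P q s x}.
Proof.
move=> h.
have : {ae mu, forall x, forall k : nat, if unpickle k is Some (q, s) then P q s x else True}.
  apply: ae_foralln => k; case: unpickle => [[q s]|]; first exact: h.
  exact: aeW.
by apply: ae_mono => x hx q s; have := hx (pickle (q, s)); rewrite pickleK.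
Qed.

End AlmostEverywhere.

Section AlmostSure.
Context {R : realType} {n m : nat}.
Variable (le_mn : (m <= n)%N).
Hypothesis m0 : (0 < m)%N.
Local Notation G := (Gr R le_mn).
Variable gamma : probability (borel G) R.
Hypothesis inv : rotation_invariant le_mn gamma.
Variable E : set 'rV[R]_n.
Hypotheses (E0 : E !=set0) (bE : bounded_set E).
Variables (theta s : R).
Hypotheses (th01 : 0 < theta <= 1) (sm : 0 <= s <= m%:R).
Let th0 : 0 < theta. Proof. by case/andP: th01. Qed.
Let n0 : (0 < n)%N. Proof. exact: leq_trans le_mn. Qed.

(** The excess eta is spent in three parts: eta / 4 on the number of dyadic scales, eta / 4 on the
    geometric decay q^k, available as r_k <= 2^-k, and eta / 2 is kept in the conclusion, which
    fails for small r_k. The range [r_k / 2, r_k] for rho lets a sequence of scales control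
    intermediate ones. *)
Lemma ae_no_cover (eta : R) (r : nat -> R) : 0 < eta ->
  (forall k, 0 < r k < 1) -> (forall k, r k <= 2^-1 ^+ k) ->
  (forall k, ((s + eta)%:E < log_capacity m theta s E (r k))%E) ->
  {ae gamma, forall V : G, exists2 B : R, 0 < B & forall k rho s',
     r k / 2 <= rho <= r k -> 0 <= s' <= s ->
     admissible_cover theta (rho `^ theta) s' 1 (orthoproj (val V) @` E) ->
     1 <= B * r k `^ (eta / 2)}.
Proof.
move=> eta0 r01 r2 hlog.
have r01' k : 0 < r k <= 1 by case/andP: (r01 k) => -> /ltW ->.
have r0 k : 0 < r k by case/andP: (r01 k).
have e4 : 0 < eta / 4 by rewrite divr_gt0.
have [K K0 hK] := @dyadic_scales R 1 (eta / 4) ltr01 e4.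
have [K' K'0 hK'] := multiscale_expectation m0 inv.
have H k : exists w : nat * nat * (nat -> 'rV[R]_n) * (nat -> R),
    let: (N, L, x, p) := w in
    [/\ forall i, E (x i), forall i, 0 <= p i, \sum_(i < N) p i = 1,
     discrete_energy m theta s (r k) N x p <= 3 ^+ m * r k `^ (s + eta) &
     1 <= 2 ^+ L * r k /\ L.+1%:R <= K * r k `^ (- (eta / 4))].
  have [N [x [p [Ex p0 p1 dp]]]] := discrete_of_log_capacity n0 E0 bE (r01 k) th01 sm (hlog k).
  have [L L1 L2] := hK _ (r01 k).
  by exists (N, L, x, p).
have [w hw] := choice H.
pose N k := (w k).1.1.1; pose L k := (w k).1.1.2.
pose x k := (w k).1.2; pose p k := (w k).2.
have {}hw k : [/\ forall i, E (x k i), forall i, 0 <= p k i, \sum_(i < N k) p k i = 1,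
     discrete_energy m theta s (r k) (N k) (x k) (p k) <= 3 ^+ m * r k `^ (s + eta) &
     1 <= 2 ^+ (L k) * r k /\ (L k).+1%:R <= K * r k `^ (- (eta / 4))].
  by rewrite /N /L /x /p; have := hw k; case: (w k) => [[[N' L'] x'] p'].
pose J k (V : borel G) := multiscale_energy theta s (r k) (L k) (N k) (p k)
   (fun i => orthoproj (val (V : G)) (x k i)).
pose q : R := 2^-1 `^ (eta / 4).
have q01 : 0 <= q < 1.
  rewrite powR_ge0/=; apply: (@lt_le_trans _ _ (1 `^ (eta / 4))); last by rewrite powR1.
  by rewrite gt0_ltr_powR ?nnegrE ?invr_ge0// invf_lt1// ltr1n.
pose C := K' * K * 3 ^+ m.
have C0 : 0 <= C by rewrite !mulr_ge0 ?exprn_ge0// ltW.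
have b0 k : 0 < r k `^ (s + eta / 2) by rewrite powR_gt0.
have J0 k V : 0 <= J k V.
  have [_ p0 _ _ _] := hw k.
  apply: sumr_ge0 => k' _; apply: sumr_ge0 => j _; apply: sumr_ge0 => i _.
  by rewrite !mulr_ge0 ?powR_ge0.
have mJ k : measurable_fun setT (J k) by exact: multiscale_energy_measurable.
have iJ k : (\int[gamma]_V (J k V)%:E <= (C * q ^+ k * r k `^ (s + eta / 2))%:E)%E.
  have [Ex p0 p1 dp [L1 L2]] := hw k.
  apply: le_trans (hK' theta s (r k) (L k) (N k) (p k) (x k) (r01' k) th01 sm p0) _.
  rewrite lee_fin.
  apply: (@le_trans _ _ (K' * (K * r k `^ (- (eta / 4))) * (3 ^+ m * r k `^ (s + eta)))).
    apply: ler_pM => //; first by rewrite mulr_ge0// ltW.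
      apply: sumr_ge0 => j _; apply: sumr_ge0 => i _.
      by rewrite !mulr_ge0// phi_ge0.
    by rewrite ler_pM2l.
  have rq : r k `^ (eta / 4) <= q ^+ k.
    rewrite /q -powR_mulrn ?powR_ge0// powRAC powR_le ?(ltW e4)//.
    by rewrite powR_mulrn ?invr_ge0.
  have -> : K' * (K * r k `^ (- (eta / 4))) * (3 ^+ m * r k `^ (s + eta)) =
     C * r k `^ (eta / 4) * r k `^ (s + eta / 2).
    have -> : r k `^ (s + eta) = r k `^ (eta / 4) * r k `^ (eta / 4) * r k `^ (s + eta / 2).
      by rewrite -!powRD ?(gt_eqF (r0 k)) ?implybT//; congr (_ `^ _); field.
    rewrite powRN /C; field; rewrite gt_eqF// powR_gt0//.
  by rewrite ler_pM2r// ler_wpM2l.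
apply: filterS (ae_bounded_geometric J0 mJ b0 C0 q01 iJ) => V [B B0 hB].
exists (B * 2 `^ s); first by rewrite mulr_gt0// powR_gt0.
move=> k rho s' rhoP /andP[s'0 ss'] cov.
have [Ex p0 p1 dp [L1 L2]] := hw k.
have FE i : (orthoproj (val (V : G)) @` E) (orthoproj (val (V : G)) (x k i)).
  by exists (x k i).
apply: le_trans (admissible_cover_energy (r01' k) th01 s'0 ss' L1 rhoP FE p0 p1 cov) _.
apply: (@le_trans _ _ (B * r k `^ (s + eta / 2) * (2 / r k) `^ s)).
  by rewrite ler_wpM2r ?powR_ge0//; exact: hB.
rewrite powRM ?invr_ge0 ?(ltW (r0 k))//.
have -> : (r k)^-1 `^ s = r k `^ (- s) by rewrite -powR_inv1 ?(ltW (r0 k))// -powRrM mulN1r.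
rewrite le_eqVlt; apply/orP; left; apply/eqP.
have -> : r k `^ (eta / 2) = r k `^ (s + eta / 2) * r k `^ (- s).
  by rewrite -powRD ?(gt_eqF (r0 k)) ?implybT//; congr (_ `^ _); ring.
by ring.
Qed.

Let room (l : \bar R) : (s%:E < l)%E -> exists2 eta, 0 < eta & ((s + eta)%:E < l)%E.
Proof.
case: l => [l| |]//.
  rewrite lte_fin => sl; exists ((l - s) / 2); first by lra.
  by rewrite lte_fin; lra.
by exists 1; rewrite ?ltry.
Qed.

Let threshold (B eta : R) : 0 < B -> 0 < eta ->
  exists2 e, 0 < e & forall r, 0 < r <= e -> B * r `^ (eta / 2) < 1.
Proof.
move=> B0 eta0; have e2 : 0 < eta / 2 by rewrite divr_gt0.
exists ((2 * B)^-1 `^ (eta / 2)^-1); first by rewrite powR_gt0// invr_gt0 mulr_gt0.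
move=> r /andP[r0 re]; rewrite mulrC -ltr_pdivlMr//.
apply: (@le_lt_trans _ _ (2 * B)^-1).
  have -> : (2 * B)^-1 = ((2 * B)^-1 `^ (eta / 2)^-1) `^ (eta / 2).
    by rewrite -powRrM mulVf ?gt_eqF// powRr1// invr_ge0 mulr_ge0// ltW.
  by rewrite powR_le ?(ltW e2).
by rewrite div1r ltf_pV2 ?posrE ?mulr_gt0// ltr_pMl// ltr1n.
Qed.

Lemma ae_upper_idim_ge : (s%:E < limf_esup (log_capacity m theta s E) 0^'+)%E ->
  {ae gamma, forall V : G, (s%:E <= upper_idim theta (orthoproj (val V) @` E))%E}.
Proof.
move=> /room[eta eta0 hs].
have H k : exists r, [/\ 0 < r < 1, r <= 2^-1 ^+ k &
    ((s + eta)%:E < log_capacity m theta s E r)%E].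
  have e0 : 0 < Num.min 1 (2^-1 ^+ k) :> R by rewrite lt_min ltr01 exprn_gt0// invr_gt0.
  have [r /andP[r0]] := limf_esup_freq hs (near0_lt e0).
  by rewrite lt_min => /andP[r1 r2] hr; exists r; split => //; rewrite ?r0// ltW.
have [r hr] := choice H.
have r01 k : 0 < r k < 1 by have [] := hr k.
have r2 k : r k <= 2^-1 ^+ k by have [] := hr k.
have rl k : ((s + eta)%:E < log_capacity m theta s E (r k))%E by have [] := hr k.
apply: ae_mono (ae_no_cover eta0 r01 r2 rl) => V [B B0 hB].
have [e e0 he] := threshold B0 eta0.
apply: le_ereal_inf_tmp => _ [s' [s'0 hs'] <-]; rewrite lee_fin leNgt; apply/negP => ss.
have [rho0 rho00 hrho] := hs' 1 ltr01.
have e'0 : 0 < Num.min e (rho0 `^ theta^-1) by rewrite lt_min e0 powR_gt0.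
have [k hk] := small_power e'0.
have rk0 : 0 < r k by case/andP: (r01 k).
have := le_lt_trans (r2 k) hk; rewrite lt_min => /andP[rke rkr].
have rk1 : r k `^ theta <= rho0.
  have -> : rho0 = (rho0 `^ theta^-1) `^ theta.
    by rewrite -powRrM mulVf ?gt_eqF// powRr1// ltW.
  by rewrite powR_le ?(ltW th0)// ltW.
have hc : admissible_cover theta (r k `^ theta) s' 1 (orthoproj (val V) @` E).
  by apply: hrho; rewrite powR_gt0.
have := hB k (r k) s' _ _ hc; rewrite lexx s'0 (ltW ss) andbT.
have -> : r k / 2 <= r k by rewrite ler_pdivrMr// ler_peMr ?ler1n// ltW.
move=> /(_ isT isT); rewrite leNgt he//.
by rewrite rk0 ltW.
Qed.

(** The covers now come at scales that cannot be prescribed. The lower limit controls all small r,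
    so the r_k may be consecutive powers of 1/2, and every small scale is within a factor 2 of one
    of them. *)
Lemma ae_lower_idim_ge : (s%:E < limf_einf (log_capacity m theta s E) 0^'+)%E ->
  {ae gamma, forall V : G, (s%:E <= lower_idim theta (orthoproj (val V) @` E))%E}.
Proof.
move=> /room[eta eta0 hs].
have [e1 e10 he1] := near0E (limf_einf_near hs).
have e1'0 : 0 < Num.min 1 e1 by rewrite lt_min ltr01.
have [k0 hk0] := small_power e1'0.
pose r k : R := 2^-1 ^+ (k + k0).
have r0 k : 0 < r k by rewrite exprn_gt0// invr_gt0.
have i2 : (2^-1 : R) <= 1 by rewrite invf_le1// ler1n.
have rk0 k : r k <= r 0%N.
  by rewrite /r exprD add0n ler_piMl ?exprn_ge0 ?invr_ge0// exprn_ile1// invr_ge0.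
have r2 k : r k <= 2^-1 ^+ k.
  by rewrite /r exprD ler_piMr ?exprn_ge0 ?invr_ge0// exprn_ile1// invr_ge0.
have rlt k : r k < Num.min 1 e1 by apply: le_lt_trans (rk0 k) _; rewrite /r add0n.
have r01 k : 0 < r k < 1.
  by rewrite r0; have := rlt k; rewrite lt_min => /andP[].
have rl k : ((s + eta)%:E < log_capacity m theta s E (r k))%E.
  by apply: he1; rewrite r0; have := rlt k; rewrite lt_min => /andP[].
apply: ae_mono (ae_no_cover eta0 r01 r2 rl) => V [B B0 hB].
have [e e0 he] := threshold B0 eta0.
apply: le_ereal_inf_tmp => _ [s' [s'0 hs'] <-]; rewrite lee_fin leNgt; apply/negP => ss.
(* The bound r 0 places rho below the start of the sequence; e / 2 ensures r k <= 2 rho <= e. *)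
pose d := Num.min (e / 2) (r 0%N).
have d0 : 0 < d by rewrite lt_min r0 divr_gt0.
have [r' /andP[r'0 r'd] hc] := hs' 1 (d `^ theta) ltr01 (powR_gt0 _ d0).
pose rho := r' `^ theta^-1.
have rho0 : 0 < rho by rewrite powR_gt0.
have rhoE : rho `^ theta = r' by rewrite -powRrM mulVf ?gt_eqF// powRr1// ltW.
have rhod : rho <= d.
  have -> : d = (d `^ theta) `^ theta^-1 by rewrite -powRrM divff ?gt_eqF// powRr1// ltW.
  by rewrite powR_le// invr_ge0 ltW.
have ex : exists k, r k / 2 <= rho.
  have [k hk] := small_power rho0; exists k.
  rewrite ler_pdivrMr//; apply: le_trans (r2 k) _; apply: (le_trans (ltW hk)).
  by rewrite ler_peMr ?ler1n// ltW.
(* By minimality rho < r_(k-1) / 2 = r_k, or k = 0 and rho <= d <= r 0. *)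
have := ex_minnP ex; case=> k krho kmin.
have rhok : rho <= r k.
  case: k krho kmin => [|k] _ kmin; first by apply: (le_trans rhod); rewrite ge_min lexx orbT.
  have : rho < r k / 2 by rewrite ltNge; apply/negP => /kmin; rewrite ltnn.
  by rewrite /r addSn exprS mulrC => /ltW.
rewrite -rhoE in hc.
have := hB k rho s' _ _ hc; rewrite krho rhok s'0 (ltW ss) => /(_ isT isT).
rewrite leNgt he// r0/=.
have : rho <= e / 2 by apply: (le_trans rhod); rewrite ge_min lexx.
lra.
Qed.

End AlmostSure.

(** * Dependence on theta and reduction to rational parameters *)

Section ThetaMonotone.
Context {R : realType} {n : nat}.
Implicit Types (F : set 'rV[R]_n) (theta q : R).

(** The same cover serves: for r <= 1, r^(1/q) <= r^(1/theta), so lowering theta only relaxes the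
    lower bound on diameters. *)
Lemma admissible_cover_theta q theta r s eps F : 0 < q -> q <= theta ->
  0 < r <= 1 -> admissible_cover theta r s eps F -> admissible_cover q r s eps F.
Proof.
move=> q0 qth r01 [D [U [cov dU sU]]]; exists D, U; split => // i /dU /andP[h1 h2].
apply/andP; split => //; apply: le_trans h1; rewrite lee_fin.
apply: ger_powR => //; rewrite lef_pV2 ?posrE//; exact: lt_le_trans qth.
Qed.

Lemma lower_idim_theta q theta F : 0 < q -> q <= theta ->
  (lower_idim q F <= lower_idim theta F)%E.
Proof.
move=> q0 qth; apply: ereal_inf_le_tmp => _ [s [s0 hs] <-]; exists s => //; split => //.
move=> eps r0 eps0 r00; have r1 : 0 < Num.min r0 1 by rewrite lt_min r00 ltr01.
have [r /andP[rp]] := hs eps _ eps0 r1; rewrite le_min => /andP[rr r1'] hr.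
by exists r; rewrite ?rp//; apply: admissible_cover_theta hr; rewrite ?rp.
Qed.

Lemma upper_idim_theta q theta F : 0 < q -> q <= theta ->
  (upper_idim q F <= upper_idim theta F)%E.
Proof.
move=> q0 qth; apply: ereal_inf_le_tmp => _ [s [s0 hs] <-]; exists s => //; split => //.
move=> eps eps0; have [r0 r00 hr] := hs eps eps0.
have r1 : 0 < Num.min r0 1 by rewrite lt_min r00 ltr01.
exists (Num.min r0 1) => // r /andP[rp]; rewrite le_min => /andP[rr r1'].
by apply: (admissible_cover_theta q0 qth); [rewrite rp|apply: hr; rewrite rp].
Qed.

(* Left continuity in [theta] reduces all [theta] to the rational ones. *)
Lemma le_of_rational_pairs (dim : R -> \bar R) (P theta : R) (m : nat)
    (good : R -> R -> Prop) :
  0 < theta <= 1 -> 0 <= P <= m%:R -> (0 <= dim theta)%E ->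
  (forall q, 0 < q -> q <= theta -> (dim q <= dim theta)%E) ->
  (forall s, 0 <= s -> s < P -> exists2 e, 0 < e & forall q, 0 < q -> q <= theta ->
     theta - q < e -> good q s) ->
  (forall q s : rat, 0 < (ratr q : R) <= 1 -> 0 <= (ratr s : R) <= m%:R ->
     good (ratr q) (ratr s) -> ((ratr s)%:E <= dim (ratr q))%E) ->
  (P%:E <= dim theta)%E.
Proof.
move=> /andP[th0 th1] /andP[P0 Pm] d0 mono gap rat_le.
rewrite leNgt; apply/negP => dP.
have df : dim theta = (fine (dim theta))%:E.
  by rewrite fineK// ge0_fin_numE//; apply: lt_trans dP (ltry _).
rewrite df lte_fin in dP; rewrite df lee_fin in d0.
have [s] := rat_in_itvoo dP; rewrite in_itv /= => /andP[ds sP].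
have s0 : 0 <= (ratr s : R) by apply: le_trans d0 (ltW ds).
have [e e0 he] := gap _ s0 sP.
have [q] : exists q : rat, ratr q \in `]Num.max 0 (theta - e), theta[.
  by apply: rat_in_itvoo; rewrite gt_max th0 ltrBlDr ltrDl.
rewrite in_itv /= gt_max => /andP[/andP[q0 qe] qth].
have qe' : theta - ratr q < e by lra.
have := rat_le q s _ _ (he _ q0 (ltW qth) qe').
rewrite q0 (le_trans (ltW qth) th1) s0 (le_trans (ltW sP) Pm) => /(_ isT isT) h.
have := le_trans h (mono _ q0 (ltW qth)); rewrite df lee_fin leNgt => /negP; apply.
exact: ds.
Qed.

End ThetaMonotone.

Lemma idim_ge0 (R : realType) n theta (F : set 'rV[R]_n) :
  (0 <= lower_idim theta F)%E /\ (0 <= upper_idim theta F)%E.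
Proof. by split; apply: le_ereal_inf_tmp => _ [s [s0 _] <-]; rewrite lee_fin. Qed.

Theorem theorem5p1 (R : realType) (n m : nat)
    (n_ge1 : (1 <= n)%N) (m_ge1 : (1 <= m)%N) (le_mn : (m <= n)%N)
    (E : set 'rV[R]_n) (E_neq0 : E !=set0) (E_bounded : bounded_set E) :
  (forall (V : Gr R le_mn) (theta : R), 0 < theta <= 1 ->
     (lower_idim theta (orthoproj (val V) @` E)
        <= (lower_profile m theta E)%:E)%E /\
     (upper_idim theta (orthoproj (val V) @` E)
        <= (upper_profile m theta E)%:E)%E) /\
  (forall gamma : probability (borel (Gr R le_mn)) R,
     rotation_invariant le_mn gamma ->
     {ae gamma, forall V : Gr R le_mn, forall theta : R, 0 < theta <= 1 ->
        lower_idim theta (orthoproj (val V) @` E)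
          = (lower_profile m theta E)%:E /\
        upper_idim theta (orthoproj (val V) @` E)
          = (upper_profile m theta E)%:E}).
Proof.
have upper (V : Gr R le_mn) theta : 0 < theta <= 1 ->
   (lower_idim theta (orthoproj (val V) @` E) <= (lower_profile m theta E)%:E)%E /\
   (upper_idim theta (orthoproj (val V) @` E) <= (upper_profile m theta E)%:E)%E.
  move=> th01; have dV : \dim (val V) = m by apply/eqP; exact: (valP V).
  by split; [exact: lower_idim_projection_le|exact: upper_idim_projection_le].
split => // gamma inv.
have H1 : {ae gamma, forall V : Gr R le_mn, forall q s : rat,
    0 < (ratr q : R) <= 1 -> 0 <= (ratr s : R) <= m%:R ->
    ((ratr s)%:E < limf_einf (log_capacity m (ratr q) (ratr s) E) 0^'+)%E ->
    ((ratr s)%:E <= lower_idim (ratr q) (orthoproj (val V) @` E))%E}.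
  apply: ae_forall_rat2 => q s.
  have [q01|nq] := pselect (0 < (ratr q : R) <= 1); last exact: aeW.
  have [s01|ns] := pselect (0 <= (ratr s : R) <= m%:R); last exact: aeW.
  have [l|nl] := pselect ((ratr s)%:E < limf_einf (log_capacity m (ratr q) (ratr s) E) 0^'+)%E; last exact: aeW.
  by apply: ae_mono (ae_lower_idim_ge m_ge1 inv E_neq0 E_bounded q01 s01 l) => V.
have H2 : {ae gamma, forall V : Gr R le_mn, forall q s : rat,
    0 < (ratr q : R) <= 1 -> 0 <= (ratr s : R) <= m%:R ->
    ((ratr s)%:E < limf_esup (log_capacity m (ratr q) (ratr s) E) 0^'+)%E ->
    ((ratr s)%:E <= upper_idim (ratr q) (orthoproj (val V) @` E))%E}.
  apply: ae_forall_rat2 => q s.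
  have [q01|nq] := pselect (0 < (ratr q : R) <= 1); last exact: aeW.
  have [s01|ns] := pselect (0 <= (ratr s : R) <= m%:R); last exact: aeW.
  have [l|nl] := pselect ((ratr s)%:E < limf_esup (log_capacity m (ratr q) (ratr s) E) 0^'+)%E; last exact: aeW.
  by apply: ae_mono (ae_upper_idim_ge m_ge1 inv E_neq0 E_bounded q01 s01 l) => V.
(* The exceptional set was fixed by the rational pairs before theta is introduced. *)
apply: ae_mono2 H1 H2 => V h1 h2 theta th01.
have [u1 u2] := upper V theta th01.
split; apply/le_anti/andP; split => //.
  have [P01 _] := lower_profileP m E_neq0 E_bounded th01.
  apply: (le_of_rational_pairs th01 P01 (dim := fun q => lower_idim q (orthoproj (val V) @` E))
    (good := fun q s => (s%:E < limf_einf (log_capacity m q s E) 0^'+)%E)) => //.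
  - by have [] := idim_ge0 theta (orthoproj (val V) @` E).
  - by move=> q q0 qth; exact: lower_idim_theta.
  - by move=> s s0 sP; exact: lower_profile_gap.
have [P01 _] := upper_profileP m E_neq0 E_bounded th01.
apply: (le_of_rational_pairs th01 P01 (dim := fun q => upper_idim q (orthoproj (val V) @` E))
  (good := fun q s => (s%:E < limf_esup (log_capacity m q s E) 0^'+)%E)) => //.
- by have [] := idim_ge0 theta (orthoproj (val V) @` E).
- by move=> q q0 qth; exact: upper_idim_theta.
- by move=> s s0 sP; exact: upper_profile_gap.
Qed.
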